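(* Let $m\ge2$, $n\ge1$, let $M$ be an $m$-dimensional submanifold of $\mathbb{R}^{m+n}$ with second fundamental form $\alpha$, and let $\gamma\colon I\to M$ be a smooth regular embedded curve on an interval $I$. Suppose that $\gamma$ is never parallel to an asymptotic direction of $M$, i.e., that $\alpha(\dot\gamma,\dot\gamma)$ never vanishes. Suppose further that the linear map $\alpha_t=\alpha(\dot\gamma(t),\cdot)\colon T_{\gamma(t)}M\to N_{\gamma(t)}M$ has rank one for all $t\in I$. Then there exists a rank-one approximation of $M$ along $\gamma$. Such an approximation is locally unique (any two coincide on an open set containing $\gamma(I)$), and may be constructed as follows when $I$ is closed (with $\gamma$ taken to be unit-speed). Let $(E_1,\dots,E_m)$ be a smooth orthonormal frame for $TM$ along $\gamma$ with $E_1=\dot\gamma$. Choose a smooth section $N$ of the normal bundle of $M$ along $\gamma$ such that the orthogonal projection of $\overline{D}_tN$ onto $T_{\gamma(t)}M$ is nonvanishing. For $j=1,\dots,m-1$ set $$X_j=\bigl(\overline{D}_tE_{j+1}\cdot N\bigr)E_1-\bigl(\overline{D}_tE_1\cdot N\bigr)E_{j+1}.$$ Then, for sufficiently small $\varepsilon>0$, the approximation is the image of $\sigma\colon I\times(-\varepsilon,\varepsilon)^{m-1}\to\mathbb{R}^{m+n}$, $\sigma(t,u^1,\dots,u^{m-1})=\gamma(t)+\sum_{j=1}^{m-1}u^jX_j(t)$.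
   Context: $N_pM$ is the normal space of $M$ at $p$. $\overline{D}_t$ is the Euclidean covariant derivative along $\gamma$ (componentwise $t$-derivative), and the dot is the Euclidean inner product. A submanifold of $\mathbb{R}^{m+n}$ is a (first-order) approximation of $M$ along $\gamma$ if it contains $\gamma$ and has the same tangent bundle as $M$ along $\gamma$. An $m$-dimensional embedded submanifold $S$ of $\mathbb{R}^{m+n}$ with second fundamental form $\alpha^S$ is rank-one if at every $p\in S$ the nullity space $\{x\in T_pS\mid\alpha^S(x,\cdot)=0\}$ has dimension $m-1$; equivalently, $S$ has no point where $\alpha^S$ vanishes, is foliated by open subsets of $(m-1)$-dimensional affine subspaces, and its tangent space is constant along each of them. Submanifolds are considered locally, near $\gamma(I)$.
   Formalization: If I has end points, approximations are submanifolds with boundary, the boundary meeting γ exactly there and made of leaves (otherwise uniqueness fails: one can continue arbitrarily past an end point); in the construction, ''I is closed'' means I compact. *)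

(* Defs.v *)
From mathcomp Require Import all_boot all_order all_algebra.
From mathcomp Require Import all_classical all_reals all_analysis.

Set Implicit Arguments.
Unset Strict Implicit.
Unset Printing Implicit Defensive.

Import Order.TTheory GRing.Theory Num.Theory.
Import numFieldNormedType.Exports.

Local Open Scope ring_scope.
Local Open Scope classical_set_scope.

Fixpoint class_C (R : realType) (V W : normedModType R) (k : nat)
    (U : set V) (f : V -> W) : Prop :=
  match k with
  | 0 => forall x, U x -> {for x, continuous f}
  | k'.+1 => (forall x, U x -> differentiable f x) /\
             (forall v, class_C k' U ('D_v f))
  end.

(* On a set that need not be open, smooth means: smooth on some open
   neighbourhood of it.  In particular a curve on an interval with end points is
   given through a smooth extension past them, so that its derivative on the
   closed interval is an ordinary two-sided derivative; that derivative depends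
   only on the values on the interval, as the interval is nondegenerate. *)
Definition smooth_on (R : realType) (V W : normedModType R)
    (A : set V) (f : V -> W) : Prop :=
  exists U : set V, [/\ open U, A `<=` U & forall k, class_C k U f].

Definition embeds (T U : topologicalType) (A : set T) (f : T -> U) : Prop :=
  exists g : U -> T, [/\ (forall x, A x -> g (f x) = x),
    {within A, continuous f} & {within f @` A, continuous g}].

Section Euclidean.
Variables (R : realType) (N : nat).
Implicit Types (A : set 'rV[R]_N) (x y z : 'rV[R]_N).

Definition dot x y : R := \sum_(i < N) x 0 i * y 0 i.

(* [A] is a linear subspace of dimension [d]. *)
Definition has_dim A (d : nat) : Prop :=
  exists V : {vspace 'rV[R]_N}, (forall x, A x <-> x \in V) /\ \dim V = d.

(* The orthogonal projection of [z] onto a linear subspace [A]. *)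
Definition orthproj A z : 'rV[R]_N :=
  xget 0 [set y | A y /\ forall x, A x -> dot (z - y) x = 0].

End Euclidean.

Section Submanifolds.
Variables (R : realType) (N m : nat).
Implicit Types (S M : set 'rV[R]_N) (U : set 'rV[R]_m)
  (phi : 'rV[R]_m -> 'rV[R]_N) (p x y z : 'rV[R]_N) (g : R -> 'rV[R]_N).

Definition half_space : set 'rV[R]_m :=
  [set a | forall i : 'I_m, i = 0%N :> nat -> 0 <= a 0 i].

Definition half_space_bd : set 'rV[R]_m :=
  [set a | forall i : 'I_m, i = 0%N :> nat -> a 0 i = 0].

Definition model (b : bool) : set 'rV[R]_m := if b then half_space else setT.

(* A local parametrization of [S] as a submanifold with boundary (interior one
   when [b = false]): [phi] is a smooth immersion of the open set [U], whose
   restriction to [U `&` model b] is an embedding onto an open subset of [S]. *)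
Definition local_param S (b : bool) U phi : Prop :=
  [/\ open U, smooth_on U phi,
      forall a, U a -> forall v, 'd phi a v = 0 -> v = 0,
      embeds (U `&` model b) phi &
      exists O : set 'rV[R]_N, open O /\ S `&` O = phi @` (U `&` model b)].

(* [phi] is a local parametrization of [S] with [phi a = p]. *)
Definition param_at S p (b : bool) U phi (a : 'rV[R]_m) : Prop :=
  [/\ local_param S b U phi, (U `&` model b) a & phi a = p].

(* m-dimensional embedded submanifolds of R^N, possibly with boundary. *)
Definition submanifold S : Prop :=
  forall p, S p -> exists b U phi a, param_at S p b U phi a.

Definition boundary S : set 'rV[R]_N :=
  [set p | exists U phi a, param_at S p true U phi a /\ half_space_bd a].

Definition tangent S p : set 'rV[R]_N :=
  [set x | exists b U phi a, param_at S p b U phi a /\ exists v, x = 'd phi a v].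

Definition normal S p : set 'rV[R]_N :=
  [set z | forall x, tangent S p x -> dot z x = 0].

(* The second fundamental form of [S] at [p]: the normal component of the
   Euclidean derivative along [x] of a tangent extension of [y] (Gauss formula),
   the extension being the one with constant coefficients in a parametrization;
   the value does not depend on the parametrization. *)
Definition sff S p x y : 'rV[R]_N :=
  xget 0 [set z | exists b U phi a v w,
    [/\ param_at S p b U phi a, x = 'd phi a v, y = 'd phi a w &
        z = 'D_v ('D_w phi) a - orthproj (tangent S p) ('D_v ('D_w phi) a)]].

Definition nullity S p : set 'rV[R]_N :=
  [set x | tangent S p x /\ forall y, tangent S p y -> sff S p x y = 0].

(* Without boundary, the nullity condition alone implies that [S] is foliated by
   open subsets of (m-1)-dimensional affine subspaces.  When [S] has boundary the
   leaves through boundary points have to be required to be open too; this forces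
   the boundary to be a union of leaves. *)
Definition rank_one S : Prop :=
  [/\ submanifold S,
      forall p, S p -> has_dim (nullity S p) m.-1 &
      forall p, boundary S p ->
        \forall x \near (0 : 'rV[R]_N), nullity S p x -> S (p + x)].

(* First-order approximations of [M] along [g : I -> M].  As submanifolds are
   considered only near the curve, an approximation has no boundary when [I] is
   open, and otherwise its boundary meets the curve exactly in the end points of
   the curve: the approximation does not extend beyond the curve. *)
Definition approximation M (I : set R) g S : Prop :=
  [/\ submanifold S,
      g @` I `<=` S,
      forall t, I t -> tangent S (g t) = tangent M (g t),
      forall t, I t -> (boundary S (g t) <-> ~ I° t) &
      open I -> boundary S = set0].

Definition rank_one_approximation M (I : set R) g S : Prop :=
  rank_one S /\ approximation M I g S.

(* Only the vectors of index in {1, ..., m} matter. *)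
Definition tangent_frame M (I : set R) g (E : nat -> R -> 'rV[R]_N) : Prop :=
  [/\ forall i, (1 <= i <= m)%N -> smooth_on I (E i),
      forall i t, (1 <= i <= m)%N -> I t -> tangent M (g t) (E i t),
      forall i j t, (1 <= i <= m)%N -> (1 <= j <= m)%N -> I t ->
        dot (E i t) (E j t) = (i == j)%:R &
      forall t, I t -> E 1%N t = derive1 g t].

Definition admissible_normal M (I : set R) g (nu : R -> 'rV[R]_N) : Prop :=
  [/\ smooth_on I nu,
      forall t, I t -> normal M (g t) (nu t) &
      forall t, I t -> orthproj (tangent M (g t)) (derive1 nu t) != 0].

(* The vector field X_j, for 1 <= j <= m-1. *)
Definition ruling (E : nat -> R -> 'rV[R]_N) (nu : R -> 'rV[R]_N) (j : nat)
    (t : R) : 'rV[R]_N :=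
  dot (derive1 (E j.+1) t) (nu t) *: E 1%N t
  - dot (derive1 (E 1%N) t) (nu t) *: E j.+1 t.

(* Coordinates are numbered from 0 and the X_j from 1: [u 0 j] multiplies X_(j+1). *)
Definition ruled_map g (E : nat -> R -> 'rV[R]_N) (nu : R -> 'rV[R]_N)
    (t : R) (u : 'rV[R]_m.-1) : 'rV[R]_N :=
  g t + \sum_(j < m.-1) u 0 j *: ruling E nu j.+1 t.

Definition ruled_image (I : set R) g (E : nat -> R -> 'rV[R]_N)
    (nu : R -> 'rV[R]_N) (e : R) : set 'rV[R]_N :=
  [set p | exists t (u : 'rV[R]_m.-1),
    [/\ I t, forall j, - e < u 0 j < e & p = ruled_map g E nu t u]].

End Submanifolds.

(* Main.v *)
(* Let P t be the orthogonal projection onto the tangent space of M at g t and A t = P t P' t (1 - P t):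
   for tangent y, y A t is the second fundamental form of g' t and y.  As it has rank one and g' A
   does not vanish, the tangent space is spanned by g' t and the leaf K t = {y | y P t = y, y A t = 0}.

   Existence: the points g t + x, with x in K t small (locally uniformly in t), form a submanifold
   ruled by the K t.  Differentiating Y P = Y for sections Y of K gives Y' (1 - P) = Y A = 0, so the
   tangent space along the leaf through g t is constant, equal to the one at g t, whence rank one.  The fields X_j
   form a basis of K t.

   Uniqueness: parametrize a rank-one approximation by Phi so that its second fundamental form vanishes
   exactly when the second derivative of Phi does, and let l_y v = D_v D_e Phi_i y / D_e D_e Phi_i y with
   e the direction of g.  Rank one means D_u D_v Phi_i D_e D_e Phi_i = D_u D_e Phi_i D_v D_e Phi_i;
   differentiating this along e shows that l is constant to first order along its own kernel, so
   by Gronwall l is constant, and Phi affine, on the segments issued from y in the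
   direction of ker l_y.  A small segment of the leaf through a point near g t0 is thus straight, and
   by the intermediate value theorem its affine span meets g; so the approximation agrees near g t0 with
   the union of the g t + x.  At an end point of g the boundary is itself a leaf, so that the domain of
   Phi is a half-space bounded by a translate of ker l. *)

Require Import Defs.
From HB Require Import structures.
From mathcomp Require Import all_boot all_order all_algebra.
From mathcomp Require Import all_classical all_reals all_analysis.
From mathcomp Require Import ring lra.

Set Implicit Arguments.
Unset Strict Implicit.
Unset Printing Implicit Defensive.

Import Order.TTheory GRing.Theory Num.Theory.
Import numFieldNormedType.Exports.

Local Open Scope ring_scope.
Local Open Scope classical_set_scope.

(** * Smooth maps *)

Section ClassC.
Context {R : realType}.
Implicit Types V W X : normedModType R.

(** Tangent spaces enter through their orthogonal projections, matrices acting on row vectors from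
    the right. Needing no choice of basis, they are defined along the whole curve at once, and
    differentiating [Y P = Y] takes the place of computations in frames. Two obstacles shape the
    proof. At an end point of [I], as on the boundary of a half-space chart, identities hold on one
    side only; they can still be differentiated along [v] when a short ray along [v] or [- v] stays
    in the set, because all functions are smooth on a full neighbourhood. This is also why, for
    uniqueness, the product rule is applied along [e] alone: [e] is the direction known to point
    into the chart. Secondly, if [I] is not compact, leaves through distant points of the curve must
    be kept apart. The predicate [good] therefore compares points over parameters near [t] with
    points over all of [I]; for distant parameters its lower bound comes from the embeddedness of
    the curve. *)

Lemma differentiable_epsP V W (f : V -> W) (x : V) (l : {linear V -> W}) :
  continuous l ->
  (forall e, 0 < e -> \forall h \near (0 : V), `|f (h + x) - f x - l h| <= e * `|h|) ->
  differentiable f x /\ 'd f x = l :> (V -> W).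
Proof.
move=> lc H.
have E : f \o shift x = cst (f x) + l +o_ (0 : V) id.
  apply/eqaddoP => e e0 /=; near=> h.
  have -> : (f \o shift x - (cst (f x) + l)) h = f (h + x) - f x - l h.
    by rewrite /= !fctE /= opprD addrA.
  by near: h; exact: H.
have dE := diff_unique lc E.
split=> //; apply/diff_locallyP; rewrite dE; split => //.
Unshelve. all: by end_near. Qed.

Lemma differentiable_eps V W (f : V -> W) (x : V) :
  differentiable f x ->
  forall e, 0 < e -> \forall h \near (0 : V), `|f (h + x) - f x - 'd f x h| <= e * `|h|.
Proof.
move=> /diff_locally H e e0.
have /eqaddoP/(_ e e0) := H; apply: filterS => h /=.
by rewrite !fctE /= opprD addrA.
Qed.

Lemma near_eq_differentiable V W (f g : V -> W) (x : V) :
  (\forall y \near x, f y = g y) -> differentiable f x -> differentiable g x.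
Proof.
move=> fg df; apply: (differentiable_epsP (l := 'd f x) _ _).1.
  exact: diff_continuous.
move=> e e0; have H := differentiable_eps df e0.
have fgx := nbhs_singleton fg.
have : \forall h \near (0 : V), f (h + x) = g (h + x).
  by move: fg; rewrite (near_shift 0) /=; apply: filterS => h; rewrite subr0.
by move=> fg'; near=> h; rewrite -fgx -(near fg' h) //; near: h.
Unshelve. all: by end_near. Qed.

Lemma class_CS V W k U (f : V -> W) : class_C k.+1 U f -> class_C k U f.
Proof.
elim: k f => [|k IH] f [df Df]; first by move=> x /df; exact: differentiable_continuous.
by split=> // v; apply: IH.
Qed.

Lemma class_C_sub V W k (A B : set V) (f : V -> W) :
  A `<=` B -> class_C k B f -> class_C k A f.
Proof.
move=> AB; elim: k f => [|k IH] f /=; first by move=> fc x /AB; exact: fc.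
by move=> [df Df]; split=> [x /AB|v]; [exact: df|exact: IH].
Qed.

Lemma class_C_eq V W k (U : set V) (f g : V -> W) : open U ->
  (forall x, U x -> f x = g x) -> class_C k U f -> class_C k U g.
Proof.
move=> oU; elim: k f g => [|k IH] f g fg /=.
  move=> fc x Ux; have nU : \forall y \near x, f y = g y.
    by near=> y; apply: fg; near: y; exact: open_nbhs_nbhs.
  rewrite /prop_for /continuous_at -(fg _ Ux).
  by apply: cvg_trans (fc x Ux); apply: near_eq_cvg.
move=> [df Df]; split=> [x Ux|v].
  apply: near_eq_differentiable (df x Ux).
  by near=> y; apply: fg; near: y; exact: open_nbhs_nbhs.
apply: (IH ('D_v f)) (Df v) => x Ux; apply: near_eq_derive.
by near=> y; apply: fg; near: y; exact: open_nbhs_nbhs.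
Unshelve. all: by end_near. Qed.

Lemma class_C_cst V W k (U : set V) (c : W) : class_C k U (fun _ : V => c).
Proof.
elim: k c => [|k IH] c /=; first by move=> x _; exact: cst_continuous.
split=> [x _|v]; first exact: differentiable_cst.
have -> : 'D_v (fun _ : V => c) = (fun _ => 0) by apply/funext => x; exact: derive_cst.
exact: IH.
Qed.

Lemma class_C_lin V W k (U : set V) (f : {linear V -> W}) :
  continuous f -> class_C k U f.
Proof.
move=> fc; case: k => [|k] /=; first by move=> x _; exact: fc.
split=> [x _|v]; first exact: linear_differentiable.
have -> : 'D_v f = (fun _ => f v).
  by apply/funext => x; rewrite deriveE ?diff_lin//; exact: linear_differentiable.
exact: class_C_cst.
Qed.

Lemma class_CD V W k (U : set V) (f g : V -> W) : open U ->
  class_C k U f -> class_C k U g -> class_C k U (fun x => f x + g x).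
Proof.
move=> oU; elim: k f g => [|k IH] f g /=.
  by move=> fc gc x Ux; apply: cvgD; [exact: fc|exact: gc].
move=> [df Df] [dg Dg]; split=> [x Ux|v].
  by apply: differentiableD; [exact: df|exact: dg].
apply: class_C_eq oU _ (IH _ _ (Df v) (Dg v)) => x Ux.
by rewrite -deriveD//; apply: diff_derivable; [exact: df|exact: dg].
Qed.

Lemma class_CM V k (U : set V) (f g : V -> R) : open U ->
  class_C k U f -> class_C k U g -> class_C k U (fun x => f x * g x).
Proof.
move=> oU; elim: k f g => [|k IH] f g.
  by move=> /= fc gc x Ux; apply: cvgM; [exact: fc|exact: gc].
move=> Cf Cg; have [df Df] := Cf; have [dg Dg] := Cg.
split=> [x Ux|v].
  by apply: differentiableM; [exact: df|exact: dg].
have := class_CD oU (IH _ _ (Df v) (class_CS Cg)) (IH _ _ (class_CS Cf) (Dg v)).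
apply: class_C_eq => // x Ux; rewrite [RHS]deriveM; last 2 first.
- by apply: diff_derivable; exact: df.
- by apply: diff_derivable; exact: dg.
by rewrite addrC /= !/GRing.scale /= [g x * _]mulrC.
Qed.

Lemma class_CV V k (U : set V) (f : V -> R) : open U ->
  (forall x, U x -> f x != 0) ->
  class_C k U f -> class_C k U (fun x => (f x)^-1).
Proof.
move=> oU f0; elim: k => [|k IH].
  by move=> /= fc x Ux; apply: cvgV; [exact: f0|exact: fc].
move=> Cf; have [df Df] := Cf; have IH' := IH (class_CS Cf).
split=> [x Ux|v].
  by apply: differentiableV; [exact: df|exact: f0].
have := class_CM oU (class_CM oU (class_C_cst _ _ (-1 : R)) (Df v)) (class_CM oU IH' IH').
apply: class_C_eq => // x Ux; rewrite [RHS]deriveV; last 2 first.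
- exact: f0.
- by apply: diff_derivable; exact: df.
rewrite /GRing.scale /= mulN1r mulNr [in RHS]mulNr; congr (- _).
by rewrite mulrC expr2 invfM.
Qed.

Lemma class_C_sum V (I : Type) (r : seq I) (P : pred I) k (U : set V)
  (f : I -> V -> R) : open U ->
  (forall i, P i -> class_C k U (f i)) -> class_C k U (fun x => \sum_(i <- r | P i) f i x).
Proof.
move=> oU Cf; elim: r => [|i r IH].
  by apply: class_C_eq (class_C_cst _ _ (0 : R)) => // x _; rewrite big_nil.
have [Pi|nPi] := boolP (P i).
  by apply: class_C_eq (class_CD oU (Cf i Pi) IH) => // x _; rewrite big_cons Pi.
by apply: class_C_eq IH => // x _; rewrite big_cons (negbTE nPi).
Qed.

Lemma mx_entry_le m n (M : 'M[R]_(m, n)) i j : `|M i j| <= `|M|.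
Proof.
by rewrite [leRHS]/Num.Def.normr/= mx_normrE; exact: (le_bigmax _ _ (i, j)).
Qed.

Lemma mx_norm_le m n (M : 'M[R]_(m, n)) e : 0 <= e ->
  (forall i j, `|M i j| <= e) -> `|M| <= e.
Proof.
by move=> e0 H; rewrite /Num.Def.normr/= mx_normrE (bigmax_le _ e0)//= => -[].
Qed.

(** The differential is assembled entry by entry. There are finitely many entries, so their
    estimates hold on a common neighbourhood; [V] is any normed space, so the continuity of the
    assembled linear map has to be proved too. *)
Lemma differentiable_mxP V m n (F : V -> 'M[R]_(m, n)) x :
  (forall i j, differentiable (fun y => F y i j) x) <-> differentiable F x.
Proof.
split=> [dF|dF i j]; last first.
  exact: (differentiable_comp dF (differentiable_coord _ i j)).
pose l v : 'M[R]_(m, n) := \matrix_(i, j) 'd (fun y => F y i j) x v.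
have ll : linear l by move=> k u v; apply/matrixP => i j; rewrite !mxE linearP.
pose lM := GRing.isLinear.Build _ _ _ _ _ ll.
pose lL : {linear _ -> _} := HB.pack l lM.
have lc : continuous lL.
  move=> y; apply/cvgrPdist_le => e e0.
  have H : \forall t \near y, forall ij : 'I_m * 'I_n,
     `|'d (fun y => F y ij.1 ij.2) x y - 'd (fun y => F y ij.1 ij.2) x t| <= e.
    apply: filter_forall => ij.
    have := diff_continuous (dF ij.1 ij.2); move=> /(_ y)/cvgrPdist_le; exact.
  apply: filterS H => t Ht; apply: mx_norm_le; first exact: ltW.
  by move=> i j; rewrite !mxE; exact: (Ht (i, j)).
apply: (differentiable_epsP lc _).1 => e e0.
have H : \forall h \near (0 : V), forall ij : 'I_m * 'I_n,
     `|F (h + x) ij.1 ij.2 - F x ij.1 ij.2 - 'd (fun y => F y ij.1 ij.2) x h| <= e * `|h|.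
  apply: filter_forall => ij; exact: differentiable_eps.
apply: filterS H => t Ht; apply: mx_norm_le; first by rewrite mulr_ge0 // ltW.
by move=> i j; rewrite !mxE; exact: (Ht (i, j)).
Qed.

Lemma continuous_mxP V m n (F : V -> 'M[R]_(m, n)) x :
  (forall i j, {for x, continuous (fun y => F y i j)}) <-> {for x, continuous F}.
Proof.
split=> [cF|cF i j]; last first.
  exact: (continuous_comp cF (@coord_continuous _ _ _ i j _)).
apply/cvgrPdist_le => e e0.
have H : \forall t \near x, forall ij : 'I_m * 'I_n,
     `|F x ij.1 ij.2 - F t ij.1 ij.2| <= e.
  apply: filter_forall => ij.
  by have /cvgrPdist_le := cF ij.1 ij.2; exact.
apply: filterS H => t Ht; apply: mx_norm_le; first exact: ltW.
by move=> i j; rewrite !mxE; exact: (Ht (i, j)).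
Qed.

Lemma derive_entry V m n (F : V -> 'M[R]_(m, n)) x v i j :
  differentiable F x -> 'D_v F x i j = 'D_v (fun y => F y i j) x.
Proof. by move=> dF; rewrite derive_mx ?mxE//; exact: diff_derivable. Qed.

Lemma class_C_mxP V m n k (U : set V) (F : V -> 'M[R]_(m, n)) : open U ->
  (forall i j, class_C k U (fun y => F y i j)) <-> class_C k U F.
Proof.
move=> oU; elim: k F => [|k IH] F.
  split=> [cF x Ux|cF i j x Ux]; first by apply/continuous_mxP => i j; exact: cF.
  by move/continuous_mxP : (cF x Ux); exact.
split=> [CF|[dF DF] i j].
  have dF x : U x -> differentiable F x.
    by move=> Ux; apply/differentiable_mxP => i j; have [+ _] := CF i j; exact.
  split=> // v; apply/IH => i j; have [_ /(_ v)] := CF i j.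
  by apply: class_C_eq => // x Ux; rewrite derive_entry//; exact: dF.
split=> [x Ux|v]; first by move/differentiable_mxP : (dF x Ux); exact.
move/IH : (DF v) => /(_ i j); apply: class_C_eq => // x Ux.
by rewrite derive_entry//; exact: dF.
Qed.

Lemma derive_comp V X W (f : X -> W) (h : V -> X) x v :
  differentiable h x -> differentiable f (h x) ->
  'D_v (f \o h) x = 'D_('D_v h x) f (h x).
Proof.
move=> dh df; rewrite !deriveE//; last exact: differentiable_comp.
by rewrite diff_comp.
Qed.

Lemma class_C_linear V X W (p : {linear X -> W}) k (U : set V) (g : V -> X) :
  open U -> continuous p -> class_C k U g -> class_C k U (p \o g).
Proof.
move=> oU pc; elim: k g => [|k IH] g.
  move=> /= gc x Ux; apply: continuous_comp; first exact: gc.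
  exact: pc.
move=> [dg Dg]; split=> [x Ux|w].
  apply: differentiable_comp; first exact: dg.
  exact: linear_differentiable.
have := IH _ (Dg w); apply: class_C_eq => // x Ux.
rewrite /= [RHS]derive_comp; last 2 first.
- exact: dg.
- exact: linear_differentiable.
by rewrite [RHS]deriveE ?diff_lin//; exact: linear_differentiable.
Qed.

(* [e] and [p] play the role of a finite basis of [X] and its coordinates. *)
Lemma class_C_comp_fin V X n (e : 'I_n -> X) (p : 'I_n -> {linear X -> R})
  (U : set V) (A : set X) (h : V -> X) (f : X -> R) k :
  (forall i, continuous (p i)) -> (forall x, x = \sum_i p i x *: e i) ->
  open U -> open A -> (forall x, U x -> A (h x)) ->
  class_C k U h -> class_C k A f -> class_C k U (f \o h).
Proof.
move=> pc pe oU oA hUA.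
elim: k f => [|k IH] f.
  move=> /= hc fc x Ux; apply: continuous_comp; first exact: hc.
  by apply: fc; exact: hUA.
move=> Ch Cf; have [dh Dh] := Ch; have [df Df] := Cf.
split=> [x Ux|v].
  by apply: differentiable_comp; [exact: dh|apply: df; exact: hUA].
(* One summand of the chain rule: the [i]-th coordinate of ['D_v h] times the [i]-th partial
   derivative of [f] at [h x]. The second factor is again a composite, of lower order. *)
have H i : class_C k U (fun x => 'D_v (p i \o h) x * ('D_(e i) f \o h) x).
  apply: class_CM => //; last exact: IH (class_CS Ch) (Df _).
  have := class_C_linear oU (pc i) (Dh v).
  apply: class_C_eq => // x Ux.
  rewrite derive_comp; last 2 first.
  - exact: dh.
  - exact: linear_differentiable.
  by rewrite [RHS]deriveE ?diff_lin//; try exact: linear_differentiable; exact: pc.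
have := @class_C_sum V _ (index_enum 'I_n) xpredT k U _ oU (fun i _ => H i).
apply: class_C_eq => // x Ux.
rewrite [RHS]derive_comp; last 2 first.
- exact: dh.
- by apply: df; exact: hUA.
have dfx : differentiable f (h x) by apply: df; exact: hUA.
rewrite [RHS]deriveE// [X in 'd f _ X]pe linear_sum; apply: eq_bigr => i _.
rewrite linearZ /= [in RHS]/GRing.scale /= -deriveE//; congr (_ * _).
rewrite derive_comp; last 2 first.
- exact: dh.
- exact: linear_differentiable.
by rewrite deriveE ?diff_lin//; try exact: linear_differentiable; exact: pc.
Qed.

End ClassC.

Lemma near_open (T : topologicalType) (x : T) (P : T -> Prop) :
  (\forall y \near x, P y) -> exists B : set T, [/\ open B, B x & forall y, B y -> P y].
Proof.
move=> H; have : nbhs x P by exact: H.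
by rewrite nbhsE => -[B [oB Bx] BP]; exists B.
Qed.

Section SmoothAt.
Context {R : realType}.
Implicit Types V W X : normedModType R.

Definition smooth_at V W (f : V -> W) (x : V) := smooth_on [set x] f.

Lemma smooth_atE V W (f : V -> W) (x : V) :
  smooth_at f x <-> exists U : set V, [/\ open U, U x & forall k, class_C k U f].
Proof.
split=> [[U [oU xU CU]]|[U [oU Ux CU]]]; exists U; split=> //; first exact: xU.
by move=> _ ->.
Qed.

Lemma class_C_bigcup V W (I : Type) (D : set I) (U : I -> set V) k (f : V -> W) :
  (forall i, D i -> class_C k (U i) f) -> class_C k (\bigcup_(i in D) U i) f.
Proof.
elim: k f => [|k IH] f H; first by move=> x [i Di Uix]; exact: H Uix.
split=> [x [i Di Uix]|v]; first exact: (H i Di).1.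
by apply: IH => i Di; exact: (H i Di).2.
Qed.

(** [class_C k U] only constrains the points of [U], so the neighbourhoods chosen for the points of
    [A] can be united, and the union serves every [k]. *)
Lemma smooth_onP V W (A : set V) (f : V -> W) :
  smooth_on A f <-> forall x, A x -> smooth_at f x.
Proof.
split=> [[U [oU AU CU]] x Ax|H].
  by apply/smooth_atE; exists U; split=> //; exact: AU.
have /choice[U HU] x : exists U : set V, A x -> [/\ open U, U x & forall k, class_C k U f].
  have [Ax|nAx] := pselect (A x); last by exists setT.
  by have /smooth_atE[U HU] := H x Ax; exists U.
exists (\bigcup_(x in A) U x); split.
- by apply: bigcup_open => x /HU[].
- by move=> x Ax; exists x => //; have [] := HU x Ax.
- by move=> k; apply: class_C_bigcup => x /HU[].
Qed.

Lemma smooth_near V W (f : V -> W) x : smooth_at f x -> \forall y \near x, smooth_at f y.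
Proof.
move=> /smooth_atE[U [oU Ux CU]]; near=> y; apply/smooth_atE; exists U; split=> //.
by near: y; exact: open_nbhs_nbhs.
Unshelve. all: by end_near. Qed.

Lemma smooth_at_eq V W (f g : V -> W) x :
  (\forall y \near x, f y = g y) -> smooth_at f x -> smooth_at g x.
Proof.
move=> /near_open[B [oB Bx fg]] /smooth_atE[U [oU Ux CU]].
apply/smooth_atE; exists (U `&` B); split=> //; first exact: openI.
move=> k; apply: class_C_eq (class_C_sub _ (CU k)); first exact: openI.
  by move=> y [_ /fg].
by move=> y [].
Qed.

Lemma smooth_diff V W (f : V -> W) x : smooth_at f x -> differentiable f x.
Proof. by move=> /smooth_atE[U [oU Ux /(_ 1%N)[+ _]]]; exact. Qed.

Lemma smooth_cont V W (f : V -> W) x : smooth_at f x -> {for x, continuous f}.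
Proof. by move/smooth_diff; exact: differentiable_continuous. Qed.

Lemma smooth_derivable V W (f : V -> W) x v : smooth_at f x -> derivable f x v.
Proof. by move/smooth_diff; exact: diff_derivable. Qed.

Lemma smooth_derive V W (f : V -> W) v x : smooth_at f x -> smooth_at ('D_v f) x.
Proof.
move=> /smooth_atE[U [oU Ux CU]]; apply/smooth_atE; exists U; split=> // k.
by have [_] := CU k.+1; exact.
Qed.

Lemma smooth_cst V W (c : W) (x : V) : smooth_at (fun _ => c) x.
Proof.
apply/smooth_atE; exists setT; split=> //; first exact: openT.
by move=> k; exact: class_C_cst.
Qed.

Lemma smooth_linear V W (f : {linear V -> W}) x : continuous f -> smooth_at f x.
Proof.
move=> fc; apply/smooth_atE; exists setT; split=> //; first exact: openT.
by move=> k; exact: class_C_lin.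
Qed.

Lemma smooth_id V (x : V) : smooth_at (fun y => y) x.
Proof. by apply: (@smooth_linear _ _ idfun) => y; exact: cvg_id. Qed.

Let smooth2 V W W' W'' (f : V -> W) (g : V -> W') (h : V -> W'') x :
  (forall k U, open U -> class_C k U f -> class_C k U g -> class_C k U h) ->
  smooth_at f x -> smooth_at g x -> smooth_at h x.
Proof.
move=> H /smooth_atE[U [oU Ux CU]] /smooth_atE[U' [oU' Ux' CU']].
apply/smooth_atE; exists (U `&` U'); split=> // [|k]; first exact: openI.
apply: H; first exact: openI.
  by apply: class_C_sub (CU k) => y [].
by apply: class_C_sub (CU' k) => y [].
Qed.

Lemma smoothD V W (f g : V -> W) x :
  smooth_at f x -> smooth_at g x -> smooth_at (fun y => f y + g y) x.
Proof. by apply: smooth2 => k U oU; exact: class_CD. Qed.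

Lemma smoothM V (f g : V -> R) x :
  smooth_at f x -> smooth_at g x -> smooth_at (fun y => f y * g y) x.
Proof. by apply: smooth2 => k U oU; exact: class_CM. Qed.

Lemma smoothV V (f : V -> R) x : f x != 0 ->
  smooth_at f x -> smooth_at (fun y => (f y)^-1) x.
Proof.
move=> fx0 sf; have : \forall y \near x, f y != 0.
  exact: ((smooth_cont sf) _ (open_nbhs_nbhs (conj (@open_neq _ (0:R)) fx0))).
move=> /near_open[B [oB Bx f0]].
have /smooth_atE[U [oU Ux CU]] := sf.
apply/smooth_atE; exists (U `&` B); split=> // [|k]; first exact: openI.
apply: class_CV; first exact: openI.
  by move=> y [_ /f0].
by apply: class_C_sub (CU k) => y [].
Qed.

Lemma smooth_sum V (I : Type) (r : seq I) (P : pred I) (f : I -> V -> R) x :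
  (forall i, P i -> smooth_at (f i) x) ->
  smooth_at (fun y => \sum_(i <- r | P i) f i y) x.
Proof.
move=> sf; elim: r => [|i r IH].
  by apply: smooth_at_eq (smooth_cst (0 : R) x); near=> y; rewrite big_nil.
have [Pi|nPi] := boolP (P i).
  by apply: smooth_at_eq (smoothD (sf i Pi) IH); near=> y; rewrite big_cons Pi.
by apply: smooth_at_eq IH; near=> y; rewrite big_cons (negbTE nPi).
Unshelve. all: by end_near. Qed.

Lemma smooth_prod V (I : Type) (r : seq I) (P : pred I) (f : I -> V -> R) x :
  (forall i, P i -> smooth_at (f i) x) ->
  smooth_at (fun y => \prod_(i <- r | P i) f i y) x.
Proof.
move=> sf; elim: r => [|i r IH].
  by apply: smooth_at_eq (smooth_cst (1 : R) x); near=> y; rewrite big_nil.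
have [Pi|nPi] := boolP (P i).
  by apply: smooth_at_eq (smoothM (sf i Pi) IH); near=> y; rewrite big_cons Pi.
by apply: smooth_at_eq IH; near=> y; rewrite big_cons (negbTE nPi).
Unshelve. all: by end_near. Qed.

Lemma smooth_mxP V m n (F : V -> 'M[R]_(m, n)) x :
  smooth_at F x <-> forall i j, smooth_at (fun y => F y i j) x.
Proof.
split=> [/smooth_atE[U [oU Ux CU]] i j|H].
  apply/smooth_atE; exists U; split=> // k.
  by have /(class_C_mxP _ _ oU) := CU k; exact.
have /choice[U HU] (ij : 'I_m * 'I_n) : exists U : set V,
    [/\ open U, U x & forall k, class_C k U (fun y => F y ij.1 ij.2)].
  by have /smooth_atE := H ij.1 ij.2.
have nU : \forall y \near x, forall ij, U ij y.
  by apply: filter_forall => ij; apply: open_nbhs_nbhs; have [] := HU ij.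
have [B [oB Bx BU]] := near_open nU.
apply/smooth_atE; exists B; split=> // k; apply/(class_C_mxP _ _ oB) => i j.
have [_ _ /(_ k)] := HU (i, j); apply: class_C_sub => y /BU; exact.
Qed.

Lemma smoothN V m n (F : V -> 'M[R]_(m, n)) x :
  smooth_at F x -> smooth_at (fun y => - F y) x.
Proof.
move/smooth_mxP => H; apply/smooth_mxP => i j.
apply: smooth_at_eq (smoothM (smooth_cst (-1 : R) x) (H i j)).
by near=> y; rewrite mxE mulN1r.
Unshelve. all: by end_near. Qed.

Lemma smoothB V m n (F G : V -> 'M[R]_(m, n)) x :
  smooth_at F x -> smooth_at G x -> smooth_at (fun y => F y - G y) x.
Proof. by move=> ? ?; apply: smoothD => //; exact: smoothN. Qed.

Lemma smoothZ V m n (a : V -> R) (F : V -> 'M[R]_(m, n)) x :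
  smooth_at a x -> smooth_at F x -> smooth_at (fun y => a y *: F y) x.
Proof.
move=> sa /smooth_mxP H; apply/smooth_mxP => i j.
by apply: smooth_at_eq (smoothM sa (H i j)); near=> y; rewrite mxE.
Unshelve. all: by end_near. Qed.

Lemma smooth_tr V m n (F : V -> 'M[R]_(m, n)) x :
  smooth_at F x -> smooth_at (fun y => (F y)^T) x.
Proof.
move=> /smooth_mxP H; apply/smooth_mxP => i j.
by apply: smooth_at_eq (H j i); near=> y; rewrite mxE.
Unshelve. all: by end_near. Qed.

Lemma smooth_mulmx V m n p (F : V -> 'M[R]_(m, n)) (G : V -> 'M[R]_(n, p)) x :
  smooth_at F x -> smooth_at G x -> smooth_at (fun y => F y *m G y) x.
Proof.
move=> /smooth_mxP HF /smooth_mxP HG; apply/smooth_mxP => i j.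
apply: smooth_at_eq (@smooth_sum _ _ (index_enum 'I_n) xpredT _ _
  (fun k _ => smoothM (HF i k) (HG k j))).
by near=> y; rewrite mxE.
Unshelve. all: by end_near. Qed.

Lemma smooth_det V n (F : V -> 'M[R]_n) x :
  smooth_at F x -> smooth_at (fun y => \det (F y)) x.
Proof.
move=> /smooth_mxP HF.
apply: smooth_sum => s _; apply: smoothM; first exact: smooth_cst.
by apply: smooth_prod => i _; exact: HF.
Qed.

Lemma near_unitmx V n (F : V -> 'M[R]_n) x : {for x, continuous (fun y => \det (F y))} ->
  F x \in unitmx -> \forall y \near x, F y \in unitmx.
Proof.
move=> cF; rewrite unitmxE unitfE => d0.
have : \forall y \near x, \det (F y) != 0.
  exact: (cF _ (open_nbhs_nbhs (conj (@open_neq _ (0:R)) d0))).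
by apply: filterS => y; rewrite unitmxE unitfE.
Qed.

Lemma smooth_near_unitmx V n (F : V -> 'M[R]_n) x : smooth_at F x ->
  F x \in unitmx -> \forall y \near x, F y \in unitmx.
Proof. by move=> sF; apply: near_unitmx; apply/smooth_cont/smooth_det. Qed.

(** Cramer's rule: near [x] the inverse is the adjugate divided by the determinant, and both are
    polynomial in the entries. *)
Lemma smooth_invmx V n (F : V -> 'M[R]_n) x : F x \in unitmx ->
  smooth_at F x -> smooth_at (fun y => invmx (F y)) x.
Proof.
move=> Fx sF; have nF := smooth_near_unitmx sF Fx.
have : smooth_at (fun y => (\det (F y))^-1 *: \adj (F y)) x.
  apply: smoothZ; first apply: smoothV.
  - by rewrite -unitfE -unitmxE.
  - exact: smooth_det.
  apply/smooth_mxP => i j.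
  have : smooth_at (fun y => cofactor (F y) j i) x.
    apply: smoothM; first exact: smooth_cst.
    apply: smooth_det; apply/smooth_mxP => i' j'.
    move/smooth_mxP : sF => /(_ (lift j i') (lift i j')).
    by apply: smooth_at_eq; near=> y; rewrite !mxE.
  by apply: smooth_at_eq; near=> y; rewrite mxE.
by apply: smooth_at_eq; near=> y; rewrite /invmx (near nF y).
Unshelve. all: by end_near. Qed.

Lemma smooth_dot V N (f g : V -> 'rV[R]_N) x :
  smooth_at f x -> smooth_at g x -> smooth_at (fun y => dot (f y) (g y)) x.
Proof.
move=> /smooth_mxP sf /smooth_mxP sg; apply: smooth_sum => i _.
by apply: smoothM; [exact: sf|exact: sg].
Qed.

Lemma smooth_comp_fin V X n (e : 'I_n -> X) (p : 'I_n -> {linear X -> R})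
    (h : V -> X) (f : X -> R) x :
  (forall i, continuous (p i)) -> (forall x, x = \sum_i p i x *: e i) ->
  smooth_at h x -> smooth_at f (h x) -> smooth_at (f \o h) x.
Proof.
move=> pc pe sh sf.
have /smooth_atE[A [oA Ahx CA]] := sf.
have /smooth_atE[U [oU Ux CU]] := sh.
have : \forall y \near x, A (h y) /\ U y.
  by near=> y; split; near: y; [apply: (smooth_cont sh)|]; exact: open_nbhs_nbhs.
move=> /near_open[B [oB Bx BAU]].
apply/smooth_atE; exists B; split=> // k.
apply: (class_C_comp_fin pc pe oB oA _ _ (CA k)); first by move=> y /BAU[].
by apply: class_C_sub (CU k) => y /BAU[].
Unshelve. all: by end_near. Qed.

Lemma smooth_comp_scal V (h : V -> R) (f : R -> R) x :
  smooth_at h x -> smooth_at f (h x) -> smooth_at (fun y => f (h y)) x.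
Proof.
apply: (@smooth_comp_fin V R 1 (fun _ => 1) (fun _ => idfun)).
  by move=> _ y; exact: cvg_id.
by move=> y; rewrite big_ord1 /GRing.scale /= mulr1.
Qed.

Lemma smooth_comp_rV V m (h : V -> 'rV[R]_m) (f : 'rV[R]_m -> R) x :
  smooth_at h x -> smooth_at f (h x) -> smooth_at (fun y => f (h y)) x.
Proof.
have cl (i : 'I_m) : linear (fun u : 'rV[R]_m => u 0 i) by move=> k u v; rewrite !mxE.
pose p (i : 'I_m) : {linear 'rV[R]_m -> R} :=
  HB.pack (fun u : 'rV[R]_m => u 0 i) (GRing.isLinear.Build _ _ _ _ _ (cl i)).
apply: (@smooth_comp_fin V _ m (fun i => delta_mx 0 i) p).
  by move=> i; exact: coord_continuous.
exact: row_sum_delta.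
Qed.

Lemma smooth_comp_R V p q (h : V -> R) (f : R -> 'M[R]_(p, q)) x :
  smooth_at h x -> smooth_at f (h x) -> smooth_at (fun y => f (h y)) x.
Proof.
move=> sh /smooth_mxP sf; apply/smooth_mxP => i j.
exact: (smooth_comp_scal sh (sf i j)).
Qed.

Lemma smooth_comp V m p q (h : V -> 'rV[R]_m) (f : 'rV[R]_m -> 'M[R]_(p, q)) x :
  smooth_at h x -> smooth_at f (h x) -> smooth_at (fun y => f (h y)) x.
Proof.
move=> sh /smooth_mxP sf; apply/smooth_mxP => i j.
exact: (smooth_comp_rV sh (sf i j)).
Qed.

Lemma smooth_coord V m n (F : V -> 'M[R]_(m, n)) x i j :
  smooth_at F x -> smooth_at (fun y => F y i j) x.
Proof. by move/smooth_mxP. Qed.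

Lemma smooth_jacobian m n (f : 'rV[R]_m -> 'rV[R]_n) x :
  smooth_at f x -> smooth_at (jacobian f) x.
Proof.
move=> sf; apply/smooth_mxP => i j.
have nf := smooth_near sf.
have := smooth_coord 0 j (smooth_derive (delta_mx 0 i) sf).
apply: smooth_at_eq; near=> y; rewrite deriveEjacobian.
  by rewrite -rowE mxE.
by apply: smooth_diff; exact: (near nf y).
Unshelve. all: by end_near. Qed.

End SmoothAt.

(** * Differentiation rules and mean value inequalities *)

Section Rules.
Context {R : realType}.
Implicit Types V W X : normedModType R.

Lemma derive_mulmx V m n p (F : V -> 'M[R]_(m, n)) (G : V -> 'M[R]_(n, p)) x v :
  differentiable F x -> differentiable G x ->
  'D_v (fun y => F y *m G y) x = 'D_v F x *m G x + F x *m 'D_v G x.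
Proof.
move=> dF dG.
have dF' i j : derivable (fun y => F y i j) x v.
  by apply: diff_derivable; exact: (differentiable_mxP F x).2.
have dG' i j : derivable (fun y => G y i j) x v.
  by apply: diff_derivable; exact: (differentiable_mxP G x).2.
have E i j : (fun y => (F y *m G y) i j) =
    \sum_(k < n) ((fun y => F y i k) * (fun y => G y k j)) :> (V -> R).
  by apply/funext => y; rewrite mxE fct_sumE.
have dFG : derivable (fun y => F y *m G y) x v.
  apply/derivable_mxP => i j; rewrite E; apply: derivable_sum => k.
  exact: derivableM.
rewrite (derive_mx dFG); apply/matrixP => i j; rewrite mxE E derive_sum; last first.
  by move=> k; apply: derivableM.
rewrite !mxE -big_split /=; apply: eq_bigr => k _.
rewrite (deriveM (dF' i k) (dG' k j)) (derive_entry v i k dF) (derive_entry v k j dG).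
by rewrite addrC /GRing.scale /= [G x k j * _]mulrC.
Qed.

Lemma derive_dirD V W (f : V -> W) x u v : differentiable f x ->
  'D_(u + v) f x = 'D_u f x + 'D_v f x.
Proof. by move=> df; rewrite !deriveE// linearD. Qed.

Lemma derive_dirZ V W (f : V -> W) x k v : differentiable f x ->
  'D_(k *: v) f x = k *: 'D_v f x.
Proof. by move=> df; rewrite !deriveE// linearZ. Qed.

Lemma derive_dirN V W (f : V -> W) x v : differentiable f x ->
  'D_(- v) f x = - 'D_v f x.
Proof. by move=> df; rewrite !deriveE// linearN. Qed.

Lemma derive_dirB V W (f : V -> W) x u v : differentiable f x ->
  'D_(u - v) f x = 'D_u f x - 'D_v f x.
Proof. by move=> df; rewrite !deriveE// linearB. Qed.

Lemma continuous_mulmxr m n p (B : 'M[R]_(n, p)) :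
  continuous (fun A : 'M[R]_(m, n) => A *m B).
Proof.
move=> A; apply: smooth_cont; apply: smooth_mulmx; first exact: smooth_id.
exact: smooth_cst.
Qed.

Lemma derive_mulmxr V m n p (F : V -> 'M[R]_(m, n)) (B : 'M[R]_(n, p)) x v :
  differentiable F x -> 'D_v (fun y => F y *m B) x = 'D_v F x *m B.
Proof.
move=> dF; rewrite derive_mulmx//.
by rewrite derive_cst mulmx0 addr0.
Qed.

Lemma derive_mulmxl V m n p (F : V -> 'M[R]_(n, p)) (B : 'M[R]_(m, n)) x v :
  differentiable F x -> 'D_v (fun y => B *m F y) x = B *m 'D_v F x.
Proof.
move=> dF; rewrite derive_mulmx//.
by rewrite derive_cst mul0mx add0r.
Qed.

Lemma derive_tr V m n (F : V -> 'M[R]_(m, n)) x v : differentiable F x ->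
  'D_v (fun y => (F y)^T) x = ('D_v F x)^T.
Proof.
move=> dF; have dFt : differentiable (fun y => (F y)^T) x.
  apply/differentiable_mxP => i j.
  under eq_fun do rewrite mxE.
  by move/differentiable_mxP : dF; exact.
apply/matrixP => i j; rewrite (derive_entry v i j dFt) mxE (derive_entry v j i dF).
have -> : (fun y => (F y)^T i j) = (fun y => F y j i) by apply/funext => y; rewrite mxE.
by [].
Qed.

Lemma differentiable_line V W (f : V -> W) (x v : V) (s : R) :
  differentiable f (x + s *: v) -> differentiable (fun h : R => f (x + h *: v)) s.
Proof.
by move=> df; apply: (@differentiable_comp _ _ _ _ (fun h : R => x + h *: v) f).
Qed.

Lemma derive_line V W (f : V -> W) (x v : V) (s : R) :
  differentiable f (x + s *: v) ->
  is_derive s 1 (fun h : R => f (x + h *: v)) ('D_v f (x + s *: v)).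
Proof.
move=> df; apply: DeriveDef; first exact/diff_derivable/differentiable_line.
have dl : differentiable (fun h : R => x + h *: v) s by [].
rewrite (@derive_comp _ _ _ _ f (fun h : R => x + h *: v))//.
congr (derive _ _ _).
rewrite deriveD//; last exact: diff_derivable.
by rewrite derive_cst add0r deriveE// diff_val scale1r.
Qed.

Lemma MVT_line V (f : V -> R) (x v : V) :
  (forall s : R, 0 <= s <= 1 -> differentiable f (x + s *: v)) ->
  exists2 s : R, 0 < s < 1 & f (x + v) - f x = 'D_v f (x + s *: v).
Proof.
move=> df.
have dl (s : R) : s \in `[0, 1]%R -> is_derive s 1 (fun h : R => f (x + h *: v)) ('D_v f (x + s *: v)).
  by rewrite in_itv /= => s01; apply: derive_line; exact: df.
have dl' (s : R) : s \in `]0, 1[%R -> is_derive s 1 (fun h : R => f (x + h *: v)) ('D_v f (x + s *: v)).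
  by move=> s01; apply: dl; exact: subset_itv_oo_cc s01.
have cl : {within `[0, 1], continuous (fun h : R => f (x + h *: v))}.
  apply: derivable_within_continuous => s s01.
  by case: (dl s s01).
have [s s01 E] := MVT ltr01 dl' cl.
exists s; first by move: s01; rewrite in_itv.
by move: E; rewrite subr0 mulr1 scale1r scale0r addr0.
Qed.

(** The two-sided derivative exists by differentiability, so its value can be read off from one
    side. *)
Lemma derive_eq0_side V W (f : V -> W) x v : differentiable f x ->
  (\forall s \near (0 : R)^'+, f (x + s *: v) = f x) -> 'D_v f x = 0.
Proof.
move=> df H; have : derivable f x v := diff_derivable df; rewrite /derivable => cf.
have c1 : (fun h => h^-1 *: (f (h *: v + x) - f x)) @ (0:R)^'+ --> 'D_v f x.
  exact: cvg_dnbhs_at_right cf.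
have c2 : (fun h => h^-1 *: (f (h *: v + x) - f x)) @ (0:R)^'+ --> (0 : W).
  apply: (@cvg_trans _ ((fun _ : R => 0 : W) @ (0:R)^'+)); last exact: cvg_cst.
  apply: near_eq_cvg.
  by apply: filterS H => s E; rewrite /cst /= [s *: v + x]addrC E subrr scaler0.
exact: (cvg_unique _ c1 c2).
Qed.

Lemma derive_eq_side V m n (f g : V -> 'M[R]_(m, n)) x v :
  differentiable f x -> differentiable g x -> f x = g x ->
  (\forall s \near (0 : R)^'+, f (x + s *: v) = g (x + s *: v)) -> 'D_v f x = 'D_v g x.
Proof.
move=> df dg E H.
have : 'D_v (f - g) x = 0.
  apply: derive_eq0_side; first exact: differentiableB.
  by apply: filterS H => s; rewrite !fctE E subrr => ->; rewrite subrr.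
rewrite deriveB; [|exact: diff_derivable..].
by move/subr0_eq.
Qed.

(** With the integrating factor, [expR (- (2 * C) * s) * l s ^ 2] has derivative [expR (- (2 * C) *
    s) * 2 * (k s - C) * l s ^ 2 <= 0]. It is nonnegative, starts at [0], and so stays there. *)
Lemma gronwall0 (l k : R -> R) (C : R) :
  (forall s : R, 0 <= s <= 1 -> is_derive s 1 l (k s * l s)) ->
  (forall s : R, 0 <= s <= 1 -> `|k s| <= C) -> l 0 = 0 ->
  forall s : R, 0 <= s <= 1 -> l s = 0.
Proof.
move=> dl kC l0.
pose E s := expR (- (2 * C) * s) * (l s * l s).
pose dE s := expR (- (2 * C) * s) * (2 * (k s - C) * (l s * l s)).
have HE (s : R) : 0 <= s <= 1 -> is_derive s 1 E (dE s).
  move=> s01; have := dl s s01 => ?.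
  have He : is_derive s 1 (fun s => expR (- (2 * C) * s)) (- (2 * C) * expR (- (2 * C) * s)).
    apply: is_derive_eq; rewrite /GRing.scale /=.
    by rewrite mulr1 mulrC.
  apply: is_derive_eq; rewrite /GRing.scale /= /dE.
  by ring.
move=> s s01.
have cE : {within `[0, 1], continuous E}.
  apply: derivable_within_continuous => t; rewrite in_itv /= => t01.
  by case: (HE t t01).
have : E s <= E 0.
  apply: (@ler0_derive1_le_cc R E 0 1).
  - move=> t /[!in_itv] /= /andP[t0 t1].
    have t01 : 0 <= t <= 1 by rewrite !ltW.
    by case: (HE t t01).
  - move=> t /[!in_itv] /= /andP[t0 t1].
    have t01 : 0 <= t <= 1 by rewrite !ltW.
    rewrite derive1E; have [_ ->] := HE t t01; rewrite /dE.
    rewrite pmulr_rle0 ?expR_gt0//.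
    rewrite mulr_le0_ge0//; last by rewrite -expr2 sqr_ge0.
    rewrite pmulr_rle0// subr_le0 (le_trans (ler_norm _))//.
    by apply: kC; rewrite !ltW.
  - exact: cE.
  - by rewrite in_itv.
  - by rewrite in_itv /= lexx ler01.
  - by move: s01 => /andP[].
rewrite {2}/E l0 mul0r mulr0 /E pmulr_rle0 ?expR_gt0// => H.
have : l s * l s = 0 by apply/eqP; rewrite eq_le H -expr2 sqr_ge0.
by move/eqP; rewrite mulf_eq0 orbb => /eqP.
Qed.

End Rules.

(** * Symmetry of second derivatives, strict differentiability and the inverse function theorem *)

Section Inverse.
Context {R : realType}.
Implicit Types V W X : normedModType R.

Lemma near0P V (x : V) (P : V -> Prop) :
  (\forall y \near x, P y) <-> exists2 r : R, 0 < r & forall y, `|y - x| < r -> P y.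
Proof.
split=> [/nbhs_ballP[r /= r0 H]|[r r0 H]].
  by exists r => // y yx; apply: H; rewrite -ball_normE /= distrC.
by apply/nbhs_ballP; exists r => // y; rewrite -ball_normE /= distrC; exact: H.
Qed.

Lemma cont_dist V W (f : V -> W) x (e : R) : {for x, continuous f} -> 0 < e ->
  \forall y \near x, `|f x - f y| < e.
Proof. by move=> /cvgrPdist_lt + e0 => /(_ e e0). Qed.

Lemma dist_half (A B C e : R) : `|B - C| < e / 2 -> `|A - C| < e / 2 -> `|A - B| <= e.
Proof.
move=> BC AC; rewrite (splitr e) (le_trans (ler_distD C _ _))// lerD//; first exact: ltW.
by rewrite distrC ltW.
Qed.

(** Two mean value theorems in a row: along [u] for the difference [F (y + v) - F y], then along [v]
    for ['D_u F]. *)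
Lemma schwarz_box V (F : V -> R) (x u v : V) :
  (forall a b : R, 0 <= a <= 1 -> 0 <= b <= 1 -> smooth_at F (x + a *: u + b *: v)) ->
  exists a b : R, [/\ 0 <= a <= 1, 0 <= b <= 1 &
    F (x + u + v) - F (x + u) - (F (x + v) - F x) = 'D_v ('D_u F) (x + a *: u + b *: v)].
Proof.
move=> sF.
have i0 : 0 <= (0:R) <= 1 by apply/andP; split.
have i1 : 0 <= (1:R) <= 1 by apply/andP; split.
pose g y := F (y + v) - F y.
have dsh y : differentiable (fun y : V => y + v) y by [].
have dF a b : 0 <= a <= 1 -> 0 <= b <= 1 -> differentiable F (x + a *: u + b *: v).
  by move=> ? ?; apply: smooth_diff; exact: sF.
have dF0 a : 0 <= a <= 1 -> differentiable F (x + a *: u).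
  by move=> ha; have := dF a 0 ha i0; rewrite scale0r addr0.
have dF1 a : 0 <= a <= 1 -> differentiable (F \o (fun y => y + v)) (x + a *: u).
  move=> ha; apply: differentiable_comp => //.
  by have := dF a 1 ha i1; rewrite scale1r.
have [a a01 E] : exists2 s : R, 0 < s < 1 & g (x + u) - g x = 'D_u g (x + s *: u).
  apply: MVT_line => s s01; apply: differentiableB; [exact: dF1|exact: dF0].
have a01' : 0 <= a <= 1 by move: a01 => /andP[/ltW -> /ltW ->].
have [b b01 E'] := @MVT_line R V ('D_u F) (x + a *: u) v (fun b hb =>
  smooth_diff (smooth_derive u (sF a b a01' hb))).
have b01' : 0 <= b <= 1 by move: b01 => /andP[/ltW -> /ltW ->].
exists a, b; split => //; rewrite -E' [LHS]E /g.
rewrite (_ : (fun y => F (y + v) - F y) = (F \o (fun y => y + v)) - F)//.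
rewrite deriveB; [|by apply: diff_derivable; auto..].
congr (_ - _); rewrite (derive_comp (f := F) u (dsh _)); last first.
  by have := dF a 1 a01' i1; rewrite scale1r.
congr (derive _ _ _).
by rewrite deriveD// derive_cst addr0 derive_id.
Qed.

(** The second difference over the parallelogram spanned by [s u] and [s v] is symmetric in [u] and
    [v]. Evaluated both ways, it shows that the two mixed derivatives agree at two points as close
    to [x] as desired; continuity at [x] concludes. *)
Lemma schwarz V (F : V -> R) (x u v : V) : smooth_at F x ->
  'D_u ('D_v F) x = 'D_v ('D_u F) x.
Proof.
move=> sF; apply/eqP; rewrite -subr_eq0 -normr_le0; apply/ler_addgt0Pr => e e0.
rewrite add0r.
have e2 : 0 < e / 2 by rewrite divr_gt0.
have c1 : {for x, continuous ('D_u ('D_v F))} by apply/smooth_cont/smooth_derive/smooth_derive.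
have c2 : {for x, continuous ('D_v ('D_u F))} by apply/smooth_cont/smooth_derive/smooth_derive.
have : \forall y \near x, [/\ smooth_at F y,
    `|'D_u ('D_v F) x - 'D_u ('D_v F) y| < e / 2 &
    `|'D_v ('D_u F) x - 'D_v ('D_u F) y| < e / 2].
  have n1 := cont_dist c1 e2; have n2 := cont_dist c2 e2; have n3 := smooth_near sF.
  by near=> y; split; [exact: (near n3 y)|exact: (near n1 y)|exact: (near n2 y)].
move=> /near0P[r r0 H].
have [s [s0 sr]] : exists s : R, 0 < s /\ s * (`|u| + `|v|) < r.
  have M0 : 0 < 1 + (`|u| + `|v|) by rewrite ltr_pwDl.
  exists (r / (1 + (`|u| + `|v|))); split; first by rewrite divr_gt0.
  by rewrite mulrAC ltr_pdivrMr// ltr_pM2l// ltrDr.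
have K a b w z : 0 <= a <= 1 -> 0 <= b <= 1 -> `|w| + `|z| <= `|u| + `|v| ->
    `|x + a *: (s *: w) + b *: (s *: z) - x| < r.
  move=> /andP[a0 a1] /andP[b0 b1] wz.
  rewrite addrAC [x + _ - x]addrAC subrr add0r.
  apply: le_lt_trans (ler_normD _ _) _.
  rewrite !normrZ (ger0_norm a0) (ger0_norm b0) (gtr0_norm s0).
  apply: (@le_lt_trans _ _ (s * (`|w| + `|z|))).
    by rewrite mulrDr lerD// ler_piMl// mulr_ge0// ltW.
  exact: le_lt_trans (ler_wpM2l (ltW s0) wz) sr.
have sF1 a b : 0 <= a <= 1 -> 0 <= b <= 1 -> smooth_at F (x + a *: (s *: u) + b *: (s *: v)).
  by move=> ? ?; have [] := H (x + a *: (s *: u) + b *: (s *: v)) (K _ _ _ _ _ _ (lexx _)).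
have sF2 a b : 0 <= a <= 1 -> 0 <= b <= 1 -> smooth_at F (x + a *: (s *: v) + b *: (s *: u)).
  move=> ? ?; have [] // := H (x + a *: (s *: v) + b *: (s *: u)).
  by apply: K => //; rewrite addrC.
have [a [b [ha hb E1]]] := schwarz_box sF1.
have [a' [b' [ha' hb' E2]]] := schwarz_box sF2.
have DD w z y : smooth_at F y -> 'D_(s *: w) ('D_(s *: z) F) y = s * (s * 'D_w ('D_z F) y).
  move=> sy; have E : \forall y' \near y, s * 'D_z F y' = 'D_(s *: z) F y'.
    have n3 := smooth_near sy.
    by near=> y'; rewrite derive_dirZ; [|exact: (smooth_diff (near n3 y' _))].
  have sDz := smooth_derive z sy.
  rewrite -(near_eq_derive _ E) derive_dirZ; last first.
    by apply: smooth_diff; apply: smoothM => //; exact: smooth_cst.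
  have dz : derivable ('D_z F) y w := smooth_derivable sDz.
  by congr (_ * _); exact: (deriveZ s dz).
rewrite DD in E1; last exact: sF1.
rewrite DD in E2; last exact: sF2.
have key (p q A B : R) : A = s * (s * p) -> B = s * (s * q) -> A = B -> p = q.
  have sn0 : s != 0 by rewrite gt_eqF.
  by move=> -> -> /(mulfI sn0)/(mulfI sn0).
have swap (A B C D : R) : A - B - (C - D) = A - C - (B - D) by ring.
have E3 := key _ _ _ _ E1 E2.
rewrite (addrAC x) in E3; have {}E3 := E3 (swap _ _ _ _).
have [_ _ L1] := H _ (K a b u v ha hb (lexx _)).
have vu : `|v| + `|u| <= `|u| + `|v| by rewrite addrC.
have [_ L2 _] := H _ (K a' b' v u ha' hb' vu).
rewrite E3 in L1.
exact: dist_half L1 L2.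
Unshelve. all: by end_near. Qed.

Lemma schwarz_mx V m n (F : V -> 'M[R]_(m, n)) (x u v : V) : smooth_at F x ->
  'D_u ('D_v F) x = 'D_v ('D_u F) x.
Proof.
move=> sF; have nF := smooth_near sF.
have E w i j : \forall y \near x, 'D_w F y i j = 'D_w (fun y => F y i j) y.
  by near=> y; apply: derive_entry; exact: (smooth_diff (near nF y _)).
apply/matrixP => i j.
have du : differentiable ('D_u F) x := smooth_diff (smooth_derive u sF).
have dv : differentiable ('D_v F) x := smooth_diff (smooth_derive v sF).
have e1 := derive_entry u i j dv.
have e2 := derive_entry v i j du.
apply: (etrans e1); apply: etrans (esym e2).
have e3 := near_eq_derive u (E v i j).
have e4 := near_eq_derive v (E u i j).
apply: (etrans e3); apply: etrans (esym e4).
by apply: schwarz; exact: smooth_coord.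
Unshelve. all: by end_near. Qed.

Lemma mulmx_norm m n p (A : 'M[R]_(m, n)) (B : 'M[R]_(n, p)) :
  `|A *m B| <= n%:R * (`|A| * `|B|).
Proof.
apply: mx_norm_le; first by rewrite !mulr_ge0.
move=> i j; rewrite mxE; apply: le_trans (ler_norm_sum _ _ _) _.
have -> : n%:R * (`|A| * `|B|) = \sum_(k < n) (`|A| * `|B|).
  by rewrite sumr_const card_ord mulr_natl.
apply: ler_sum => k _; rewrite normrM ler_pM//; exact: mx_entry_le.
Qed.

(** The mean value theorem along the segment from [y] to [x], for each component of
    [f z - z *m jacobian f a], whose derivative is small near [a]. *)
Lemma strict_diff m n (f : 'rV[R]_m -> 'rV[R]_n) a (e : R) : smooth_at f a -> 0 < e ->
  exists2 r : R, 0 < r & forall x y, `|x - a| < r -> `|y - a| < r ->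
    `|f x - f y - (x - y) *m jacobian f a| <= e * `|x - y|.
Proof.
move=> sf e0.
(* [mulmx_norm] costs a factor [m]; dividing by [m.+1] also makes sense for [m = 0]. *)
have M0 : 0 < m.+1%:R :> R by rewrite ltr0n.
have c := smooth_cont (smooth_jacobian sf).
have : \forall z \near a, smooth_at f z /\ `|jacobian f a - jacobian f z| < e / m.+1%:R.
  have n1 := cont_dist c (divr_gt0 e0 M0); have n3 := smooth_near sf.
  by near=> z; split; [exact: (near n3 z)|exact: (near n1 z)].
move=> /near0P[r r0 H]; exists r => // x y xa ya.
apply: mx_norm_le; first by rewrite mulr_ge0// ltW.
move=> i j; rewrite !ord1 {i}.
pose g z := (f z - z *m jacobian f a) 0 j.
have dg z : smooth_at f z -> smooth_at g z.
  move=> sz; apply: smooth_coord; apply: smoothB => //.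
  apply: smooth_mulmx; [exact: smooth_id|exact: smooth_cst].
have seg s : 0 <= s <= 1 -> `|y + s *: (x - y) - a| < r.
  move=> /andP[s0 s1].
  have -> : y + s *: (x - y) - a = (1 - s) *: (y - a) + s *: (x - a).
    by apply/rowP => k; rewrite !mxE; ring.
  apply: le_lt_trans (ler_normD _ _) _; rewrite !normrZ ger0_norm ?subr_ge0// ger0_norm//.
  have [->|sn1] := eqVneq s 1; first by rewrite subrr mul0r add0r mul1r.
  have s1' : 0 < 1 - s by rewrite subr_gt0 lt_neqAle sn1.
  apply: (@lt_le_trans _ _ ((1 - s) * r + s * r)); last by rewrite -mulrDl subrK mul1r.
  by rewrite ltr_leD// ?ltr_pM2l// ler_wpM2l// ltW.
have [s s01 E] := @MVT_line R _ g y (x - y) (fun s hs =>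
  smooth_diff (dg _ (H _ (seg s hs)).1)).
have s01' : 0 <= s <= 1 by move: s01 => /andP[/ltW -> /ltW ->].
have [sz Jz] := H _ (seg s s01').
set z := y + s *: (x - y) in E sz Jz.
have -> : (f x - f y - (x - y) *m jacobian f a) 0 j = g (y + (x - y)) - g y.
  by rewrite /g subrKC mulmxBl !mxE; ring.
rewrite E.
have -> : 'D_(x - y) g z = ((x - y) *m (jacobian f z - jacobian f a)) 0 j.
  have s1 : smooth_at (fun z => z *m jacobian f a) z.
    apply: smooth_mulmx; [exact: smooth_id|exact: smooth_cst].
  rewrite /g -(derive_entry (F := fun z => f z - z *m jacobian f a)); last first.
    by apply: smooth_diff; exact: smoothB.
  rewrite deriveB; [|exact: smooth_derivable..].
  rewrite derive_mulmxr// ?derive_id ?deriveEjacobian ?mulmxBr//.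
  exact: smooth_diff.
apply: le_trans (mx_entry_le _ _ _) _; apply: le_trans (mulmx_norm _ _) _.
rewrite mulrCA mulrC ler_wpM2r// mulrC.
rewrite distrC in Jz; apply: (@le_trans _ _ (m.+1%:R * (e / m.+1%:R))).
  rewrite mulrC ler_pM ?ler_nat//; exact: ltW.
by rewrite mulrCA divff ?mulr1// gt_eqF.
Unshelve. all: by end_near. Qed.

Lemma class_C_comp_rV V m p q k (U : set V) (A : set 'rV[R]_m) (h : V -> 'rV[R]_m)
    (f : 'rV[R]_m -> 'M[R]_(p, q)) : open U -> open A -> (forall x, U x -> A (h x)) ->
  class_C k U h -> class_C k A f -> class_C k U (fun y => f (h y)).
Proof.
move=> oU oA UA Ch /(class_C_mxP _ _ oA) Cf; apply/(class_C_mxP _ _ oU) => i j.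
have cl (l : 'I_m) : linear (fun u : 'rV[R]_m => u 0 l) by move=> c u v; rewrite !mxE.
pose pr (l : 'I_m) : {linear 'rV[R]_m -> R} :=
  HB.pack (fun u : 'rV[R]_m => u 0 l) (GRing.isLinear.Build _ _ _ _ _ (cl l)).
apply: (@class_C_comp_fin R V _ m (fun l => delta_mx 0 l) pr U A h (fun z => f z i j)) => //.
  by move=> l; exact: coord_continuous.
exact: row_sum_delta.
Qed.

Lemma linear_mulmxr_pack m n p (B : 'M[R]_(n, p)) :
  exists2 l : {linear 'M[R]_(m, n) -> 'M[R]_(m, p)}, continuous l & l = (fun A => A *m B) :> (_ -> _).
Proof.
by exists (mulmxr B) => //; exact: continuous_mulmxr.
Qed.

Lemma jacobian_eq m n (f : 'rV[R]_m -> 'rV[R]_n) x (B : 'M[R]_(m, n)) :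
  differentiable f x -> (forall v, 'D_v f x = v *m B) -> jacobian f x = B.
Proof.
move=> df H; apply/row_matrixP => i; rewrite !rowE -H.
by rewrite deriveEjacobian.
Qed.

(** Near [a] the map [f] minus the identity is Lipschitz with constant [1/2], so [f] is injective
    with Lipschitz inverse. A preimage of [y] is a minimizer of [|f x - y|] on a compact ball. The
    derivative of the inverse is a smooth function of the inverse itself, which raises its class one
    step at a time. *)
Lemma local_inverse1 m (f : 'rV[R]_m -> 'rV[R]_m) a :
  smooth_at f a -> jacobian f a = 1%:M ->
  exists psi : 'rV[R]_m -> 'rV[R]_m,
    [/\ smooth_at psi (f a), psi (f a) = a,
        \forall y \near f a, f (psi y) = y &
        \forall x \near a, psi (f x) = x].
Proof.
move=> sf Ja.
have half0 : 0 < (2^-1 : R) by rewrite invr_gt0.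
have [r1 r10 H1] := strict_diff sf half0.
have [r2 r20 H2] : exists2 r : R, 0 < r & forall y, `|y - a| < r ->
    smooth_at f y /\ jacobian f y \in unitmx.
  apply/near0P; have n1 := smooth_near sf.
  have n2 : \forall y \near a, jacobian f y \in unitmx.
    apply: smooth_near_unitmx; first exact: smooth_jacobian.
    by rewrite Ja unitmx1.
  by near=> y; split; [exact: (near n1 y)|exact: (near n2 y)].
pose r := Num.min r1 r2.
have r0 : 0 < r by rewrite lt_min r10.
have rr1 x : `|x - a| < r -> `|x - a| < r1 by move=> /lt_le_trans; apply; rewrite ge_min lexx.
have rr2 x : `|x - a| < r -> `|x - a| < r2 by move=> /lt_le_trans; apply; rewrite ge_min lexx orbT.
have est x y : `|x - a| < r -> `|y - a| < r -> `|f x - f y - (x - y)| <= 2^-1 * `|x - y|.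
  by move=> xa ya; have := H1 _ _ (rr1 _ xa) (rr1 _ ya); rewrite Ja mulmx1.
have inj x y : `|x - a| < r -> `|y - a| < r -> `|x - y| <= 2 * `|f x - f y|.
  move=> xa ya; have := est x y xa ya.
  have := ler_distD (f x - f y) 0 (x - y).
  rewrite !sub0r !normrN => A B; lra.
pose rh := r / 2; pose r4 := r / 4.
have rh0 : 0 < rh by rewrite divr_gt0.
have r40 : 0 < r4 by rewrite divr_gt0.
have rhr : rh < r by rewrite ltr_pdivrMr// ltr_pMr// ltr1n.
pose B := [set x : 'rV[R]_m | `|x - a| <= rh].
have Bc : compact B.
  apply: bounded_closed_compact.
    exists (`|a| + rh); split; first exact: num_real.
    move=> M aM x Bx; have := ler_normD (x - a) a; rewrite subrK => /le_trans; apply.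
    by rewrite addrC (le_trans _ (ltW aM))// lerD2l.
  have -> : B = (fun x => `|x - a|) @^-1` [set z | z <= rh] by [].
  apply: closed_comp; last exact: closed_le.
  move=> x _; have cx : {for x, continuous (fun z : 'rV[R]_m => z - a)}.
    by apply: smooth_cont; apply: smoothB; [exact: smooth_id|exact: smooth_cst].
  exact: (cvg_norm cx).
have surj y : `|y - f a| <= r4 -> exists2 x, B x & f x = y.
  move=> ya.
  have fc : {within B, continuous (fun x => `|f x - y|)}.
    apply: continuous_in_subspaceT => x; rewrite inE => Bx.
    have [sx _] := H2 _ (rr2 _ (le_lt_trans Bx rhr)).
    have cx : {for x, continuous (fun z => f z - y)}.
      by apply: smooth_cont; apply: smoothB => //; exact: smooth_cst.
    exact: (cvg_norm cx).
  have B0 : B !=set0 by exists a; rewrite /B /= subrr normr0 ltW.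
  have [c cB cmin] := EVT_min_rV B0 Bc fc.
  rewrite inE in cB.
  have car : `|c - a| < r by exact: le_lt_trans rhr.
  have aar : `|a - a| < r by rewrite subrr normr0.
  (* A Newton step from the minimizer. It stays in [B], as
     [|c' - a| <= r / 4 + |c - a| / 2 <= r / 2], and it would halve the minimum; the minimum is
     therefore zero. *)
  pose c' := c - (f c - y).
  have Bc' : B c'.
    rewrite /B /= /c'.
    have -> : c - (f c - y) - a = (y - f a) - (f c - f a - (c - a)).
      by apply/rowP => k; rewrite !mxE; ring.
    rewrite (le_trans (ler_normB _ _))//.
    have := est c a car aar; move: ya cB; rewrite /B /= /r4 /rh.
    by move=> *; lra.
  have := cmin c'; rewrite inE => /(_ Bc') mc.
  have := est c' c (le_lt_trans Bc' rhr) car.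
  have -> : f c' - f c - (c' - c) = f c' - y by apply/rowP => k; rewrite !mxE; ring.
  have -> : c' - c = - (f c - y) by apply/rowP => k; rewrite !mxE; ring.
  rewrite normrN => mc'.
  have : `|f c - y| <= 0 by lra.
  by rewrite normr_le0 subr_eq0 => /eqP ?; exists c.
pose psi y := xget a [set x | B x /\ f x = y].
have psiP y : `|y - f a| <= r4 -> B (psi y) /\ f (psi y) = y.
  move=> /surj[x Bx fx]; rewrite /psi.
  by case: xgetP => [z _ []//|/(_ x)[]].
have psi_uniq x : B x -> `|f x - f a| <= r4 -> psi (f x) = x.
  move=> Bx /psiP[Bp fp]; have := inj _ _ (le_lt_trans Bp rhr) (le_lt_trans Bx rhr).
  by rewrite fp subrr normr0 mulr0 normr_le0 subr_eq0 => /eqP.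
pose D := ball (f a) r4.
have DP y : D y -> `|y - f a| < r4 by rewrite /D -ball_normE /= distrC.
have oD : open D by exact: ball_open.
have Dlip y z : D y -> D z -> `|psi y - psi z| <= 2 * `|y - z|.
  move=> /DP/ltW/psiP[By fy] /DP/ltW/psiP[Bz fz].
  have := inj _ _ (le_lt_trans By rhr) (le_lt_trans Bz rhr).
  by rewrite fy fz.
have dpsi y : D y -> differentiable psi y /\
    forall v, 'D_v psi y = v *m invmx (jacobian f (psi y)).
  move=> Dy; have [By fy] := psiP _ (ltW (DP _ Dy)).
  have [sx Jx] := H2 _ (rr2 _ (le_lt_trans By rhr)).
  set x := psi y in By fy sx Jx *; set J := jacobian f x in Jx *.
  have [l lc lE] := @linear_mulmxr_pack 1 m m (invmx J).
  suff [dp dE] : differentiable psi y /\ 'd psi y = l :> (_ -> _).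
    by split=> // v; rewrite deriveE// dE lE.
  apply: differentiable_epsP => // e e0; rewrite lE.
  (* The factor [2] is the Lipschitz constant of [psi], the rest comes from multiplying by
     [invmx J]; the added [1] makes [M] positive. *)
  pose M := m%:R * (2 * `|invmx J|) + 1.
  have M0 : 0 < M by rewrite ltr_wpDl// mulr_ge0// mulr_ge0.
  have dfx := smooth_diff sx.
  have /near0P[d d0 Hd] := differentiable_eps dfx (divr_gt0 e0 M0).
  have nD : \forall h \near (0 : 'rV[R]_m), D (h + y).
    have : \forall z \near y, D z by exact: open_nbhs_nbhs.
    by rewrite (near_shift 0) /=; apply: filterS => h; rewrite subr0.
  have nd : \forall h \near (0 : 'rV[R]_m), `|h| < d / 2.
    by apply/near0P; exists (d / 2); [rewrite divr_gt0|move=> h; rewrite subr0].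
  near=> h.
  have Dh : D (h + y) by near: h.
  have hd : `|h| < d / 2 by near: h.
  pose k := psi (h + y) - x.
  have kh : `|k| <= 2 * `|h|.
    by have := Dlip _ _ Dh Dy; rewrite addrK.
  have [_ fh] := psiP _ (ltW (DP _ Dh)).
  have := Hd k; rewrite subr0 => /(_ (le_lt_trans kh _)).
  rewrite -ltr_pdivlMl// mulrC => /(_ hd).
  rewrite /k subrK fh fy addrK -/k -deriveE// deriveEjacobian// -/J => Hk.
  have -> : k - h *m invmx J = - ((h - k *m J) *m invmx J).
    by rewrite mulmxBl mulmxK// opprB.
  rewrite normrN (le_trans (mulmx_norm _ _))//.
  apply: (@le_trans _ _ (m%:R * (e / M * (2 * `|h|) * `|invmx J|))).
    rewrite ler_wpM2l// ler_wpM2r// (le_trans Hk)// ler_wpM2l//.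
    by rewrite ltW// divr_gt0.
  have -> : m%:R * (e / M * (2 * `|h|) * `|invmx J|) =
     (e * `|h|) * ((m%:R * (2 * `|invmx J|)) / M) by ring.
  rewrite ler_piMr ?mulr_ge0 ?(ltW e0)//.
  by rewrite ler_pdivrMr// mul1r /M lerDl.
pose A := ball a r.
have AP x : A x -> `|x - a| < r by rewrite /A -ball_normE /= distrC.
have oA : open A by exact: ball_open.
have DA y : D y -> A (psi y).
  move=> Dy; have [By _] := psiP _ (ltW (DP _ Dy)).
  by rewrite /A -ball_normE /= distrC; exact: le_lt_trans rhr.
have Cpsi k : class_C k D psi.
  elim: k => [|k IH].
    by move=> y /dpsi[+ _]; exact: differentiable_continuous.
  split=> [y /dpsi[]//|v].
  have sG x : A x -> smooth_at (fun x => v *m invmx (jacobian f x)) x.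
    move=> /AP/rr2/H2[sx Jx]; apply: smooth_mulmx; first exact: smooth_cst.
    by apply: smooth_invmx => //; exact: smooth_jacobian.
  have [A' [oA' AA' CA']] := (smooth_onP A _).2 sG.
  have := class_C_comp_rV oD oA DA IH (class_C_sub AA' (CA' k)).
  apply: class_C_eq => // y Dy.
  by have [_ ->] := dpsi y Dy.
exists psi; split.
- apply/smooth_atE; exists D; split=> //; exact: ballxx.
- by apply: psi_uniq; rewrite ?subrr ?normr0 ?(ltW r40)// /B /= subrr normr0 ltW.
- have : \forall y \near f a, D y by exact: open_nbhs_nbhs (conj oD (ballxx _ r40)).
  by apply: filterS => y /DP/ltW/psiP[].
- have n1 : \forall x \near a, `|x - a| < rh by apply/near0P; exists rh.
  have n2 := cont_dist (smooth_cont sf) r40.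
  near=> x; apply: psi_uniq.
    by rewrite /B /= ltW//; exact: (near n1 x).
  by rewrite distrC ltW//; exact: (near n2 x).
Unshelve. all: by end_near. Qed.

Lemma local_inverse m (f : 'rV[R]_m -> 'rV[R]_m) a :
  smooth_at f a -> jacobian f a \in unitmx ->
  exists psi : 'rV[R]_m -> 'rV[R]_m,
    [/\ smooth_at psi (f a), psi (f a) = a,
        \forall y \near f a, f (psi y) = y &
        \forall x \near a, psi (f x) = x].
Proof.
move=> sf Ju; pose B := invmx (jacobian f a).
pose F x := f x *m B.
have sF : smooth_at F a by apply: smooth_mulmx => //; exact: smooth_cst.
have JF : jacobian F a = 1%:M.
  apply: jacobian_eq => [|v]; first exact: smooth_diff.
  rewrite derive_mulmxr; last exact: smooth_diff.
  rewrite deriveEjacobian; last exact: smooth_diff.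
  by rewrite mulmxK// mulmx1.
have [psi [sp pa n1 n2]] := local_inverse1 sF JF.
have sB : smooth_at (fun y => y *m B) (f a).
  by apply: smooth_mulmx; [exact: smooth_id|exact: smooth_cst].
exists (fun y => psi (y *m B)); split=> //.
  exact: smooth_comp.
have cB := smooth_cont sB.
have n3 : \forall y \near f a, F (psi (y *m B)) = y *m B := cB _ n1.
apply: filterS n3 => y E.
have := congr1 (fun z => z *m jacobian f a) E.
by rewrite /F !mulmxKV.
Unshelve. all: by end_near. Qed.

End Inverse.

(** * Linear algebra *)

Section LinearAlgebra.
Context {R : realType}.

Lemma dot_mx N (x y : 'rV[R]_N) : dot x y = (x *m y^T) 0 0.
Proof. by rewrite /dot mxE; apply: eq_bigr => i _; rewrite mxE. Qed.

Lemma dotC N (x y : 'rV[R]_N) : dot x y = dot y x.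
Proof. by apply: eq_bigr => i _; rewrite mulrC. Qed.

Lemma dot_ge0 N (x : 'rV[R]_N) : 0 <= dot x x.
Proof. by apply: sumr_ge0 => i _; rewrite -expr2 sqr_ge0. Qed.

Lemma dot_eq0 N (x : 'rV[R]_N) : dot x x = 0 -> x = 0.
Proof.
move=> /eqP; rewrite psumr_eq0; last by move=> i _; rewrite -expr2 sqr_ge0.
move=> /allP H; apply/rowP => i; rewrite mxE.
by have := H i (mem_index_enum _); rewrite mulf_eq0 orbb => /eqP.
Qed.

Lemma dotBl N (x y z : 'rV[R]_N) : dot (x - y) z = dot x z - dot y z.
Proof. by rewrite !dot_mx mulmxBl !mxE. Qed.

Lemma dotZl N k (x z : 'rV[R]_N) : dot (k *: x) z = k * dot x z.
Proof. by rewrite !dot_mx -scalemxAl mxE. Qed.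

Lemma dot0l N (z : 'rV[R]_N) : dot 0 z = 0.
Proof. by rewrite dot_mx mul0mx mxE. Qed.

Lemma dot_mulmxr d N (x : 'rV[R]_N) (v : 'rV[R]_d) (B : 'M[R]_(d, N)) :
  dot x (v *m B) = dot (x *m B^T) v.
Proof. by rewrite !dot_mx trmx_mul mulmxA. Qed.

Lemma gram_unit d N (B : 'M[R]_(d, N)) : row_free B -> B *m B^T \in unitmx.
Proof.
move=> rB; rewrite -row_free_unit; apply: inj_row_free => v vB.
have vB0 : v *m B = 0.
  apply: dot_eq0; rewrite dot_mx trmx_mul mulmxA -(mulmxA v) vB.
  by rewrite mul0mx mxE.
by apply: (row_free_inj rB); rewrite mul0mx.
Qed.

(** The Gram matrix formula for the orthogonal projection onto the row space of a [B] with
    independent rows. *)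
Definition projmx d N (B : 'M[R]_(d, N)) : 'M[R]_N := B^T *m invmx (B *m B^T) *m B.

Lemma mul_projmx d N (B : 'M[R]_(d, N)) : row_free B -> B *m projmx B = B.
Proof. by move=> /gram_unit uB; rewrite /projmx !mulmxA mulmxV// mul1mx. Qed.

Lemma projmx_sub d N (B : 'M[R]_(d, N)) (z : 'rV[R]_N) :
  z *m projmx B = (z *m (B^T *m invmx (B *m B^T))) *m B.
Proof. by rewrite /projmx !mulmxA. Qed.

Lemma projmx_tr d N (B : 'M[R]_(d, N)) : (projmx B)^T = projmx B.
Proof. by rewrite /projmx !trmx_mul trmxK trmx_inv trmx_mul trmxK mulmxA. Qed.

Lemma projmx_ortho d N (B : 'M[R]_(d, N)) (z : 'rV[R]_N) v : row_free B ->
  dot (z - z *m projmx B) (v *m B) = 0.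
Proof.
move=> rB; rewrite dot_mulmxr mulmxBl -mulmxA.
have -> : projmx B *m B^T = B^T.
  by rewrite -{1}projmx_tr -trmx_mul mul_projmx.
by rewrite subrr dot0l.
Qed.

Lemma orthproj_unique N (A : set 'rV[R]_N) z y :
  (forall u v, A u -> A v -> A (u - v)) -> A y ->
  (forall x, A x -> dot (z - y) x = 0) -> orthproj A z = y.
Proof.
move=> AB Ay zy; apply: xget_subset1; first by split.
move=> u v [Au zu] [Av zv]; apply/eqP; rewrite -subr_eq0; apply/eqP/dot_eq0.
have Auv := AB _ _ Au Av.
have -> : dot (u - v) (u - v) = dot (z - v) (u - v) - dot (z - u) (u - v).
  by rewrite !dotBl; ring.
by rewrite zu// zv// subr0.
Qed.

Lemma orthprojE d N (A : set 'rV[R]_N) (B : 'M[R]_(d, N)) z : row_free B ->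
  (forall x, A x <-> exists v, x = v *m B) -> orthproj A z = z *m projmx B.
Proof.
move=> rB AE; apply: orthproj_unique.
- move=> u v /AE[u' ->] /AE[v' ->]; apply/AE; exists (u' - v').
  by rewrite mulmxBl.
- by apply/AE; rewrite projmx_sub; eexists.
- by move=> x /AE[v ->]; exact: projmx_ortho.
Qed.

Lemma projmx_id d N (B : 'M[R]_(d, N)) (z : 'rV[R]_N) : row_free B ->
  (z *m projmx B = z) <-> exists v, z = v *m B.
Proof.
move=> rB; split=> [<-|[v ->]]; first by rewrite projmx_sub; eexists.
by rewrite -mulmxA mul_projmx.
Qed.

Lemma smooth_projmx (V : normedModType R) d N (B : V -> 'M[R]_(d, N)) x :
  row_free (B x) -> smooth_at B x -> smooth_at (fun y => projmx (B y)) x.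
Proof.
move=> rB sB; have sT := smooth_tr sB.
apply: smooth_mulmx => //; apply: smooth_mulmx => //.
by apply: smooth_invmx; [exact: gram_unit|exact: smooth_mulmx].
Qed.

Lemma near_row_free (V : normedModType R) d N (B : V -> 'M[R]_(d, N)) x :
  row_free (B x) -> smooth_at B x -> \forall y \near x, row_free (B y).
Proof.
move=> rB sB; have : \forall y \near x, B y *m (B y)^T \in unitmx.
  apply: smooth_near_unitmx; last exact: gram_unit.
  by apply: smooth_mulmx => //; exact: smooth_tr.
apply: filterS => y uy; apply: inj_row_free => v vB.
rewrite -row_free_unit in uy.
by apply: (row_free_inj uy); rewrite /= mulmxA vB !mul0mx.
Qed.

(** Replaces vector spaces by matrices with independent rows, the only form of a basis used
    below. *)
Lemma has_dimP N (A : set 'rV[R]_N) d : has_dim A d <->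
  exists2 B : 'M[R]_(d, N), row_free B & forall x, A x <-> exists v, x = v *m B.
Proof.
split=> [[V [AV dV]]|[B rB AB]].
  move: (dV) => <-.
  exists (\matrix_(i < \dim V) (vbasis V)`_i).
    apply: inj_row_free => v; rewrite mulmx_sum_row => H.
    have /freeP/(_ (v 0)) := basis_free (vbasisP V).
    under eq_bigr => i _ do rewrite -[(vbasis V)`_i](rowK (fun i : 'I_(\dim V) => (vbasis V)`_i)).
    by move=> /(_ H) h; apply/rowP => i; rewrite h mxE.
  move=> x; rewrite AV; split=> [xV|[v ->]].
    exists (\row_i coord (vbasis V) i x).
    rewrite mulmx_sum_row {1}(coord_vbasis xV); apply: eq_bigr => i _.
    by rewrite mxE rowK.
  rewrite mulmx_sum_row; apply: memv_suml => i _; rewrite memvZ//.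
  by rewrite rowK vbasis_mem// mem_nth// size_tuple.
pose f : 'Hom('rV[R]_d, 'rV[R]_N) := linfun (mulmxr B).
exists (limg f); split=> [x|].
  rewrite AB; split=> [[v ->]|/memv_imgP[v _ ->]].
    by apply/memv_imgP; exists v; rewrite ?memvf// lfunE.
  by exists v; rewrite lfunE.
rewrite limg_dim_eq ?dimvf /dim /= ?mul1n//.
apply/eqP; rewrite -subv0; apply/subvP => v; rewrite memv_cap memv_ker => /andP[_].
rewrite lfunE /= memv0 => /eqP vB.
by apply/eqP/(row_free_inj rB); rewrite vB mul0mx.
Qed.

End LinearAlgebra.

(** * Submanifolds with boundary *)

Section Directions.
Context {R : realType}.
Implicit Types V W : normedModType R.

Lemma smooth_cont_near V W (h : V -> W) x (P : W -> Prop) : smooth_at h x ->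
  (\forall z \near h x, P z) -> \forall y \near x, P (h y).
Proof. by move=> sh; have c := smooth_cont sh => /c. Qed.

Lemma derive_ge0_side V (f : V -> R) x v : differentiable f x ->
  (\forall s \near (0 : R)^'+, f x <= f (x + s *: v)) -> 0 <= 'D_v f x.
Proof.
move=> df H; have : derivable f x v := diff_derivable df; rewrite /derivable => cf.
have c1 : (fun h => h^-1 *: (f (h *: v + x) - f x)) @ (0:R)^'+ --> 'D_v f x.
  exact: cvg_dnbhs_at_right cf.
apply: (cvgr_to_ge c1); near=> s; apply: mulr_ge0.
  by rewrite invr_ge0.
by rewrite subr_ge0 [s *: v + x]addrC; exact: (near H s).
Unshelve. all: by end_near. Qed.

Lemma near_line V (x v : V) (P : V -> Prop) :
  (\forall y \near x, P y) -> \forall s \near (0 : R)^'+, P (x + s *: v).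
Proof.
move=> H; have c : (fun s : R => x + s *: v) @ (0:R)^'+ --> x.
  apply: cvg_at_right_filter.
  rewrite -[X in _ --> X]addr0 -[X in x + X](scale0r v).
  apply: cvgD; first exact: cvg_cst.
  by apply: cvgZr_tmp; exact: cvg_id.
exact: c _ H.
Qed.

Lemma derive_min V (f : V -> R) x v : differentiable f x ->
  (\forall y \near x, f x <= f y) -> 'D_v f x = 0.
Proof.
move=> df H.
have side w := near_line w H.
apply/eqP; rewrite eq_le (derive_ge0_side df (side v)) andbT.
by rewrite -oppr_ge0 -derive_dirN// (derive_ge0_side df (side _)).
Qed.

(** As ['D_(- v)] is [- 'D_v], a short ray on either side is enough to determine a derivative along
    [v] by values on [A]. *)
Definition has_dir V (A : set V) x v :=
  (\forall s \near (0 : R)^'+, A (x + s *: v)) \/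
  (\forall s \near (0 : R)^'+, A (x + s *: - v)).

Lemma derive_eq_dir V p q (F G : V -> 'M[R]_(p, q)) (A : set V) x v :
  differentiable F x -> differentiable G x -> A x -> has_dir A x v ->
  (\forall y \near x, A y -> F y = G y) -> 'D_v F x = 'D_v G x.
Proof.
move=> dF dG Ax dir FG; have FGx := nbhs_singleton FG Ax.
have FG' w := near_line w FG.
case: dir => dir.
  by apply: derive_eq_side => //; apply: filterS2 dir (FG' v) => s As; exact.
apply: oppr_inj; rewrite -!derive_dirN//.
by apply: derive_eq_side => //; apply: filterS2 dir (FG' (- v)) => s As; exact.
Qed.

(** The conclusion has the same shape as the hypothesis, so that second derivatives can be compared
    on a half-space as well. *)
Lemma derive_eq_dir_near V p q (F G : V -> 'M[R]_(p, q)) (A : set V) x v :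
  smooth_at F x -> smooth_at G x -> (forall y, A y -> has_dir A y v) ->
  (\forall y \near x, A y -> F y = G y) ->
  \forall y \near x, A y -> 'D_v F y = 'D_v G y.
Proof.
move=> sF sG dir FG; have nF := smooth_near sF; have nG := smooth_near sG.
have FG' := near_join FG.
near=> y => Ay; apply: (@derive_eq_dir _ _ _ _ _ A).
- exact: (smooth_diff (near nF y _)).
- exact: (smooth_diff (near nG y _)).
- by [].
- exact: dir.
- exact: (near FG' y).
Unshelve. all: by end_near. Qed.

(** One of [v] and [- v] has a nonnegative first coordinate, hence does not leave the half-space. *)
Lemma model_dir m b (a v : 'rV[R]_m) : model b a -> has_dir (model b) a v.
Proof.
case: b => /= [Ha|_]; last by left; near=> s.
have key (w : 'rV[R]_m) : (forall i : 'I_m, i = 0%N :> nat -> 0 <= w 0 i) ->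
    \forall s \near (0 : R)^'+, half_space (a + s *: w).
  move=> wi; near=> s => i i0; rewrite !mxE addr_ge0 ?Ha// mulr_ge0 ?wi//.
have [wi|/existsNP[i /not_implyP[i0 vi]]] := pselect (forall i : 'I_m, i = 0%N :> nat -> 0 <= v 0 i).
  by left; exact: key.
right; apply: key => j j0.
have -> : j = i by apply: val_inj; rewrite /= i0 j0.
by rewrite mxE oppr_ge0 leNgt; apply/negP => /ltW.
Unshelve. all: by end_near. Qed.

Lemma derive2_comp V m n (h : V -> 'rV[R]_m) (f : 'rV[R]_m -> 'rV[R]_n) y v w :
  smooth_at h y -> smooth_at f (h y) ->
  'D_v ('D_w (fun z => f (h z))) y =
    'D_('D_v h y) ('D_('D_w h y) f) (h y) + 'D_('D_v ('D_w h) y) f (h y).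
Proof.
move=> sh sf; have nh := smooth_near sh.
have nf : \forall z \near y, smooth_at f (h z) := smooth_cont_near sh (smooth_near sf).
have E : \forall z \near y, 'D_w h z *m jacobian f (h z) = 'D_w (fun z => f (h z)) z.
  near=> z; have sz : smooth_at h z by exact: (near nh z).
  have sfz : smooth_at f (h z) by exact: (near nf z).
  have := derive_comp w (smooth_diff sz) (smooth_diff sfz); rewrite /comp => ->.
  by rewrite deriveEjacobian//; exact: smooth_diff.
rewrite -(near_eq_derive _ E).
have sJ := smooth_jacobian sf.
have sD := smooth_derive w sh.
have dJh : differentiable (fun z => jacobian f (h z)) y by apply: smooth_diff; exact: smooth_comp.
rewrite (derive_mulmx v (smooth_diff sD) dJh) addrC; congr (_ + _); last first.
  by rewrite -deriveEjacobian//; exact: smooth_diff.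
have := derive_comp v (smooth_diff sh) (smooth_diff sJ); rewrite /comp => ->.
rewrite -(derive_mulmxl _ _ (smooth_diff sJ)).
apply: near_eq_derive; have nf' := smooth_near sf.
near=> z; rewrite deriveEjacobian//; exact: (smooth_diff (near nf' z _)).
Unshelve. all: by end_near. Qed.

End Directions.

Section Submanifold.
Context {R : realType} {N m : nat}.
Implicit Types (S : set 'rV[R]_N) (phi : 'rV[R]_m -> 'rV[R]_N).

Lemma param_smooth S p b U phi a : param_at S p b U phi a -> smooth_at phi a.
Proof. by move=> [[oU /smooth_onP sU _ _ _] [Ua _] _]; exact: sU. Qed.

Lemma param_row_free S p b U phi a : param_at S p b U phi a -> row_free (jacobian phi a).
Proof.
move=> Pa; have sphi := param_smooth Pa.
move: Pa => [[oU sU inj _ _] [Ua _] _].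
apply: inj_row_free => v; rewrite -deriveEjacobian; last exact: smooth_diff.
by rewrite deriveE; [exact: inj|exact: smooth_diff].
Qed.

Lemma param_sub S p b U phi a : param_at S p b U phi a ->
  forall x, (U `&` model b) x -> param_at S (phi x) b U phi x.
Proof. by move=> [lp _ _] x Ux; split. Qed.

Lemma param_mem S p b U phi a : param_at S p b U phi a -> S p.
Proof.
move=> [[_ _ _ _ [W [_ SO]]] Ua pa]; rewrite -pa.
have : (phi @` (U `&` model b)) (phi a) by exists a.
by rewrite -SO => -[].
Qed.

(** The map [phi x *m L] has invertible differential at [a], and [psi] is its local inverse; [S]
    becomes a graph in which a point [q] is recovered from [q *m L]. That the parameter of [q] is
    close to [a] when [q] is close to [p] is the continuity of the inverse of the embedding. *)
Lemma param_chart S p b U phi a : param_at S p b U phi a ->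
  forall L, jacobian phi a *m L = 1%:M ->
  exists psi : 'rV[R]_m -> 'rV[R]_m,
  [/\ smooth_at psi (p *m L), psi (p *m L) = a,
      \forall y \near p *m L, phi (psi y) *m L = y &
      \forall q \near p, S q ->
         (U `&` model b) (psi (q *m L)) /\ phi (psi (q *m L)) = q].
Proof.
move=> Pa L JL; have sphi := param_smooth Pa.
have sf : smooth_at (fun x => phi x *m L) a by apply: smooth_mulmx => //; exact: smooth_cst.
have Jf : jacobian (fun x => phi x *m L) a \in unitmx.
  suff -> : jacobian (fun x => phi x *m L) a = 1%:M by rewrite unitmx1.
  apply: jacobian_eq => [|v]; first exact: smooth_diff.
  by rewrite derive_mulmxr ?deriveEjacobian -?mulmxA ?JL//; exact: smooth_diff.
have [psi [spsi psia n1 n2]] := local_inverse sf Jf.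
move: Pa => [[oU sU _ [gi [gK _ gc]] [W [oO SO]]] Ua pa].
rewrite pa in spsi psia n1 n2; exists psi; split => //.
have Op : W p.
  have : (phi @` (U `&` model b)) p by exists a.
  by rewrite -SO => -[].
have imp : (phi @` (U `&` model b)) p by exists a.
have gcp : gi @ within (phi @` (U `&` model b)) (nbhs p) --> gi p.
  exact: (subspace_continuousP _ _).1 gc p imp.
have ga : gi p = a by rewrite -pa gK.
rewrite ga in gcp; have n3 := gcp _ n2.
have n4 : \forall q \near p, W q by exact: open_nbhs_nbhs.
have n5 : \forall q \near p, (phi @` (U `&` model b)) q -> psi (phi (gi q) *m L) = gi q.
  exact: n3.
apply: filterS2 n4 n5 => q Oq nq Sq.
have imq : (phi @` (U `&` model b)) q by rewrite -SO.
have E := nq imq.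
have [z Uz zq] := imq.
have gz : gi q = z by rewrite -zq gK.
rewrite gz zq in E.
by rewrite E.
Unshelve. all: by end_near. Qed.

(** The map [h] is required to take values in [S] on [A] only: this covers curves on an interval
    with end points and parametrizations on a half-space. The lift is nevertheless smooth on a full
    neighbourhood. *)
Lemma param_lift S p b U phi a : param_at S p b U phi a ->
  forall (V : normedModType R) (h : V -> 'rV[R]_N) (A : set V) y0,
  smooth_at h y0 -> h y0 = p -> (\forall y \near y0, A y -> S (h y)) ->
  exists c : V -> 'rV[R]_m, [/\ smooth_at c y0, c y0 = a &
    \forall y \near y0, A y -> (U `&` model b) (c y) /\ h y = phi (c y)].
Proof.
move=> Pa V h A y0 sh hp hA.
have /row_freeP[L JL] := param_row_free Pa.
have [psi [spsi psia _ n]] := param_chart Pa JL.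
have shL : smooth_at (fun y => h y *m L) y0 by apply: smooth_mulmx => //; exact: smooth_cst.
exists (fun y => psi (h y *m L)); split.
- by apply: smooth_comp => //; rewrite hp.
- by rewrite hp.
- rewrite -hp in n; have n' := smooth_cont_near sh n.
  by apply: filterS2 hA n' => y hAy ny Ay; have [] := ny (hAy Ay).
Unshelve. all: by end_near. Qed.

Lemma param_transition S p b U phi a b' U' phi' a' :
  param_at S p b U phi a -> param_at S p b' U' phi' a' ->
  exists c : 'rV[R]_m -> 'rV[R]_m, [/\ smooth_at c a, c a = a' &
    \forall x \near a, model b x -> (U' `&` model b') (c x) /\ phi x = phi' (c x)].
Proof.
move=> Pa Pa'; have sphi := param_smooth Pa.
have [[oU _ _ _ _] [Ua _] pa] := Pa.
have nU : \forall x \near a, U x by exact: open_nbhs_nbhs.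
apply: (param_lift Pa' (h := phi) (A := model b)) => //.
by apply: filterS nU => x Ux mx; apply: (param_mem (param_sub Pa _)).
Qed.

(** [tangent] collects the images of all parametrizations. Through the transition map any two of
    them agree, their derivatives being compared on the half-space along [has_dir] directions. *)
Lemma tangentE S p b U phi a : param_at S p b U phi a ->
  forall x, tangent m S p x <-> exists v, x = v *m jacobian phi a.
Proof.
move=> Pa x; have sphi := param_smooth Pa; split; last first.
  move=> [v ->]; exists b, U, phi, a; split=> //; exists v.
  by rewrite -deriveEjacobian ?deriveE//; exact: smooth_diff.
move=> [b' [U' [phi' [a' [Pa' [v ->]]]]]].
have sphi' := param_smooth Pa'.
have [c [sc ca nc]] := param_transition Pa' Pa.
have [_ [_ ma'] _] := Pa'.
rewrite -deriveE; last exact: smooth_diff.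
have sfc : smooth_at (fun x => phi (c x)) a' by apply: smooth_comp => //; rewrite ca.
have -> : 'D_v phi' a' = 'D_v (fun x => phi (c x)) a'.
  apply: (@derive_eq_dir _ _ _ _ _ _ (model b')) => //; try exact: smooth_diff.
    exact: model_dir.
  by apply: filterS nc => y H /H[].
exists ('D_v c a').
have := derive_comp v (smooth_diff sc) (_ : differentiable phi (c a')).
rewrite /comp => ->; rewrite ca; last exact: smooth_diff.
by rewrite deriveEjacobian//; exact: smooth_diff.
Qed.

Definition norproj phi a : 'M[R]_N := 1%:M - projmx (jacobian phi a).

Lemma norproj_eq0 phi a (z : 'rV[R]_N) : row_free (jacobian phi a) ->
  z *m norproj phi a = 0 <-> exists v, z = v *m jacobian phi a.
Proof.
move=> rJ; rewrite /norproj mulmxBr mulmx1 -(projmx_id z rJ); split.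
  by move/subr0_eq.
by move=> ->; rewrite subrr.
Qed.

Lemma tangent_orthproj S p b U phi a z : param_at S p b U phi a ->
  orthproj (tangent m S p) z = z *m projmx (jacobian phi a).
Proof.
by move=> Pa; apply: orthprojE; [exact: param_row_free Pa|exact: tangentE Pa].
Qed.

(** Independence of the parametrization: if [phi' = phi \o c] on the model, the second derivatives
    differ by the derivative of [phi] along ['D_v' ('D_w' c) a'], a tangent vector, which [norproj]
    kills. *)
Lemma sff_param S p b U phi a : param_at S p b U phi a -> forall v w,
  sff m S p (v *m jacobian phi a) (w *m jacobian phi a)
    = 'D_v ('D_w phi) a *m norproj phi a.
Proof.
move=> Pa v w; have sphi := param_smooth Pa; have rJ := param_row_free Pa.
have dphi : differentiable phi a := smooth_diff sphi.
apply: xget_subset1.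
  exists b, U, phi, a, v, w; split=> //.
  - by rewrite -deriveEjacobian ?deriveE.
  - by rewrite -deriveEjacobian ?deriveE.
  - by rewrite (tangent_orthproj _ Pa) /norproj mulmxBr mulmx1.
suff K z : (exists b' U' phi' a' v' w', [/\ param_at S p b' U' phi' a',
    v *m jacobian phi a = 'd phi' a' v', w *m jacobian phi a = 'd phi' a' w' &
    z = 'D_v' ('D_w' phi') a' - orthproj (tangent m S p) ('D_v' ('D_w' phi') a')]) ->
    z = 'D_v ('D_w phi) a *m norproj phi a.
  by move=> z z' /K -> /K ->.
move=> [b' [U' [phi' [a' [v' [w' [Pa' vv' ww' ->]]]]]]].
have sphi' := param_smooth Pa'.
have [c [sc ca nc]] := param_transition Pa' Pa.
have [_ [_ ma'] _] := Pa'.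
have sphic : smooth_at phi (c a') by rewrite ca.
have sfc : smooth_at (fun x => phi (c x)) a' by apply: smooth_comp.
have neq : \forall x \near a', model b' x -> phi' x = phi (c x).
  by apply: filterS nc => y H /H[].
have E1 u : 'D_u phi' a' = 'D_u c a' *m jacobian phi a.
  have -> : 'D_u phi' a' = 'D_u (fun x => phi (c x)) a'.
    apply: (@derive_eq_dir _ _ _ _ _ _ (model b')) => //; try exact: smooth_diff.
    exact: model_dir.
  have := derive_comp u (smooth_diff sc) (smooth_diff sphic).
  by rewrite /comp => ->; rewrite ca deriveEjacobian.
have E2 : 'D_v' ('D_w' phi') a' = 'D_v' ('D_w' (fun x => phi (c x))) a'.
  apply: (@derive_eq_dir _ _ _ _ _ _ (model b')) => //.
  - exact: smooth_diff (smooth_derive _ sphi').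
  - exact: smooth_diff (smooth_derive _ sfc).
  - exact: model_dir.
  - by apply: derive_eq_dir_near => // y; exact: model_dir.
have inj u u' : u *m jacobian phi a = 'd phi' a' u' -> 'D_u' c a' = u.
  rewrite -deriveE; last exact: smooth_diff.
  by rewrite E1 => /(row_free_inj rJ).
rewrite E2 (derive2_comp _ _ sc sphic) (inj _ _ vv') (inj _ _ ww') ca.
rewrite (tangent_orthproj _ Pa) -[X in X - _]mulmx1 -mulmxBr -/(norproj phi a) mulmxDl.
have Z : 'D_('D_v' ('D_w' c) a') phi a *m norproj phi a = 0.
  by apply/(norproj_eq0 _ rJ); rewrite deriveEjacobian; [eexists|].
by rewrite Z addr0.
Qed.

End Submanifold.

Section Boundary.
Context {R : realType} {N m : nat}.
Implicit Types (S : set 'rV[R]_N).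

(** In a half-space chart sending [p] to the boundary, the first coordinate of the transition map
    would have a minimum at the interior parameter [a]. Its differential would vanish there, whereas
    the transition map has invertible Jacobian. *)
Lemma boundary_param S p b (U : set 'rV[R]_m.+1) phi a : param_at S p b U phi a ->
  (\forall x \near a, model b x) -> ~ boundary m.+1 S p.
Proof.
move=> Pa na [U' [phi' [a' [Pa' bda']]]].
have [c [sc ca nc]] := param_transition Pa Pa'.
have sphi := param_smooth Pa; have sphi' := param_smooth Pa'.
have nc' : \forall x \near a, half_space (c x) /\ phi x = phi' (c x).
  by apply: filterS2 na nc => x + H => /H[[_ ?] ?].
have E v : 'D_v phi a = 'D_v c a *m jacobian phi' a'.
  have -> : 'D_v phi a = 'D_v (fun x => phi' (c x)) a.
    by apply: near_eq_derive; apply: filterS nc' => x [].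
  have sphic : smooth_at phi' (c a) by rewrite ca.
  have := derive_comp v (smooth_diff sc) (smooth_diff sphic).
  by rewrite /comp => ->; rewrite ca deriveEjacobian//; exact: smooth_diff.
have rJc : row_free (jacobian c a).
  apply: inj_row_free => v; rewrite -deriveEjacobian; last exact: smooth_diff.
  move=> Dv; apply: (row_free_inj (param_row_free Pa)).
  by rewrite /= mul0mx -deriveEjacobian ?E ?Dv ?mul0mx//; exact: smooth_diff.
have dc : differentiable (fun x => c x 0 ord0) a.
  by apply: smooth_diff; exact: smooth_coord.
have D0 v : ('D_v c a) 0 ord0 = 0.
  have -> : ('D_v c a) 0 ord0 = 'D_v (fun x => c x 0 ord0) a.
    by apply: derive_entry; exact: smooth_diff.
  apply: derive_min dc _; rewrite ca (bda' ord0)//.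
  by apply: filterS nc' => x [+ _]; exact.
have uJ : jacobian c a \in unitmx by rewrite -row_free_unit.
have := D0 (delta_mx 0 ord0 *m invmx (jacobian c a)).
rewrite deriveEjacobian; last exact: smooth_diff.
by rewrite mulmxKV// mxE !eqxx => /eqP; rewrite oner_eq0.
Qed.

Lemma nonboundary_param S p b (U : set 'rV[R]_m.+1) phi a : param_at S p b U phi a ->
  ~ boundary m.+1 S p -> \forall x \near a, model b x.
Proof.
case: b => Pa nb; last by near=> x.
have [_ [_ /= Ha] _] := Pa.
have a0 : 0 < a 0 ord0.
  rewrite lt_neqAle Ha// andbT; apply/eqP => a0; apply: nb.
  exists U, phi, a; split=> // i i0.
  by have -> : i = ord0 by apply: val_inj.
have ca : {for a, continuous (fun x : 'rV[R]_m.+1 => x 0 ord0)}.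
  exact: coord_continuous.
have : \forall x \near a, 0 < (x : 'rV[R]_m.+1) 0 ord0.
  exact: ca _ (open_nbhs_nbhs (conj (@open_gt _ (0:R)) a0)).
apply: filterS => x x0 i i0.
by have -> : i = ord0 by [apply: val_inj]; exact: ltW.
Unshelve. all: by end_near. Qed.

End Boundary.

(** * Germs of an interval at its points, and smooth extension past its end points *)

Section Interval.
Context {R : realType}.
Implicit Types I : set R.

Lemma near_gt (s t : R) : s < t -> \forall x \near t, s < x.
Proof. by move=> st; exact: open_nbhs_nbhs (conj (@open_gt _ s) st). Qed.

Lemma near_lt (s t : R) : t < s -> \forall x \near t, x < s.
Proof. by move=> st; exact: open_nbhs_nbhs (conj (@open_lt _ s) st). Qed.

(** At an end point, [tau] is the inward direction; left and right end points are treated together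
    through it. *)
Lemma interval_germ I t0 : is_interval I -> I° !=set0 -> I t0 ->
  I° t0 \/
  [/\ ~ I° t0 & exists2 tau : R, tau = 1 \/ tau = -1 &
    (forall s, I s -> 0 <= tau * (s - t0)) /\ \forall t \near t0, 0 <= tau * (t - t0) -> I t].
Proof.
move=> hI [t1 It1] It0; have [|nIt0] := pselect (I° t0); [by left|right; split=> //].
have I1 := interior_subset It1.
have [t01|t10|t01] := ltgtP t0 t1; last by exfalso; apply: nIt0; rewrite t01.
- exists 1; [by left|split].
    move=> s Is; rewrite mul1r subr_ge0 leNgt; apply/negP => st0.
    apply: nIt0; apply: filterS2 (near_gt st0) (near_lt t01) => t st tt1.
    by apply: (hI _ _ Is I1); rewrite !ltW.
  apply: filterS (near_lt t01) => t tt1; rewrite mul1r subr_ge0 => t0t.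
  by apply: (hI _ _ It0 I1); rewrite t0t ltW.
- exists (-1); [by right|split].
    move=> s Is; rewrite mulN1r opprB subr_ge0 leNgt; apply/negP => st0.
    apply: nIt0; apply: filterS2 (near_gt t10) (near_lt st0) => t st tt1.
    by apply: (hI _ _ I1 Is); rewrite !ltW.
  apply: filterS (near_gt t10) => t tt1; rewrite mulN1r opprB subr_ge0 => t0t.
  by apply: (hI _ _ I1 It0); rewrite t0t ltW.
Qed.

Lemma interval_dir I t0 : is_interval I -> I° !=set0 -> I t0 -> has_dir I t0 1.
Proof.
move=> hI hI0 It0; have [n|[_ [tau tauE [_ n]]]] := interval_germ hI hI0 It0.
  by left; apply: near_line.
case: tauE => tauE; rewrite tauE in n; [left|right].
  have n' := @near_line _ _ t0 (1 : R) _ n.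
  apply: filterS2 n' (nbhs_right_gt 0) => s + s0; apply.
  by rewrite addrAC subrr add0r mul1r /GRing.scale /= mulr1 ltW.
have n' := @near_line _ _ t0 (-1 : R) _ n.
apply: filterS2 n' (nbhs_right_gt 0) => s + s0; apply.
by rewrite addrAC subrr add0r mulN1r /GRing.scale /= mulrN1 opprK ltW.
Unshelve. all: by end_near. Qed.

(** No partition of unity is involved: on [I] the function is [f] itself, and beyond an end point it
    is continued by the one germ chosen at that end point. *)
Lemma smooth_glue I p q (f : R -> 'M[R]_(p, q)) : is_interval I -> I° !=set0 ->
  (forall t0, I t0 -> exists2 h : R -> 'M[R]_(p, q), smooth_at h t0 &
     \forall t \near t0, I t -> h t = f t) ->
  exists2 F : R -> 'M[R]_(p, q), smooth_on I F & forall t, I t -> F t = f t.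
Proof.
move=> hI hI0 hf.
have /choice[h hP] t0 : exists h : R -> 'M[R]_(p, q),
    I t0 -> smooth_at h t0 /\ \forall t \near t0, I t -> h t = f t.
  have [It0|nIt0] := pselect (I t0); last by exists f.
  by have [h] := hf t0 It0; exists h.
(* For [t] outside [I] near an end point of [I], this is the end point that separates [t] from [I];
   it is unique. The default [0] never matters near [I]. *)
pose e t := xget 0 [set t0 | [/\ I t0, ~ I° t0 &
  (forall s, I s -> t <= t0 <= s) \/ (forall s, I s -> s <= t0 <= t)]].
pose F t := if `[< I t >] then f t else h (e t) t.
have FI t : I t -> F t = f t by move=> It; rewrite /F asboolT.
exists F => //; apply/smooth_onP => t0 It0.
have [sh nh] := hP t0 It0.
have [n|[nI [tau tauE [It n]]]] := interval_germ hI hI0 It0.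
  by apply: smooth_at_eq sh; apply: filterS2 n nh => t It /(_ It) ->; rewrite FI.
apply: smooth_at_eq sh; apply: filterS2 n nh => t n nh.
have [It'|nIt] := pselect (I t); first by rewrite nh// FI.
rewrite /F asboolF//; congr (h _ t).
apply/esym; apply: xget_subset1.
  split=> //; case: tauE => tauE; rewrite tauE in It n.
    left=> s /It; rewrite mul1r subr_ge0 => ->; rewrite andbT leNgt.
    by apply/negP => /ltW tt0; apply: nIt; apply: n; rewrite mul1r subr_ge0.
  right=> s /It; rewrite mulN1r opprB subr_ge0 => -> /=; rewrite leNgt.
  by apply/negP => /ltW tt0; apply: nIt; apply: n; rewrite mulN1r opprB subr_ge0.
suff K t1 : [/\ I t1, ~ I° t1 &
    (forall s, I s -> t <= t1 <= s) \/ (forall s, I s -> s <= t1 <= t)] -> t1 = t0.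
  by move=> x y /K -> /K ->.
move=> [It1 _ [H|H]].
  have /andP[tt1 t1t0] := H _ It0.
  apply/eqP; rewrite eq_le t1t0 /=.
  case: tauE => tauE; rewrite tauE in It n.
    by have := It _ It1; rewrite mul1r subr_ge0.
  exfalso; apply: nIt; apply: n; rewrite mulN1r opprB subr_ge0.
  exact: le_trans tt1 t1t0.
have /andP[t0t1 t1t] := H _ It0.
apply/eqP; rewrite eq_le t0t1 andbT.
case: tauE => tauE; rewrite tauE in It n.
  exfalso; apply: nIt; apply: n; rewrite mul1r subr_ge0.
  exact: le_trans t0t1 t1t.
by have := It _ It1; rewrite mulN1r opprB subr_ge0.
Qed.

End Interval.

(** * Curves in a submanifold *)

Section Curve.
Context {R : realType} {N m : nat}.
Implicit Types (S : set 'rV[R]_N).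

Definition tproj (A : set 'rV[R]_N) : 'M[R]_N := \matrix_i orthproj A (delta_mx 0 i).

Lemma tprojE d (A : set 'rV[R]_N) (B : 'M[R]_(d, N)) : row_free B ->
  (forall x, A x <-> exists v, x = v *m B) -> tproj A = projmx B.
Proof.
move=> rB AB; apply/row_matrixP => i; rewrite rowK (orthprojE _ rB AB).
by rewrite rowE.
Qed.

Lemma tproj_param S p b (U : set 'rV[R]_m) phi a : param_at S p b U phi a ->
  tproj (tangent m S p) = projmx (jacobian phi a).
Proof.
by move=> Pa; apply: tprojE; [exact: param_row_free Pa|exact: tangentE Pa].
Qed.

Variables (S : set 'rV[R]_N) (I : set R) (g : R -> 'rV[R]_N).
Hypothesis sS : submanifold m S.
Hypothesis hI : is_interval I.
Hypothesis hI0 : I° !=set0.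
Hypothesis sg : smooth_on I g.
Hypothesis gS : forall t, I t -> S (g t).

Let sgt t : I t -> smooth_at g t.
Proof. by move: t; exact/smooth_onP. Qed.

Lemma curve_lift t0 b (U : set 'rV[R]_m) phi a : I t0 -> param_at S (g t0) b U phi a ->
  exists c : R -> 'rV[R]_m, [/\ smooth_at c t0, c t0 = a &
    \forall t \near t0, I t -> (U `&` model b) (c t) /\ g t = phi (c t)].
Proof.
move=> It0 Pa; apply: (param_lift Pa (h := g) (A := I)) => //; first exact: sgt.
by near=> t => It; exact: gS.
Unshelve. all: by end_near. Qed.

Lemma tproj_smooth : exists2 P : R -> 'M[R]_N, smooth_on I P &
  forall t, I t -> P t = tproj (tangent m S (g t)).
Proof.
apply: smooth_glue => // t0 It0.
have [b [U [phi [a Pa]]]] := sS (gS It0).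
have [c [sc ca nc]] := curve_lift It0 Pa.
have sphi : smooth_at phi (c t0) by rewrite ca; exact: param_smooth Pa.
exists (fun t => projmx (jacobian phi (c t))).
  apply: smooth_projmx; first by rewrite ca; exact: param_row_free Pa.
  by apply: smooth_comp => //; exact: smooth_jacobian.
apply: filterS nc => t nct It; have [Uc gc] := nct It.
by rewrite gc (tproj_param (param_sub Pa Uc)).
Qed.

Variable P : R -> 'M[R]_N.
Hypothesis sP : smooth_on I P.
Hypothesis PE : forall t, I t -> P t = tproj (tangent m S (g t)).

Lemma curve_basis t : I t -> exists2 B : 'M[R]_(m, N), row_free B & P t = projmx B.
Proof.
move=> It; have [b [U [phi [a Pa]]]] := sS (gS It).
by exists (jacobian phi a); [exact: param_row_free Pa|rewrite PE// (tproj_param Pa)].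
Qed.

Lemma curve_tangent t x : I t -> tangent m S (g t) x <-> x *m P t = x.
Proof.
move=> It; have [b [U [phi [a Pa]]]] := sS (gS It).
rewrite PE// (tproj_param Pa) projmx_id; last exact: param_row_free Pa.
exact: tangentE Pa x.
Qed.

Lemma curve_velocity t b (U : set 'rV[R]_m) phi a c : I t -> param_at S (g t) b U phi a ->
  smooth_at c t -> c t = a -> (\forall t \near t, I t -> g t = phi (c t)) ->
  derive1 g t = derive1 c t *m jacobian phi a.
Proof.
move=> It Pa sc ca nc.
have sphi : smooth_at phi (c t) by rewrite ca; exact: param_smooth Pa.
have -> : derive1 g t = 'D_1 (fun t => phi (c t)) t.
  rewrite derive1E; apply: (@derive_eq_dir _ _ _ _ _ _ I) => //.
  - exact: smooth_diff (sgt It).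
  - by apply: smooth_diff; exact: smooth_comp.
  - exact: interval_dir.
rewrite derive1E.
have := derive_comp (1:R) (smooth_diff sc) (smooth_diff sphi); rewrite /comp => ->.
by rewrite deriveEjacobian ?ca//; rewrite -ca; exact: smooth_diff.
Qed.

Lemma curve_derive_tangent t : I t -> derive1 g t *m P t = derive1 g t.
Proof.
move=> It; have [b [U [phi [a Pa]]]] := sS (gS It).
have [c [sc ca nc]] := curve_lift It Pa.
apply/curve_tangent => //; apply/(tangentE Pa); exists (derive1 c t).
by apply: curve_velocity => //; first exact: Pa; apply: filterS nc => s H /H[].
Qed.

(** Let [Y] be the tangent field along the curve with constant coefficients in a chart and
    [Y t = y]. Differentiating [Y = Y P] gives [Y' (1 - P) = y P'], and the left side is what the
    Gauss formula computes. No chart is left in the result. *)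
Lemma curve_sff t y : I t -> y *m P t = y ->
  sff m S (g t) (derive1 g t) y = y *m derive1 P t *m (1%:M - P t).
Proof.
move=> It yP; have [b [U [phi [a Pa]]]] := sS (gS It).
have [c [sc ca nc]] := curve_lift It Pa.
have sphi := param_smooth Pa; have rJ := param_row_free Pa.
have vel : derive1 g t = derive1 c t *m jacobian phi a.
  by apply: (curve_velocity It Pa sc ca); apply: filterS nc => s H /H[].
have [v yv] : exists v, y = v *m jacobian phi a.
  by apply/(tangentE Pa)/curve_tangent.
have sJ : smooth_at (jacobian phi) (c t) by rewrite ca; exact: smooth_jacobian.
have sJc : smooth_at (fun s => jacobian phi (c s)) t by exact: smooth_comp.
have sPt : smooth_at P t by exact: (smooth_onP _ _).1 sP _ It.
pose Y s := v *m jacobian phi (c s).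
have sY : smooth_at Y t by apply: smooth_mulmx => //; exact: smooth_cst.
have nY : \forall s \near t, I s -> Y s = Y s *m P s.
  have nr := near_row_free (B := fun s => jacobian phi (c s)) (x := t).
  have := nr; rewrite ca => /(_ rJ sJc) {}nr.
  apply: filterS2 nr nc => s rs ncs Is; have [Uc gc] := ncs Is.
  rewrite (PE Is) gc (tproj_param (param_sub Pa Uc)) /Y.
  have rs' : row_free (jacobian phi (c s)) := rs.
  have e := congr1 (mulmx v) (mul_projmx rs').
  by rewrite mulmxA in e; exact: esym e.
have E1 : 'D_1 Y t = 'D_1 Y t *m P t + Y t *m 'D_1 P t.
  rewrite -derive_mulmx; [|exact: smooth_diff..].
  apply: (@derive_eq_dir _ _ _ _ _ _ I) => //.
  - exact: smooth_diff.
  - by apply: smooth_diff; exact: smooth_mulmx.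
  - exact: interval_dir.
have Yt : Y t = y by rewrite /Y ca yv.
have E2 : 'D_1 Y t *m (1%:M - P t) = y *m derive1 P t.
  by rewrite mulmxBr mulmx1 {1}E1 addrAC subrr add0r Yt derive1E.
have PP : P t *m P t = P t.
  have [B rB ->] := curve_basis It.
  by rewrite {1}/projmx -mulmxA mul_projmx.
have E3 : y *m derive1 P t *m (1%:M - P t) = 'D_1 Y t *m (1%:M - P t).
  rewrite -E2 -mulmxA; congr (_ *m _).
  by rewrite mulmxBr mulmx1 mulmxBl mul1mx PP subrr subr0.
rewrite E3 vel {1}yv (sff_param Pa) /norproj (PE It) (tproj_param Pa); congr (_ *m _).
rewrite /Y derive_mulmxl; last exact: smooth_diff.
have := derive_comp (1:R) (smooth_diff sc) (smooth_diff sJ); rewrite /comp => ->.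
rewrite -derive1E ca -derive_mulmxl; last by rewrite -ca; exact: smooth_diff.
apply: near_eq_derive; apply: filterS (smooth_near sphi) => z sz.
exact: deriveEjacobian (smooth_diff sz).
Qed.

End Curve.

Section Spans.
Context {R : realType}.

Definition spans d N (B : 'M[R]_(d, N)) (A : set 'rV[R]_N) :=
  row_free B /\ forall x, A x <-> exists v, x = v *m B.

Lemma span_sub d d' N (B : 'M[R]_(d, N)) (B' : 'M[R]_(d', N)) :
  (forall v : 'rV_d, exists v' : 'rV_d', v *m B = v' *m B') -> (B <= B')%MS.
Proof.
move=> H; apply/row_subP => i; rewrite rowE.
by have [v' ->] := H (delta_mx 0 i); exact: submxMl.
Qed.

Lemma spans_le d d' N (B : 'M[R]_(d, N)) (B' : 'M[R]_(d', N)) A A' :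
  spans B A -> spans B' A' -> A `<=` A' -> (d <= d')%N.
Proof.
move=> [rB AB] [rB' AB'] AA'.
have := mxrankS (span_sub (B := B) (B' := B') _).
rewrite (eqP rB) (eqP rB'); apply=> v; apply/AB'/AA'/AB; by exists v.
Qed.

Lemma spans_uniq d d' N (B : 'M[R]_(d, N)) (B' : 'M[R]_(d', N)) A :
  spans B A -> spans B' A -> d = d'.
Proof.
move=> s s'; apply/eqP; rewrite eqn_leq.
by rewrite (spans_le s s') ?(spans_le s' s).
Qed.

Lemma spans_eq d N (B B' : 'M[R]_(d, N)) A A' :
  spans B A -> spans B' A' -> A `<=` A' -> A = A'.
Proof.
move=> [rB AB] [rB' AB'] AA'; apply/seteqP; split=> // x.
have sBB' : (B <= B')%MS.
  by apply: span_sub => v; apply/AB'/AA'/AB; exists v.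
have sB'B : (B' <= B)%MS.
  by have := (mxrank_leqif_sup sBB').2; rewrite (eqP rB) (eqP rB') eqxx => /esym.
move=> /AB'[v ->]; apply/AB.
have /submxP[D ->] : (v *m B' <= B)%MS by rewrite mulmx_sub.
by exists D.
Qed.

Lemma spans_row_base N (Q : 'M[R]_N) : Q *m Q = Q ->
  spans (row_base Q) [set y | y *m Q = y].
Proof.
move=> QQ; split; first exact: row_base_free.
move=> x; split=> [xQ|[v ->]].
  have /submxP[D ->] : (x <= row_base Q)%MS by rewrite eq_row_base -xQ submxMl.
  by exists D.
have /submxP[D ->] : (v *m row_base Q <= Q)%MS.
  by rewrite (submx_trans (submxMl _ _))// eq_row_base.
by rewrite /= -mulmxA QQ.
Qed.

Lemma has_dim_spans N (A : set 'rV[R]_N) d : has_dim A d <-> exists B : 'M[R]_(d, N), spans B A.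
Proof. by rewrite has_dimP; split=> [[B ? ?]|[B []]]; exists B. Qed.

End Spans.

(** * The kernel of a rank-one bilinear map, by an explicit projection *)

Section RankOneAlgebra.
Context {R : realType} {N m : nat}.
Variables (P A : 'M[R]_N) (v : 'rV[R]_N) (B : 'M[R]_(m.+1, N)).
Let nu := v *m A.
Hypothesis rB : row_free B.
Hypothesis PB : P = projmx B.
Hypothesis vP : v *m P = v.
Hypothesis PA : P *m A = A.
Hypothesis nu0 : nu != 0.
Hypothesis rank1 : forall y, y *m P = y -> exists k, y *m A = k *: nu.

Definition beta (y : 'rV[R]_N) : R := dot (y *m A) nu / dot nu nu.

(** On rows, [y kproj = y P - beta y v]: the tangential part of [y], corrected along [v] so that [A]
    kills it. An explicit formula is chosen because it depends smoothly on [P], [A] and [v]. *)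
Definition kproj : 'M[R]_N := P - (dot nu nu)^-1 *: (A *m nu^T *m v).

Let nn0 : dot nu nu != 0.
Proof. by apply: contra nu0 => /eqP/dot_eq0 ->. Qed.

Lemma PP_idem : P *m P = P.
Proof. by rewrite PB {1}/projmx -mulmxA mul_projmx. Qed.

Lemma betaE y : y *m A = beta y *: nu.
Proof.
have [k E] : exists k, y *m A = k *: nu.
  have [|k E] := rank1 (y := y *m P); first by rewrite -mulmxA PP_idem.
  by exists k; rewrite -E -mulmxA PA.
by rewrite /beta E dotZl mulfK.
Qed.

Lemma beta_v : beta v = 1.
Proof. by rewrite /beta -/nu divff. Qed.

Lemma beta_eq0 y : beta y = 0 <-> y *m A = 0.
Proof.
split=> [b0|yA]; first by rewrite betaE b0 scale0r.
by rewrite /beta yA dot0l mul0r.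
Qed.

Lemma kprojE y : y *m kproj = y *m P - beta y *: v.
Proof.
rewrite /kproj mulmxBr; congr (_ - _); rewrite -scalemxAr !mulmxA.
rewrite [y *m A *m nu^T]mx11_scalar mul_scalar_mx scalerA; congr (_ *: _).
by rewrite /beta -/nu [dot (y *m A) nu]dot_mx mulrC.
Qed.

Lemma kproj_A : kproj *m A = 0.
Proof.
apply/row_matrixP => i; rewrite row0 rowE mulmxA kprojE mulmxBl.
by rewrite -mulmxA PA -scalemxAl -/nu -betaE subrr.
Qed.

Lemma kproj_P : kproj *m P = kproj.
Proof.
apply/row_matrixP => i; rewrite !rowE mulmxA kprojE mulmxBl.
by rewrite -mulmxA PP_idem -scalemxAl vP.
Qed.

Lemma kprojP (y : 'rV[R]_N) : y *m kproj = y <-> y *m P = y /\ y *m A = 0.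
Proof.
split=> [E|[yP yA]]; last by rewrite kprojE yP (beta_eq0 y).2// scale0r subr0.
by rewrite -E -!mulmxA kproj_P kproj_A mulmx0.
Qed.

Lemma kproj_idem : kproj *m kproj = kproj.
Proof.
apply/row_matrixP => i; rewrite !rowE mulmxA.
by apply/kprojP; split; rewrite -!mulmxA ?kproj_P ?kproj_A ?mulmx0.
Qed.

Lemma kproj_decomp (y : 'rV[R]_N) : y *m P = y -> y = y *m kproj + beta y *: v.
Proof. by move=> yP; rewrite kprojE yP subrK. Qed.

(** Dimension count: [v] followed by a basis of the kernel is a basis of the row space of [B], of
    dimension [m.+1]. Independence is seen by applying [beta], which is [1] on [v] and [0] on the
    kernel. *)
Lemma kproj_spans : exists F : 'M[R]_(m, N), spans F [set y | y *m kproj = y].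
Proof.
have [rF KF] := spans_row_base kproj_idem.
suff E : \rank kproj = m by move: (row_base kproj) rF KF; rewrite E => F rF KF; exists F; split.
pose C : 'M[R]_(1 + \rank kproj, N) := col_mx v (row_base kproj).
have sB : spans B [set y | y *m P = y].
  by split=> // x; rewrite /= PB; exact: projmx_id.
have sC : spans C [set y | y *m P = y].
  split.
    apply: inj_row_free => w; rewrite -[w]hsubmxK mul_row_col => E.
    have w0 : lsubmx w 0 0 = 0.
      have := congr1 (fun z => beta z) E; rewrite /beta mulmxDl.
      have /kprojP[_ ->] : (rsubmx w *m row_base kproj) *m kproj = rsubmx w *m row_base kproj.
        by apply/KF; eexists.
      rewrite addr0 [lsubmx w]mx11_scalar mul_scalar_mx -scalemxAl -/nu dotZl mul0mx dot0l mul0r.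
      by rewrite mulfK// => ->; rewrite mxE.
    have w1 : lsubmx w = 0 by rewrite [lsubmx w]mx11_scalar w0 raddf0.
    rewrite w1 in E *; rewrite mul0mx add0r in E.
    have -> : rsubmx w = 0 by apply: (row_free_inj rF); rewrite mul0mx.
    by rewrite row_mx0.
  move=> x; split=> [/= xP|[w ->]] /=.
    have [u uE] : exists u, x *m kproj = u *m row_base kproj.
      by apply/KF => /=; rewrite -mulmxA kproj_idem.
    exists (row_mx (beta x)%:M u); rewrite mul_row_col mul_scalar_mx -uE addrC.
    exact: kproj_decomp.
  rewrite -[w]hsubmxK mul_row_col mulmxDl -[lsubmx w *m v *m P]mulmxA vP; congr (_ + _).
  have /kprojP[-> _]// : (rsubmx w *m row_base kproj) *m kproj = rsubmx w *m row_base kproj.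
  by apply/KF; eexists.
by have := spans_uniq sB sC; rewrite add1n => -[].
Qed.

End RankOneAlgebra.

(** * Ruled charts: one time coordinate and [m] leaf coordinates *)

Section HeadTail.
Context {R : realType} {m : nat}.
Implicit Types z w : 'rV[R]_m.+1.

Definition hd z : R := z 0 ord0.
Definition tl z : 'rV[R]_m := rsubmx (z : 'rV[R]_(1 + m)).
Definition mkz (s : R) (u : 'rV[R]_m) : 'rV[R]_m.+1 := row_mx (s%:M : 'M[R]_1) u.

Lemma hd_mkz s u : hd (mkz s u) = s.
Proof.
rewrite /hd /mkz; have -> : (ord0 : 'I_m.+1) = lshift m (ord0 : 'I_1) by apply: val_inj.
by apply: (etrans (row_mxEl (s%:M : 'M[R]_1) u 0 ord0)); rewrite mxE.
Qed.

Lemma tl_mkz s u : tl (mkz s u) = u.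
Proof. exact: row_mxKr. Qed.

Lemma mkzK z : mkz (hd z) (tl z) = z.
Proof.
transitivity (row_mx (lsubmx (z : 'rV[R]_(1 + m))) (rsubmx (z : 'rV[R]_(1 + m)))).
  apply: (congr1 (fun s : 'M[R]_1 => row_mx s (rsubmx (z : 'rV[R]_(1 + m))))).
  apply/rowP => i; rewrite !mxE ord1 eqxx mulr1n.
  by apply: (congr1 (z 0)); apply: val_inj.
exact: (@hsubmxK R 1 1 m z).
Qed.

Lemma hd_norm z : `|hd z| <= `|z|. Proof. exact: mx_entry_le. Qed.

Lemma mkz_norm s u : `|mkz s u| <= `|s| + `|u|.
Proof.
apply: mx_norm_le; first by rewrite addr_ge0.
move=> i j; rewrite ord1; have [k ->|k ->] := split_ordP (j : 'I_(1 + m)).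
  have -> : mkz s u 0 (lshift m k : 'I_m.+1) = s.
    by apply: (etrans (row_mxEl (s%:M : 'M[R]_1) u 0 k)); rewrite ord1 mxE.
  by rewrite lerDl.
have -> : mkz s u 0 (rshift 1 k : 'I_m.+1) = u 0 k by exact: (row_mxEr (s%:M : 'M[R]_1) u 0 k).
by rewrite (le_trans (mx_entry_le _ 0 k))// lerDr.
Qed.

Lemma hdB z w : hd (z - w) = hd z - hd w. Proof. by rewrite /hd !mxE. Qed.
Lemma tlB z w : tl (z - w) = tl z - tl w. Proof. exact: raddfB. Qed.
Lemma hd0 : hd 0 = 0. Proof. by rewrite /hd mxE. Qed.
Lemma tl0 : tl 0 = 0. Proof. exact: raddf0. Qed.

Lemma hd_tl_eq0 z : hd z = 0 -> tl z = 0 -> z = 0.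
Proof.
move=> h t; apply/eqP; rewrite -(mkzK z) h t -normr_le0.
by rewrite (le_trans (mkz_norm _ _))// !normr0 addr0.
Qed.

Lemma smooth_hd z : smooth_at hd z.
Proof. by apply: smooth_coord; exact: smooth_id. Qed.

Lemma smooth_tl z : smooth_at tl z.
Proof.
apply/smooth_mxP => i j; apply: smooth_at_eq (smooth_coord 0 (rshift 1 j : 'I_m.+1) (smooth_id z)).
by near=> y; rewrite mxE ord1.
Unshelve. all: by end_near. Qed.

Lemma derive_hd z w : 'D_w hd z = hd w.
Proof.
have := derive_entry w 0 ord0 (smooth_diff (smooth_id z)) => <-.
by rewrite derive_id.
Qed.

Lemma derive_tl z w : 'D_w tl z = tl w.
Proof.
apply/rowP => j; rewrite (derive_entry w 0 j (smooth_diff (smooth_tl z))).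
have -> : (fun y => tl y 0 j) = (fun y : 'rV[R]_m.+1 => y 0 (rshift 1 j : 'I_m.+1)).
  by apply/funext => y; rewrite mxE.
rewrite -(derive_entry w 0 (rshift 1 j : 'I_m.+1) (smooth_diff (smooth_id z))).
by rewrite derive_id mxE.
Qed.

End HeadTail.

Section RuledChart.
Context {R : realType} {N m : nat}.
Variables (g : R -> 'rV[R]_N) (Fr : R -> 'M[R]_(m, N)) (t0 tau : R) (u0 : 'rV[R]_m).

(** In the charts of the tube [tau] is [1] or [-1] and, when [t0] is an end point, is chosen so that
    the half-space [0 <= hd z] corresponds to the side on which [I] lies. The shift [u0] below puts
    the point under study at [z = 0]. *)
Definition rtime (z : 'rV[R]_m.+1) : R := t0 + tau * hd z.

Definition ruled_chart (z : 'rV[R]_m.+1) : 'rV[R]_N :=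
  g (rtime z) + (u0 + tl z) *m Fr (rtime z).

Lemma smooth_rtime z : smooth_at rtime z.
Proof.
apply: smoothD; first exact: smooth_cst.
by apply: smoothM; [exact: smooth_cst|exact: smooth_hd].
Qed.

Lemma derive_rtime z w : 'D_w rtime z = tau * hd w.
Proof.
have dh : derivable (hd : 'rV[R]_m.+1 -> R) z w := smooth_derivable (smooth_hd z).
have -> : rtime = cst t0 + tau *: (hd : 'rV[R]_m.+1 -> R) by [].
have d1 : derivable (cst t0 : 'rV[R]_m.+1 -> R) z w by exact: derivable_cst.
have d2 : derivable (tau *: (hd : 'rV[R]_m.+1 -> R)) z w by exact: derivableZ.
rewrite (deriveD d1 d2) derive_cst add0r.
by rewrite (deriveZ _ dh) derive_hd.
Qed.

Lemma smooth_ruled z : smooth_at g (rtime z) -> smooth_at Fr (rtime z) ->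
  smooth_at ruled_chart z.
Proof.
move=> sg sF; apply: smoothD.
  by apply: smooth_comp_R => //; exact: smooth_rtime.
apply: smooth_mulmx; last by apply: smooth_comp_R => //; exact: smooth_rtime.
by apply: smoothD; [exact: smooth_cst|exact: smooth_tl].
Qed.

Lemma derive_comp_rtime p q (f : R -> 'M[R]_(p, q)) z w : smooth_at f (rtime z) ->
  'D_w (fun z => f (rtime z)) z = (tau * hd w) *: derive1 f (rtime z).
Proof.
move=> sf; have df := smooth_diff sf.
have := derive_comp w (smooth_diff (smooth_rtime z)) df; rewrite /comp => ->.
rewrite derive_rtime -[X in 'D_X f _ = _]mulr1.
have := derive_dirZ (tau * hd w) (1 : R) df.
by rewrite {1}/GRing.scale /= => ->; rewrite derive1E.
Qed.

Lemma derive_ruled z w : smooth_at g (rtime z) -> smooth_at Fr (rtime z) ->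
  'D_w ruled_chart z =
    (tau * hd w) *: (derive1 g (rtime z) + (u0 + tl z) *m derive1 Fr (rtime z))
    + tl w *m Fr (rtime z).
Proof.
move=> sg sF.
have sgr : smooth_at (fun z => g (rtime z)) z by apply: smooth_comp_R => //; exact: smooth_rtime.
have sFr : smooth_at (fun z => Fr (rtime z)) z by apply: smooth_comp_R => //; exact: smooth_rtime.
have su : smooth_at (fun z : 'rV[R]_m.+1 => u0 + tl z) z.
  by apply: smoothD; [exact: smooth_cst|exact: smooth_tl].
have sm : smooth_at (fun z => (u0 + tl z) *m Fr (rtime z)) z by exact: smooth_mulmx.
have dtl : derivable (tl : 'rV[R]_m.+1 -> 'rV[R]_m) z w := smooth_derivable (smooth_tl z).
have Du : 'D_w (fun z : 'rV[R]_m.+1 => u0 + tl z) z = tl w.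
  have d1 : derivable (cst u0 : 'rV[R]_m.+1 -> 'rV[R]_m) z w by exact: derivable_cst.
  by apply: (etrans (deriveD d1 dtl)); rewrite derive_cst add0r derive_tl.
have dgr : derivable (fun z => g (rtime z)) z w := smooth_derivable sgr.
have dm : derivable (fun z => (u0 + tl z) *m Fr (rtime z)) z w := smooth_derivable sm.
apply: (etrans (deriveD dgr dm)).
rewrite (derive_mulmx w (smooth_diff su) (smooth_diff sFr)) Du.
rewrite (derive_comp_rtime w sg) (derive_comp_rtime w sF) scalerDr -scalemxAr.
by rewrite [tl w *m _ + _]addrC addrA.
Qed.

End RuledChart.

Section RightInverse.
Context {R : realType}.

(** The Moore-Penrose inverse of a matrix with independent rows: it reads off the coordinates of a
    vector of the row space, smoothly in [F]. *)
Definition rightinv d N (F : 'M[R]_(d, N)) : 'M[R]_(N, d) := F^T *m invmx (F *m F^T).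

Lemma mul_rightinv d N (F : 'M[R]_(d, N)) : row_free F -> F *m rightinv F = 1%:M.
Proof. by move=> rF; rewrite /rightinv mulmxA mulmxV// gram_unit. Qed.

Lemma smooth_rightinv (V : normedModType R) d N (F : V -> 'M[R]_(d, N)) x :
  row_free (F x) -> smooth_at F x -> smooth_at (fun y => rightinv (F y)) x.
Proof.
move=> rF sF; have sT := smooth_tr sF; apply: smooth_mulmx => //.
by apply: smooth_invmx; [exact: gram_unit|exact: smooth_mulmx].
Qed.

Lemma row_free_lower d N (F : 'M[R]_(d, N)) : row_free F ->
  exists2 c : R, 0 < c & forall w : 'rV_d, c * `|w| <= `|w *m F|.
Proof.
move=> rF; pose M := N%:R * `|rightinv F| + 1.
have M0 : 0 < M by rewrite ltr_wpDl// mulr_ge0.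
exists M^-1; first by rewrite invr_gt0.
move=> w; rewrite ler_pdivrMl//.
have {1}-> : w = w *m F *m rightinv F by rewrite -mulmxA mul_rightinv// mulmx1.
rewrite (le_trans (mulmx_norm _ _))// /M mulrDl mul1r mulrA mulrAC.
by rewrite lerDl.
Qed.

End RightInverse.

(** * The ruled submanifold along a curve *)

Section Tube.
Context {R : realType} {N m : nat}.
Variables (I : set R) (g : R -> 'rV[R]_N) (P : R -> 'M[R]_N).

(** All that the construction retains of [M]: the curve and the projections onto the tangent spaces
    along it. Rank one appears in the form in which it is used, every value being a multiple of the
    value at the velocity. *)
Record tube_data : Prop := TubeData {
  td_int : is_interval I;
  td_ne : I° !=set0;
  td_sg : smooth_on I g;
  td_sP : smooth_on I P;
  td_emb : embeds I g;
  td_basis : forall t, I t -> exists2 B : 'M[R]_(m.+1, N), row_free B & P t = projmx B;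
  td_vel : forall t, I t -> derive1 g t *m P t = derive1 g t;
  td_nu : forall t, I t -> derive1 g t *m derive1 P t *m (1%:M - P t) != 0;
  td_rank : forall t (y : 'rV[R]_N), I t -> y *m P t = y -> exists k : R,
    y *m derive1 P t *m (1%:M - P t) = k *: (derive1 g t *m derive1 P t *m (1%:M - P t)) }.

(* [y *m shape_mx t] is the second fundamental form at [g t] of the velocity and of
   the tangential part of [y]; [leafproj t] projects onto its kernel among
   tangent vectors, along the velocity and the normal space. *)
Definition shape_mx t : 'M[R]_N := P t *m derive1 P t *m (1%:M - P t).
Definition leafproj t : 'M[R]_N := kproj (P t) (shape_mx t) (derive1 g t).
Definition leaf t : set 'rV[R]_N := [set x | x *m leafproj t = x].

Hypothesis td : tube_data.

Section Pointwise.
Variables (t : R) (It : I t).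

Lemma tube_PP : P t *m P t = P t.
Proof. by have [B rB PB] := td_basis td It; exact: PP_idem rB PB. Qed.

Lemma tube_shape (y : 'rV[R]_N) : y *m P t = y -> y *m shape_mx t = y *m derive1 P t *m (1%:M - P t).
Proof. by move=> yP; rewrite /shape_mx !mulmxA yP. Qed.

Lemma tube_PA : P t *m shape_mx t = shape_mx t.
Proof. by rewrite /shape_mx !mulmxA tube_PP. Qed.

Lemma tube_nu0 : derive1 g t *m shape_mx t != 0.
Proof. by rewrite tube_shape ?td_vel// td_nu. Qed.

Lemma tube_rank1 (y : 'rV[R]_N) : y *m P t = y ->
  exists k : R, y *m shape_mx t = k *: (derive1 g t *m shape_mx t).
Proof.
move=> yP; have [k E] := td_rank td It yP; exists k.
by rewrite !tube_shape ?td_vel.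
Qed.

Lemma leafP (y : 'rV[R]_N) : leaf t y <-> y *m P t = y /\ y *m shape_mx t = 0.
Proof.
have [B rB PB] := td_basis td It.
exact: (kprojP rB PB (td_vel td It) tube_PA tube_nu0 tube_rank1).
Qed.

Lemma leafproj_leaf (z : 'rV[R]_N) : leaf t (z *m leafproj t).
Proof.
have [B rB PB] := td_basis td It.
by rewrite /leaf /= -mulmxA (kproj_idem rB PB (td_vel td It) tube_PA tube_nu0 tube_rank1).
Qed.

Lemma leafproj_shape : leafproj t *m shape_mx t = 0.
Proof.
have [B rB PB] := td_basis td It.
exact: (kproj_A rB PB tube_PA tube_nu0 tube_rank1).
Qed.

Lemma leaf_spans : exists F : 'M[R]_(m, N), spans F (leaf t).
Proof.
have [B rB PB] := td_basis td It.
exact: (kproj_spans rB PB (td_vel td It) tube_PA tube_nu0 tube_rank1).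
Qed.

Lemma tube_dir : has_dir I t 1.
Proof. exact: interval_dir (td_int td) (td_ne td) It. Qed.

Lemma tube_sg : smooth_at g t. Proof. by have /smooth_onP := td_sg td; exact. Qed.
Lemma tube_sP : smooth_at P t. Proof. by have /smooth_onP := td_sP td; exact. Qed.

Lemma tube_sdg : smooth_at (derive1 g) t.
Proof.
have -> : derive1 g = 'D_1 g by apply/funext => s; rewrite derive1E.
by apply: smooth_derive; exact: tube_sg.
Qed.

Lemma tube_sdP : smooth_at (derive1 P) t.
Proof.
have -> : derive1 P = 'D_1 P by apply/funext => s; rewrite derive1E.
by apply: smooth_derive; exact: tube_sP.
Qed.

Lemma tube_sshape : smooth_at shape_mx t.
Proof.
apply: smooth_mulmx; first exact: smooth_mulmx tube_sP tube_sdP.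
by apply: smoothB; [exact: smooth_cst|exact: tube_sP].
Qed.

Lemma tube_sleafproj : smooth_at leafproj t.
Proof.
have snu := smooth_mulmx tube_sdg tube_sshape.
apply: smoothB; first exact: tube_sP.
apply: smoothZ.
  apply: smoothV; last exact: smooth_dot.
  by apply: contra tube_nu0 => /eqP/dot_eq0 ->.
apply: smooth_mulmx; last exact: tube_sdg.
by apply: smooth_mulmx; [exact: tube_sshape|exact: smooth_tr].
Qed.

(** Differentiate [Y P = Y] and take normal parts. It is stated for matrices so as to cover vector
    fields and frames at once. *)
Lemma nor_derive d (Y : R -> 'M[R]_(d, N)) : smooth_at Y t ->
  (\forall s \near t, I s -> Y s *m P s = Y s) ->
  derive1 Y t *m (1%:M - P t) = Y t *m shape_mx t.
Proof.
move=> sY nY.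
have sYP : smooth_at (fun s => Y s *m P s) t := smooth_mulmx sY tube_sP.
have E : 'D_1 Y t = 'D_1 Y t *m P t + Y t *m 'D_1 P t.
  have e := derive_mulmx (1:R) (smooth_diff sY) (smooth_diff tube_sP).
  apply: etrans e; apply: esym.
  exact: (derive_eq_dir (smooth_diff sYP) (smooth_diff sY) It tube_dir nY).
have E' : 'D_1 Y t *m (1%:M - P t) = Y t *m derive1 P t.
  by rewrite mulmxBr mulmx1 {1}E addrAC subrr add0r derive1E.
rewrite derive1E /shape_mx !mulmxA (nbhs_singleton nY It) -E' -mulmxA; congr (_ *m _).
by rewrite mulmxBr mulmx1 mulmxBl mul1mx tube_PP subrr subr0.
Qed.

End Pointwise.

Lemma leafproj_P t : I t -> leafproj t *m P t = leafproj t.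
Proof.
move=> It; have [B rB PB] := td_basis td It.
exact: (kproj_P _ rB PB (td_vel td It)).
Qed.

(** The first claim is the reason for developability: sections of the leaves are killed by
    [shape_mx], so [nor_derive] makes their derivatives tangent. The second follows by
    differentiating [Y Q = Y], with [Q] the leaf projection and [Q A = 0]: the image of [Y'] under
    [A] depends on the value [Y t] alone. *)
Lemma leaf_derive t d (Y : R -> 'M[R]_(d, N)) : I t -> smooth_at Y t ->
  (\forall s \near t, I s -> Y s *m leafproj s = Y s) ->
  derive1 Y t *m P t = derive1 Y t /\
  derive1 Y t *m shape_mx t = Y t *m derive1 leafproj t *m shape_mx t.
Proof.
move=> It sY nY; have sQ := tube_sleafproj It.
have sYQ : smooth_at (fun s => Y s *m leafproj s) t := smooth_mulmx sY sQ.
have E : 'D_1 Y t = 'D_1 Y t *m leafproj t + Y t *m 'D_1 leafproj t.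
  have e := derive_mulmx (1:R) (smooth_diff sY) (smooth_diff sQ).
  apply: etrans e; apply: esym.
  exact: (derive_eq_dir (smooth_diff sYQ) (smooth_diff sY) It (tube_dir It) nY).
split; last first.
  by rewrite !derive1E {1}E mulmxDl -mulmxA leafproj_shape// mulmx0 add0r.
have Yt := nbhs_singleton nY It.
have YA : Y t *m shape_mx t = 0 by rewrite -Yt -mulmxA leafproj_shape// mulmx0.
suff : derive1 Y t *m (1%:M - P t) = 0.
  by rewrite mulmxBr mulmx1 => /subr0_eq/esym.
rewrite nor_derive//.
apply: filterS nY => s H Is; have Ys := H Is.
by rewrite -Ys -mulmxA leafproj_P.
Qed.

(** A basis of the leaf at [t0], projected to the nearby leaves. *)
Lemma leaf_frame t0 : I t0 -> exists Fr : R -> 'M[R]_(m, N),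
  [/\ smooth_at Fr t0, row_free (Fr t0) & \forall t \near t0, row_free (Fr t) /\
     (I t -> spans (Fr t) (leaf t))].
Proof.
move=> It0; have [F0 [rF0 F0K]] := leaf_spans It0.
have sF : smooth_at (fun t => F0 *m leafproj t) t0.
  by apply: smooth_mulmx; [exact: smooth_cst|exact: tube_sleafproj].
have F0Q : F0 *m leafproj t0 = F0.
  apply/row_matrixP => i; rewrite !rowE mulmxA.
  by apply/(F0K (delta_mx 0 i *m F0)); eexists.
have rF : row_free (F0 *m leafproj t0) by rewrite F0Q.
exists (fun t => F0 *m leafproj t); split => //.
have nr := near_row_free (B := fun t => F0 *m leafproj t) rF sF.
apply: filterS nr => t rt; split=> // It.
have [F1 sF1] := leaf_spans It.
have s0 : spans (F0 *m leafproj t) [set x | exists v, x = v *m (F0 *m leafproj t)].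
  by split.
rewrite (_ : leaf t = [set x | exists v, x = v *m (F0 *m leafproj t)])//.
apply/esym; apply: (spans_eq s0 sF1) => x [v ->].
by rewrite mulmxA; exact: leafproj_leaf.
Qed.

(** In the second clause [t1] is near [t] while [t2] is any parameter; the minimum with [1] lets one
    inequality express injectivity with continuous inverse for close and distant parameters. The
    third clause says that, at [g t1 + x1], moving in time is transversal to the leaf; the same
    vector turns out to generate the values of the second fundamental form there. *)
Definition good t r := [/\ 0 < r,
  forall t1 t2 x1 x2, I t1 -> I t2 -> `|t1 - t| < r -> leaf t1 x1 -> leaf t2 x2 ->
    `|x1| < r -> `|x2| < r ->
    r * Num.min 1 (`|t1 - t2| + `|x1 - x2|) <= `|g t1 + x1 - (g t2 + x2)| &
  forall t1 x1, I t1 -> `|t1 - t| < r -> leaf t1 x1 -> `|x1| < r ->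
    (derive1 g t1 + x1 *m derive1 leafproj t1) *m shape_mx t1 != 0].

Lemma good_le t r r' : 0 < r' -> r' <= r -> good t r -> good t r'.
Proof.
move=> r'0 r'r [r0 H1 H2]; split=> // [t1 t2 x1 x2 I1 I2 tt1 l1 l2 n1 n2|t1 x1 I1 tt1 l1 n1].
  apply: le_trans (H1 t1 t2 x1 x2 I1 I2 _ l1 l2 _ _); [|exact: lt_le_trans r'r..].
  by rewrite ler_wpM2r// le_min ler01 addr_ge0.
by apply: H2 => //; exact: lt_le_trans r'r.
Qed.

Lemma good_shift t t' r : good t r -> `|t' - t| < r / 2 -> good t' (r / 2).
Proof.
move=> G tt'; have [r0 _ _] := G.
have r20 : 0 < r / 2 by rewrite divr_gt0.
have r2r : r / 2 <= r by rewrite ler_pdivrMr// ler_peMr ?ler1n// ltW.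
have K t1 : `|t1 - t'| < r / 2 -> `|t1 - t| < r.
  move=> H; rewrite (splitr r) (le_lt_trans (ler_distD t' _ _))// ltrD//.
have [_ H1 H2] := G; split=> // [t1 t2 x1 x2 I1 I2 tt1 l1 l2 n1 n2|t1 x1 I1 tt1 l1 n1].
  apply: le_trans (H1 t1 t2 x1 x2 I1 I2 (K _ tt1) l1 l2 _ _); [|exact: lt_le_trans r2r..].
  by rewrite ler_wpM2r// le_min ler01 addr_ge0.
by apply: H2 => //; [exact: K|exact: lt_le_trans r2r].
Qed.

End Tube.

(** * Separation of the leaves *)

Section Good.
Context {R : realType} {N m : nat}.
Variables (I : set R) (g : R -> 'rV[R]_N) (P : R -> 'M[R]_N).
Hypothesis td : tube_data (m := m) I g P.

(** Continuity at [g t0] of the inverse of the embedding. *)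
Lemma curve_far t0 r : I t0 -> 0 < r ->
  exists2 eta : R, 0 < eta & forall s, I s -> r <= `|s - t0| -> eta <= `|g s - g t0|.
Proof.
move=> It0 r0; have [gi [gK _ gc]] := td_emb td.
have imp : (g @` I) (g t0) by exists t0.
have gcp : gi @ within (g @` I) (nbhs (g t0)) --> gi (g t0).
  exact: (subspace_continuousP _ _).1 gc (g t0) imp.
rewrite gK// in gcp.
have nr : \forall s \near t0, `|s - t0| < r by apply/near0P; exists r.
have : \forall q \near g t0, (g @` I) q -> `|gi q - t0| < r := gcp _ nr.
move=> /near0P[eta eta0 H]; exists eta => // s Is rs.
rewrite leNgt; apply/negP => sg.
have := H _ sg; rewrite gK// ltNge rs.
by move=> /(_ (ex_intro2 _ _ s Is erefl)).
Qed.

(** In common coordinates [z], the chart [sigma] gives the point [g t + x] and [Phi], the same chart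
    over the zero curve, gives [x]. As [sigma] is an immersion at the origin, strict
    differentiability bounds coordinate differences by distances of points; as [Phi] is Lipschitz,
    these differences bound those of the leaf vectors. *)
Lemma local_bilip t0 : I t0 -> exists k r : R, [/\ 0 < k, 0 < r &
  forall t1 t2 x1 x2, I t1 -> I t2 -> `|t1 - t0| < r -> `|t2 - t0| < r ->
    leaf g P t1 x1 -> leaf g P t2 x2 -> `|x1| < r -> `|x2| < r ->
    k * (`|t1 - t2| + `|x1 - x2|) <= `|g t1 + x1 - (g t2 + x2)|].
Proof.
move=> It0; have [Fr [sF rF nF]] := leaf_frame td It0.
pose sigma := ruled_chart g Fr t0 1 0.
pose Phi := ruled_chart (fun _ => 0) Fr t0 1 0.
have rt0 : rtime t0 1 (0 : 'rV[R]_m.+1) = t0 by rewrite /rtime hd0 mulr0 addr0.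
have sg0 : smooth_at g (rtime t0 1 (0 : 'rV[R]_m.+1)) by rewrite rt0; exact: tube_sg td _ It0.
have sF0 : smooth_at Fr (rtime t0 1 (0 : 'rV[R]_m.+1)) by rewrite rt0.
have ss : smooth_at sigma 0 by exact: smooth_ruled.
have sPhi : smooth_at Phi 0 by apply: smooth_ruled => //; exact: smooth_cst.
have [_ sp0] := nbhs_singleton nF; have {sp0} [_ sp0] := sp0 It0.
have rJ : row_free (jacobian sigma 0).
  apply: inj_row_free => w; rewrite -deriveEjacobian; last exact: smooth_diff.
  rewrite derive_ruled// rt0 mul1r tl0 addr0 mul0mx addr0 => E.
  have lf : leaf g P t0 (tl w *m Fr t0) by apply/sp0; eexists.
  have h0 : hd w = 0.
    have := congr1 (fun z => z *m shape_mx P t0) E.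
    rewrite /= mulmxDl mul0mx ((leafP td It0 _).1 lf).2 addr0 -scalemxAl => /eqP.
    by rewrite scaler_eq0 (negbTE (tube_nu0 td It0)) orbF => /eqP.
  apply: hd_tl_eq0 => //; apply: (row_free_inj rF).
  by move: E; rewrite h0 scale0r add0r /= mul0mx.
have [c c0 Hc] := row_free_lower rJ.
have c20 : 0 < c / 2 by rewrite divr_gt0.
have [r1 r10 H1] := strict_diff ss c20.
have [r2 r20 H2] := strict_diff sPhi ltr01.
have sp := smooth_rightinv rF sF.
have np := cont_dist (smooth_cont sp) ltr01.
have [r3 r30 H3] : exists2 r : R, 0 < r & forall t, `|t - t0| < r ->
   (I t -> spans (Fr t) (leaf g P t)) /\ `|rightinv (Fr t)| <= `|rightinv (Fr t0)| + 1.
  apply/near0P; apply: filterS2 nF np => t [_ Ft] pt; split=> //.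
  have := ler_distD 0 (rightinv (Fr t)) (rightinv (Fr t0)); rewrite subr0 => _.
  have := ler_normD (rightinv (Fr t0)) (rightinv (Fr t) - rightinv (Fr t0)).
  rewrite subrKC => /le_trans; apply; rewrite lerD2l distrC; exact: ltW.
pose L := N%:R * (`|rightinv (Fr t0)| + 1) + 1.
have L0 : 0 < L by rewrite ltr_wpDl// mulr_ge0// addr_ge0.
pose r12 := Num.min r1 r2.
have r120 : 0 < r12 by rewrite lt_min r10.
(* With this choice both parts of [z t x] have norm below [r12 / 2], since
   [|x *m rightinv (Fr t)| <= L * |x|], and [Fr t] is still a frame of the leaf. *)
pose r := Num.min (r12 / (2 * L)) (Num.min (r12 / 2) r3).
have r0 : 0 < r by rewrite !lt_min !divr_gt0 ?mulr_gt0//.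
pose C := 1 + (m.+1%:R * `|jacobian Phi 0| + 1).
have C0 : 0 < C by rewrite addr_gt0// ltr_wpDl// mulr_ge0.
pose z t x := mkz (t - t0) (x *m rightinv (Fr t)).
have zP t x : I t -> `|t - t0| < r -> leaf g P t x -> `|x| < r ->
    [/\ `|z t x - 0| < r12, sigma (z t x) = g t + x & Phi (z t x) = x].
  move=> It tr lx x2.
  have [t2 t3] : `|t - t0| < r12 / 2 /\ `|t - t0| < r3.
    by move: tr; rewrite lt_min => /andP[_]; rewrite lt_min => /andP.
  have [sp1 pb] := H3 t t3.
  have [rFt sp1'] := sp1 It.
  have [u xu] := (sp1' x).1 lx.
  have xE : x *m rightinv (Fr t) *m Fr t = x.
    by rewrite xu -[u *m Fr t *m _]mulmxA mul_rightinv// mulmx1.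
  have tE : rtime t0 1 (z t x) = t by rewrite /rtime /z hd_mkz mul1r addrC subrK.
  split.
  - rewrite subr0; apply: (le_lt_trans (mkz_norm _ _)).
    rewrite (splitr r12) ltrD//; apply: (le_lt_trans (mulmx_norm _ _)).
    apply: (@le_lt_trans _ _ (L * `|x|)).
      rewrite mulrCA mulrC ler_wpM2r// /L.
      by rewrite (@le_trans _ _ (N%:R * (`|rightinv (Fr t0)| + 1))) ?lerDl// ler_wpM2l.
    have rL : r <= r12 / (2 * L) by rewrite ge_min lexx.
    have := lt_le_trans x2 rL; rewrite ltr_pdivlMr ?mulr_gt0// => H.
    have E (p q : R) : p * q * 2 = q * (2 * p) by ring.
    by rewrite ltr_pdivlMr// E.
  - by rewrite /sigma /ruled_chart tE add0r /z tl_mkz xE.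
  - by rewrite /Phi /ruled_chart tE !add0r /z tl_mkz xE.
exists (c / 2 / C), r; split=> //; first by rewrite divr_gt0.
move=> t1 t2 x1 x2 I1 I2 tt1 tt2 l1 l2 n1 n2.
have [z1 S1 P1] := zP t1 x1 I1 tt1 l1 n1.
have [z2 S2 P2] := zP t2 x2 I2 tt2 l2 n2.
rewrite -S1 -S2.
have le1 y : `|y| < r12 -> `|y| < r1 by move=> /lt_le_trans; apply; rewrite ge_min lexx.
have le2 y : `|y| < r12 -> `|y| < r2 by move=> /lt_le_trans; apply; rewrite ge_min lexx orbT.
have A1 := H1 _ _ (le1 _ _ z1) (le1 _ _ z2).
have A2 := H2 _ _ (le2 _ _ z1) (le2 _ _ z2).
rewrite P1 P2 mul1r in A2.
set Z := z t1 x1 - z t2 x2 in A1 A2.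
have B1 : c / 2 * `|Z| <= `|sigma (z t1 x1) - sigma (z t2 x2)|.
  have := ler_distD (sigma (z t1 x1) - sigma (z t2 x2)) 0 (Z *m jacobian sigma 0).
  rewrite !sub0r !normrN => D; have := Hc Z; move: A1 D.
  move: (`|_ - Z *m _|) (`|Z *m _|) (`|sigma _ - _|) (`|Z|) => p q s v.
  by move=> *; lra.
have B2 : `|x1 - x2| <= (m.+1%:R * `|jacobian Phi 0| + 1) * `|Z|.
  have := ler_distD (Z *m jacobian Phi 0) 0 (x1 - x2).
  rewrite !sub0r !normrN [`|Z *m _ - _|]distrC => D.
  have := mulmx_norm Z (jacobian Phi 0); move: A2 D.
  rewrite [`|Z| * _]mulrC mulrA mulrDl mul1r.
  move: (`|_ - Z *m _|) (`|Z *m _|) (`|x1 - _|) (`|Z|) (_ * `|jacobian _ _|) => p q s v w.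
  by move=> *; lra.
have B3 : `|t1 - t2| <= `|Z|.
  have -> : t1 - t2 = hd Z by rewrite /Z hdB /z !hd_mkz; ring.
  exact: hd_norm.
rewrite mulrAC ler_pdivrMr//; apply: (@le_trans _ _ (c / 2 * (C * `|Z|))).
  rewrite ler_wpM2l ?(ltW c20)// /C mulrDl mul1r; exact: lerD.
by rewrite mulrCA mulrC ler_wpM2r// ltW.
Qed.

(** For [t2] near [t0] the second clause is [local_bilip]. Otherwise [g t2] is at least [eta] away
    from [g t0], while [x1], [x2] and [g t1 - g t0] are each below [eta / 8], leaving a distance of
    more than [5 * eta / 8]. The third clause holds at [x1 = 0] and persists for small [x1]. *)
Lemma good_exists t0 : I t0 -> exists r, good I g P t0 r.
Proof.
move=> It0; have [k [r1 [k0 r10 H1]]] := local_bilip It0.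
have [eta eta0 H2] := curve_far It0 r10.
have sg0 := tube_sg td It0.
have e80 : 0 < eta / 8 by rewrite divr_gt0.
have n1 := cont_dist (smooth_cont sg0) e80.
have sA := tube_sshape td It0.
have sQ := tube_sleafproj td It0.
have sQ' : smooth_at (derive1 (leafproj g P)) t0.
  have -> : derive1 (leafproj g P) = 'D_1 (leafproj g P) by apply/funext => s; rewrite derive1E.
  exact: smooth_derive.
pose M1 y := derive1 g y *m shape_mx P y.
pose M2 y := derive1 (leafproj g P) y *m shape_mx P y.
have sM1 : smooth_at M1 t0 := smooth_mulmx (tube_sdg td It0) sA.
have sM2 : smooth_at M2 t0 := smooth_mulmx sQ' sA.
have n00 : 0 < `|M1 t0| by rewrite normr_gt0; exact: (tube_nu0 td It0).
have n02 : 0 < `|M1 t0| / 2 by rewrite divr_gt0.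
have n2 := cont_dist (smooth_cont sM1) n02.
have n3 := cont_dist (smooth_cont sM2) ltr01.
pose C := N%:R * (`|M2 t0| + 1) + 1.
have C0 : 0 < C by rewrite ltr_wpDl// mulr_ge0// addr_ge0.
have nn : \forall t \near t0, [/\ `|g t0 - g t| < eta / 8,
    `|M1 t0 - M1 t| < `|M1 t0| / 2 & `|M2 t0 - M2 t| < 1].
  near=> t; split; [exact: (near n1 t)|exact: (near n2 t)|exact: (near n3 t)].
have [r2 r20 H3] := (near0P _ _).1 nn.
have [r [r0 rr1 rr2 rk [re rC]]] : exists r : R, [/\ 0 < r, r <= r1, r <= r2, r <= k &
    r <= eta / 8 /\ r <= `|M1 t0| / 2 / C].
  pose r := Num.min r1 (Num.min r2 (Num.min k (Num.min (eta / 8) (`|M1 t0| / 2 / C)))).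
  have E : r <= r by []; move: E; rewrite {2}/r !le_min => /and5P[a b c d e].
  by exists r; split=> //; rewrite !lt_min r10 r20 k0 e80 divr_gt0.
exists r; split=> //.
- move=> t1 t2 x1 x2 I1 I2 tt1 l1 l2 n1' n2'.
  have [tt2|tt2] := ltP `|t2 - t0| r1.
    apply: le_trans (H1 _ _ _ _ I1 I2 (lt_le_trans tt1 rr1) tt2 l1 l2 (lt_le_trans n1' rr1) (lt_le_trans n2' rr1)).
    by rewrite ler_pM// ?(ltW r0)// ?le_min ?ler01 ?addr_ge0// ge_min lexx orbT.
  have [g1 _ _] := H3 t1 (lt_le_trans tt1 rr2).
  have g2 := H2 _ I2 tt2.
  apply: (@le_trans _ _ r); first by rewrite ler_piMr ?(ltW r0)// ge_min lexx.
  have T1 := ler_distD (g t1 - x2) (g t2) (g t0 - x1 - x2).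
  have E : g t2 - g t0 = (g t1 - g t0) + (x1 - x2) - (g t1 + x1 - (g t2 + x2)).
    by apply/rowP => i; rewrite !mxE; ring.
  have := ler_normB (g t1 - g t0 + (x1 - x2)) (g t1 + x1 - (g t2 + x2)); rewrite -E => D1.
  have D2 := ler_normD (g t1 - g t0) (x1 - x2).
  have D3 := ler_normB x1 x2.
  rewrite distrC in g1.
  move: D1 D2 D3 g1 g2 re n1' n2'.
  move: (`|g t2 - g t0|) (`|g t1 - g t0 + _|) (`|g t1 + x1 - _|) (`|g t1 - g t0|) (`|x1 - x2|) (`|x1|) (`|x2|).
  by move=> * ; lra.
- move=> t1 x1 I1 tt1 l1 n1'.
  have [_ m1 m2] := H3 t1 (lt_le_trans tt1 rr2).
  rewrite mulmxDl -mulmxA -/(M1 t1) -/(M2 t1) -normr_gt0.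
  have D0 : M1 t0 = (M1 t0 - M1 t1) + (M1 t1 + x1 *m M2 t1) - x1 *m M2 t1.
    by rewrite addrA addrK subrK.
  have := ler_normB (M1 t0 - M1 t1 + (M1 t1 + x1 *m M2 t1)) (x1 *m M2 t1).
  rewrite -D0 => D1.
  have D2 := ler_normD (M1 t0 - M1 t1) (M1 t1 + x1 *m M2 t1).
  have D3 : `|x1 *m M2 t1| < `|M1 t0| / 2.
    apply: le_lt_trans (mulmx_norm _ _) _.
    have M2b : `|M2 t1| <= `|M2 t0| + 1.
      have := ler_normD (M2 t0) (M2 t1 - M2 t0); rewrite subrKC => /le_trans; apply.
      by rewrite lerD2l distrC ltW.
    apply: (@le_lt_trans _ _ (C * `|x1|)).
      rewrite mulrCA mulrC ler_wpM2r// /C.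
      by rewrite (@le_trans _ _ (N%:R * (`|M2 t0| + 1))) ?lerDl// ler_wpM2l.
    by rewrite mulrC -ltr_pdivlMr// (lt_le_trans n1').
  move: D1 D2 D3 m1.
  move: (`|_ - M1 t1 + _|) (`|_ - M1 t1|) (`|_ + _ *m _|) (`|_ *m _|) (`|M1 t0|).
  by move=> *; lra.
Unshelve. all: by end_near. Qed.

Lemma good_compact : compact I -> exists2 r, 0 < r & forall t, I t -> good I g P t r.
Proof.
move=> cI; have nc := (compact_near_coveringP I).1 cI.
have : \forall r \near (0 : R)^'+, I `<=` (fun t => I t -> good I g P t r).
  apply: nc => t It; have [r G] := good_exists It.
  have [r0 _ _] := G; have r20 : 0 < r / 2 by rewrite divr_gt0.
  exists ([set t' | `|t' - t| < r / 2], [set s | 0 < s < r / 2]) => /=.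
    have n : \forall t' \near t, `|t' - t| < r / 2 by apply/near0P; exists (r / 2).
    split; first exact: n.
    by apply: filterS2 (nbhs_right_gt 0) (nbhs_right_lt r20) => s s0 sr; apply/andP.
  move=> [t' s] [/= tt' /andP[s0 sr]] It'.
  exact: (good_le s0 (ltW sr) (good_shift G tt')).
move=> H; have [r [r0 Hr]] : exists r : R, 0 < r /\ I `<=` (fun t => I t -> good I g P t r).
  by apply: (@filter_ex _ ((0:R)^'+)); apply: filterI H; exact: nbhs_right_gt.
by exists r => // t It; exact: Hr.
Qed.

End Good.

(** * The tube of leaf pieces is a submanifold with boundary *)

Section TubeSubmanifold.
Context {R : realType} {N m : nat}.
Variables (I : set R) (g : R -> 'rV[R]_N) (P : R -> 'M[R]_N).
Hypothesis td : tube_data (m := m) I g P.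
Variable Om : R -> set 'rV[R]_N.
Local Notation leaf := (leaf g P).

Hypothesis Om_open : forall t x, I t -> leaf t x -> Om t x ->
  exists2 d : R, 0 < d & forall s y, I s -> leaf s y ->
    `|s - t| < d -> `|y - x| < d -> Om s y.
Hypothesis Om_good : forall t x, I t -> leaf t x -> Om t x ->
  exists2 r, good I g P t r & `|x| < r.

(** [Om t] is the part kept of the leaf through [g t]. It is left general because the existence
    proof uses radii that vary along the curve, whereas [ruled_image] cuts out boxes in the
    coordinates given by the fields [X_j]. *)
Definition tube : set 'rV[R]_N :=
  [set p | exists t x, [/\ I t, leaf t x, Om t x & p = g t + x]].

Definition tot (c : R * 'rV[R]_N) := [/\ I c.1, leaf c.1 c.2 & Om c.1 c.2].

Lemma leafD t x y : leaf t x -> leaf t y -> leaf t (x + y).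
Proof. by rewrite /leaf /= => lx ly; rewrite mulmxDl lx ly. Qed.

Lemma leaf0 t : leaf t 0.
Proof. by rewrite /leaf /= mul0mx. Qed.

(** [good] is applied at whichever of the two points has the larger radius, both leaf vectors being
    smaller than it. The resulting constant can be taken to be the radius at [(t, x)], whatever the
    other point is. *)
Lemma tube_inj t x : tot (t, x) -> exists2 r : R, 0 < r & forall s y, tot (s, y) ->
  r * Num.min 1 (`|s - t| + `|y - x|) <= `|g s + y - (g t + x)|.
Proof.
move=> [It lx Otx]; have [r G xr] := Om_good It lx Otx; have [r0 H1 _] := G.
exists r => // s y [Is ly Osy]; have [r' G' yr'] := Om_good Is ly Osy.
have [r'0 H1' _] := G'.
have [rr'|r'r] := leP r r'.
  apply: le_trans (H1' s t y x Is It _ ly lx yr' (lt_le_trans xr rr')).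
    by rewrite ler_wpM2r// le_min ler01 addr_ge0.
  by rewrite subrr normr0.
rewrite [`|s - t|]distrC [`|y - x|]distrC [leRHS]distrC.
by apply: H1 => //; [rewrite subrr normr0|exact: lt_trans r'r].
Qed.

Lemma tube_dec t x s y : tot (t, x) -> tot (s, y) -> g s + y = g t + x -> (s, y) = (t, x).
Proof.
move=> T1 T2 E; have [r r0 /(_ s y T2)] := tube_inj T1.
rewrite E subrr normr0 pmulr_rle0// => H.
have : `|s - t| + `|y - x| <= 0.
  by move: H; rewrite ge_min => /orP[|//]; rewrite ler10.
have a0 := normr_ge0 (s - t); have b0 := normr_ge0 (y - x).
move=> ab; have /eqP : `|s - t| = 0 by apply/eqP; rewrite eq_le a0 andbT; lra.
have /eqP : `|y - x| = 0 by apply/eqP; rewrite eq_le b0 andbT; lra.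
by rewrite !normr_eq0 !subr_eq0 => /eqP -> /eqP ->.
Qed.

Section Chart.
Variables (t1 : R) (x1 : 'rV[R]_N).
Hypothesis T1 : tot (t1, x1).
Variables (Fr : R -> 'M[R]_(m, N)) (u0 : 'rV[R]_m) (tau : R) (b : bool).
Hypothesis sF : smooth_at Fr t1.
Hypothesis rF : row_free (Fr t1).
Hypothesis nF : \forall t \near t1, row_free (Fr t) /\ (I t -> spans (Fr t) (leaf t)).
Hypothesis xu : x1 = u0 *m Fr t1.
Hypothesis tt : tau * tau = 1.
Hypothesis germ1 : forall s, I s -> b -> 0 <= tau * (s - t1).
Hypothesis germ2 : \forall t \near t1, (b -> 0 <= tau * (t - t1)) -> I t.

Let phi := ruled_chart g Fr t1 tau u0.
Let time := rtime (m := m) t1 tau.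
Let It1 : I t1. Proof. by case: T1. Qed.

Lemma time0 : time 0 = t1. Proof. by rewrite /time /rtime hd0 mulr0 addr0. Qed.

Lemma chart_sphi0 : smooth_at phi 0.
Proof.
apply: smooth_ruled; rewrite -/time time0//; exact: (tube_sg td It1).
Qed.

Lemma chart_derive0 w : 'D_w phi 0 =
  (tau * hd w) *: (derive1 g t1 + u0 *m derive1 Fr t1) + tl w *m Fr t1.
Proof.
rewrite derive_ruled -?/time ?time0 ?tl0 ?addr0//; exact: (tube_sg td It1).
Qed.

Lemma frame_leafproj : \forall s \near t1, I s -> Fr s *m leafproj g P s = Fr s.
Proof.
apply: filterS nF => s [_ H] Is; have [_ sp] := H Is.
apply/row_matrixP => i; rewrite !rowE mulmxA.
by apply/(sp (delta_mx 0 i *m Fr s)); eexists.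
Qed.

(** The normal part of the second time derivative of the chart at [0], see [chart_derive2]. By
    [leaf_derive] it is the vector in the third clause of [good], hence nonzero; this gives both the
    immersion and the exact rank. *)
Definition kappa : 'rV[R]_N := (derive1 g t1 + u0 *m derive1 Fr t1) *m shape_mx P t1.

Lemma kappa_neq0 : kappa != 0.
Proof.
have [_ lx Ox] := T1; have [r [r0 _ H] xr] := Om_good It1 lx Ox.
have := H t1 x1 It1; rewrite subrr normr0 => /(_ r0 lx xr).
rewrite /kappa !mulmxDl -[u0 *m _ *m _]mulmxA.
have [_ E] := leaf_derive td It1 sF frame_leafproj.
rewrite E xu; by rewrite -!mulmxA.
Qed.

Lemma chart_imm w : 'D_w phi 0 = 0 -> w = 0.
Proof.
rewrite chart_derive0 => E.
have lf : leaf t1 (tl w *m Fr t1).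
  by have [_ /(_ It1)[_ sp]] := nbhs_singleton nF; apply/sp; eexists.
have h0 : hd w = 0.
  have := congr1 (fun z => z *m shape_mx P t1) E.
  rewrite /= mulmxDl mul0mx ((leafP td It1 _).1 lf).2 addr0 -scalemxAl -/kappa => /eqP.
  rewrite scaler_eq0 (negbTE kappa_neq0) orbF mulf_eq0 => /orP[/eqP t0|/eqP//].
  by have := tt; rewrite t0 mul0r => /eqP; rewrite eq_sym oner_eq0.
apply: hd_tl_eq0 => //; apply: (row_free_inj rF).
by move: E; rewrite h0 mulr0 scale0r add0r /= mul0mx.
Qed.

Lemma chart_row_free0 : row_free (jacobian phi 0).
Proof.
apply: inj_row_free => w; rewrite -deriveEjacobian; first exact: chart_imm.
exact: smooth_diff chart_sphi0.
Qed.

Let coordx z := (u0 + tl z) *m Fr (time z).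

Lemma chart_near : \forall z \near (0 : 'rV[R]_m.+1),
  [/\ smooth_at phi z, smooth_at Fr (time z), row_free (jacobian phi z), row_free (Fr (time z)) &
   model b z -> tot (time z, coordx z) /\ spans (Fr (time z)) (leaf (time z))].
Proof.
have st : smooth_at time 0 by exact: smooth_rtime.
have n1 := smooth_near chart_sphi0.
have n2 : \forall z \near (0 : 'rV[R]_m.+1), smooth_at Fr (time z).
  by apply: (smooth_cont_near st); rewrite time0; exact: smooth_near.
have n3 := near_row_free chart_row_free0 (smooth_jacobian chart_sphi0).
have n4 : \forall z \near (0 : 'rV[R]_m.+1), row_free (Fr (time z)) /\ (I (time z) -> spans (Fr (time z)) (leaf (time z))).
  by apply: (smooth_cont_near (P := fun t => row_free (Fr t) /\ (I t -> spans (Fr t) (leaf t))) st); rewrite time0.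
have n5 : \forall z \near (0 : 'rV[R]_m.+1), (b -> 0 <= tau * (time z - t1)) -> I (time z).
  by apply: (smooth_cont_near (P := fun t => (b -> 0 <= tau * (t - t1)) -> I t) st); rewrite time0.
have [_ lx Ox] := T1; have [d d0 Hd] := Om_open It1 lx Ox.
have n6 : \forall z \near (0 : 'rV[R]_m.+1), `|time z - t1| < d.
  by have := cont_dist (smooth_cont st) d0; apply: filterS => z; rewrite time0 distrC.
have scx : smooth_at coordx 0.
  apply: smooth_mulmx; last by apply: smooth_comp_R => //; rewrite time0.
  by apply: smoothD; [exact: smooth_cst|exact: smooth_tl].
have n7 : \forall z \near (0 : 'rV[R]_m.+1), `|coordx z - x1| < d.
  have := cont_dist (smooth_cont scx) d0; apply: filterS => z.
  by rewrite {1}/coordx time0 tl0 addr0 -xu distrC.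
near=> z.
have z1 : smooth_at phi z by exact: (near n1 z).
have z2 : smooth_at Fr (time z) by exact: (near n2 z).
have z3 : row_free (jacobian phi z) by exact: (near n3 z).
have [z4 z4'] : row_free (Fr (time z)) /\ (I (time z) -> spans (Fr (time z)) (leaf (time z))).
  by exact: (near n4 z).
have z5 : (b -> 0 <= tau * (time z - t1)) -> I (time z) by exact: (near n5 z).
have z6 : `|time z - t1| < d by exact: (near n6 z).
have z7 : `|coordx z - x1| < d by exact: (near n7 z).
split=> // mz.
have Iz : I (time z).
  apply: z5 => hb; rewrite /time /rtime addrAC subrr add0r mulrA tt mul1r.
  by move: mz; rewrite hb => /(_ ord0 erefl).
have sp := z4' Iz; split=> //; split=> //=.
  by apply/sp.2; eexists.
by apply: Hd => //; apply/sp.2; eexists.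
Unshelve. all: by end_near. Qed.

Let chi (c : R * 'rV[R]_N) : 'rV[R]_m.+1 :=
  mkz (tau * (c.1 - t1)) (c.2 *m rightinv (Fr c.1) - u0).

Lemma time_chi s y : time (chi (s, y)) = s.
Proof. by rewrite /time /rtime hd_mkz mulrA tt mul1r addrC subrK. Qed.

Lemma model_chi s y : I s -> model b (chi (s, y)).
Proof.
move=> Is; have := germ1 Is; case: b => //= H i i0.
have -> : i = ord0 by apply: val_inj.
by rewrite -/(hd _) hd_mkz; exact: H.
Qed.

Lemma chi_coord z : row_free (Fr (time z)) -> chi (time z, coordx z) = z.
Proof.
move=> rz; rewrite -[RHS]mkzK /chi /=; congr mkz.
  by rewrite /time /rtime addrAC subrr add0r mulrA tt mul1r.
by rewrite /coordx -mulmxA mul_rightinv// mulmx1 addrAC subrr add0r.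
Qed.

(** [tube_inj] controls the pair [(s', y')] by the distance of points. The three terms bounded by
    [e / 3] are the change of time, the change of the leaf vector, and the change of the coordinates
    of [y] as the frame varies. *)
Lemma chi_cont s y (e : R) : smooth_at Fr s -> row_free (Fr s) -> tot (s, y) -> 0 < e ->
  exists2 d : R, 0 < d & forall s' y', tot (s', y') ->
    `|g s' + y' - (g s + y)| < d -> `|chi (s', y') - chi (s, y)| < e.
Proof.
move=> sFs rFs T e0; have [r r0 H] := tube_inj T.
have spv := smooth_rightinv rFs sFs.
have e30 : 0 < e / 3 by rewrite divr_gt0.
pose A := N%:R * `|y| + 1.
have A0 : 0 < A by rewrite ltr_wpDl// mulr_ge0.
have eA : 0 < e / 3 / A by rewrite divr_gt0.
have n1 := cont_dist (smooth_cont spv) eA.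
have n2 := cont_dist (smooth_cont spv) ltr01.
have [d1 d10 H1] := (near0P _ _).1 (filterI n1 n2).
pose B := N%:R * (`|rightinv (Fr s)| + 1) + 1.
have B0 : 0 < B by rewrite ltr_wpDl// mulr_ge0// addr_ge0.
have [d2 [d20 a1 a2 a3]] : exists d2 : R, [/\ 0 < d2, d2 <= d1, d2 <= e / 3 & d2 <= e / 3 / B].
  pose d2 := Num.min d1 (Num.min (e / 3) (e / 3 / B)).
  have E : d2 <= d2 by []; move: E; rewrite {2}/d2 !le_min => /and3P[a c d].
  by exists d2; split=> //; rewrite !lt_min d10 e30 divr_gt0.
exists (r * Num.min 1 d2); first by rewrite mulr_gt0// lt_min ltr01.
move=> s' y' T'; have := H s' y' T' => H2 H3.
have := le_lt_trans H2 H3; rewrite ltr_pM2l// => H4.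
have H5 : `|s' - s| + `|y' - y| < d2.
  move: H4; rewrite lt_min !gt_min ltxx /= => /andP[h1 /orP[h2|//]].
  exact: lt_trans h1 h2.
have hs : `|s' - s| < d2 by apply: le_lt_trans H5; rewrite lerDl.
have hy : `|y' - y| < d2 by apply: le_lt_trans H5; rewrite lerDr.
have [p1 p2] := H1 s' (lt_le_trans hs a1).
have -> : chi (s', y') - chi (s, y) =
    mkz (tau * (s' - s)) ((y' - y) *m rightinv (Fr s') + y *m (rightinv (Fr s') - rightinv (Fr s))).
  rewrite -[LHS]mkzK hdB tlB /chi !hd_mkz !tl_mkz /=; congr mkz; first by ring.
  by rewrite mulmxBl mulmxBr opprB !subrKA.
apply: le_lt_trans (mkz_norm _ _) _.
have tau1 : `|tau| = 1.
  apply/eqP; rewrite -(@eqrXn2 _ 2)// expr1n -normrX expr2 tt normr1//.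
rewrite normrM tau1 mul1r.
have b1 := lt_le_trans hs a2.
have b2 : `|(y' - y) *m rightinv (Fr s')| < e / 3.
  apply: le_lt_trans (mulmx_norm _ _) _; apply: (@le_lt_trans _ _ (B * `|y' - y|)).
    rewrite mulrCA mulrC ler_wpM2r// /B.
    apply: (@le_trans _ _ (N%:R * (`|rightinv (Fr s)| + 1))); last by rewrite lerDl.
    rewrite ler_wpM2l//.
    have := ler_normD (rightinv (Fr s)) (rightinv (Fr s') - rightinv (Fr s)).
    by rewrite subrKC => /le_trans; apply; rewrite lerD2l distrC ltW.
  by rewrite mulrC -ltr_pdivlMr// (lt_le_trans hy).
have b3 : `|y *m (rightinv (Fr s') - rightinv (Fr s))| <= e / 3.
  apply: le_trans (mulmx_norm _ _) _; rewrite distrC mulrA.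
  apply: (@le_trans _ _ (A * (e / 3 / A))); last by rewrite mulrCA divff ?mulr1// gt_eqF.
  by rewrite ler_pM ?mulr_ge0// ?lerDl// ltW.
have := ler_normD ((y' - y) *m rightinv (Fr s')) (y *m (rightinv (Fr s') - rightinv (Fr s))).
move: b1 b2 b3; move: (`|s' - s|) (`|_ *m rightinv _|) (`|y *m _|) (`|_ *m _ + _|) => p q v w.
by move=> *; lra.
Qed.

(** On a small ball the inverse of the chart decomposes a point of the tube as [g s + y], uniquely
    by [tube_dec], and takes the coordinates [chi (s, y)]. *)
Lemma tube_param : exists U, param_at tube (g t1 + x1) b U phi 0.
Proof.
have /near0P[rho rho0 Hrho] := chart_near.
pose U := ball (0 : 'rV[R]_m.+1) rho.
have UP z : U z <-> `|z| < rho by rewrite /U -ball_normE /= sub0r normrN.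
have UH z : U z -> [/\ smooth_at phi z, smooth_at Fr (time z), row_free (jacobian phi z), row_free (Fr (time z)) &
   model b z -> tot (time z, coordx z) /\ spans (Fr (time z)) (leaf (time z))].
  by move=> /UP zr; apply: Hrho; rewrite subr0.
have oU : open U by exact: ball_open.
have phiE z : phi z = g (time z) + coordx z by [].
have cont z (e : R) : U z -> model b z -> 0 < e -> exists2 d : R, 0 < d &
    forall s' y', tot (s', y') -> `|g s' + y' - phi z| < d -> `|chi (s', y') - z| < e.
  move=> Uz mz e0; have [_ s2 _ s4 /(_ mz)[T _]] := UH z Uz.
  have [d d0 H] := chi_cont s2 s4 T e0.
  by exists d => // s' y' T' H'; rewrite -[X in _ - X](chi_coord s4); exact: H.
have back s y : tot (s, y) -> U (chi (s, y)) -> phi (chi (s, y)) = g s + y.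
  move=> T Uc; have [Is ly _] := T.
  have [_ _ _ s4 /(_ (model_chi y Is))[_ sp]] := UH _ Uc.
  rewrite phiE /coordx time_chi in sp s4 *; congr (_ + _).
  rewrite /chi tl_mkz /= subrKC.
  have [v yv] := (sp.2 y).1 ly.
  by rewrite yv -[v *m Fr s *m _]mulmxA mul_rightinv// mulmx1.
have inS z : U z -> model b z -> tube (phi z).
  move=> Uz mz; have [_ _ _ _ /(_ mz)[[? ? ?] _]] := UH z Uz.
  by exists (time z), (coordx z).
exists U; split; last 2 first.
- by split; [apply/UP; rewrite normr0|case: (b) => //= i _; rewrite mxE].
- by rewrite phiE time0 /coordx time0 tl0 addr0 -xu.
split=> //.
- by apply/smooth_onP => z /UH[].
- move=> z Uz v; have [s1 _ s3 _ _] := UH z Uz.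
  rewrite -deriveE; last exact: smooth_diff.
  rewrite deriveEjacobian; last exact: smooth_diff.
  by move=> E; apply: (row_free_inj s3); rewrite E /= mul0mx.
- pose dec p : R * 'rV[R]_N := xget (0, 0) [set c | tot c /\ p = g c.1 + c.2].
  have decE s y : tot (s, y) -> dec (g s + y) = (s, y).
    move=> T; apply: xget_subset1; first by split.
    suff K c : tot c /\ g s + y = g c.1 + c.2 -> c = (s, y) by move=> c c' /K -> /K ->.
    by case: c => s' y' [T' E]; apply: tube_dec => //; rewrite E.
  exists (fun p => chi (dec p)); split.
  + move=> z [Uz mz]; have [_ _ _ s4 /(_ mz)[T _]] := UH z Uz.
    by rewrite phiE decE// chi_coord.
  + apply: continuous_in_subspaceT => z; rewrite inE => -[/UH[s1 _ _ _ _] _].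
    exact: smooth_cont.
  + apply/subspace_continuousP => _ [z [Uz mz] <-].
    have [_ _ _ s4 /(_ mz)[T _]] := UH z Uz.
    have E0 : chi (dec (phi z)) = z by rewrite phiE decE// chi_coord.
    apply/cvgrPdist_lt => e e0; have [d d0 H] := cont z e Uz mz e0.
    have n : \forall q \near phi z, `|q - phi z| < d by apply/near0P; exists d.
    apply: filterS n => q qd [z' [Uz' mz'] E].
    change (`|chi (dec (phi z)) - chi (dec q)| < e); rewrite E0.
    have [_ _ _ _ /(_ mz')[T' _]] := UH z' Uz'.
    rewrite -E phiE decE// distrC; apply: H => //.
    by rewrite -phiE E.
(* Openness of the image in the tube: the open set is a union of balls around the points of the
   image, each so small that [chi] of a tube point in it stays in [U]. *)
- have /choice[d dP] (z : 'rV[R]_m.+1) : exists d : R, U z -> model b z -> 0 < d /\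
      forall s' y', tot (s', y') -> `|g s' + y' - phi z| < d -> U (chi (s', y')).
    have [[Uz mz]|nU] := pselect (U z /\ model b z); last by exists 0 => ? ?; case: nU.
    have rz : 0 < rho - `|z| by rewrite subr_gt0; apply/UP.
    have [d d0 H] := cont z _ Uz mz rz; exists d => _ _; split=> // s' y' T' H'.
    apply/UP; have := H s' y' T' H'.
    have := ler_normD (chi (s', y') - z) z; rewrite subrK.
    by move=> *; lra.
  exists (\bigcup_(z in U `&` model b) ball (phi z) (d z)); split.
    by apply: bigcup_open => z _; exact: ball_open.
  apply/seteqP; split=> p.
    move=> [[s [y [Is ly Oy ->]]] [z [Uz mz]]].
    have T : tot (s, y) by [].
    rewrite -ball_normE /= distrC => H.
    have [_ Hd] := dP z Uz mz; have Uc := Hd s y T H.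
    exists (chi (s, y)); last exact: back.
    by split=> //; exact: model_chi.
  move=> [z [Uz mz] <-]; split; first exact: inS.
  exists z => //; have [dz _] := dP z Uz mz; exact: ballxx.
Qed.

(** The chart is affine in the leaf coordinates, and its mixed derivatives are multiples of
    combinations of the rows of [derive1 Fr t1], which are tangent. What remains is the second time
    derivative of the point with fixed leaf coordinates; its velocity [Y] is a tangent field, so
    [nor_derive] yields [Y t1 *m shape_mx P t1]. *)
Lemma chart_derive2 v w : 'D_v ('D_w phi) 0 *m (1%:M - P t1) = (hd v * hd w) *: kappa.
Proof.
have sg1 := tube_sg td It1; have sdg1 := tube_sdg td It1.
have sdF : smooth_at (derive1 Fr) t1.
  have -> : derive1 Fr = 'D_1 Fr by apply/funext => s; rewrite derive1E.
  exact: smooth_derive.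
have st : smooth_at time 0 by exact: smooth_rtime.
have n1 : \forall z \near (0 : 'rV[R]_m.+1), smooth_at g (time z).
  by apply: (smooth_cont_near st); rewrite time0; exact: smooth_near.
have n2 : \forall z \near (0 : 'rV[R]_m.+1), smooth_at Fr (time z).
  by apply: (smooth_cont_near st); rewrite time0; exact: smooth_near.
pose psi := ruled_chart (derive1 g) (derive1 Fr) t1 tau u0.
have E : \forall z \near (0 : 'rV[R]_m.+1),
    (tau * hd w) *: psi z + tl w *m Fr (time z) = 'D_w phi z.
  by apply: filterS2 n1 n2 => z z1 z2; rewrite /phi derive_ruled.
have spsi : smooth_at psi 0 by apply: smooth_ruled; rewrite -/time time0.
have sFt : smooth_at (fun z => Fr (time z)) 0 by apply: smooth_comp_R => //; rewrite time0.
have sF' : smooth_at Fr (time 0) by rewrite time0.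
have dpsi : derivable psi 0 v := smooth_derivable spsi.
have d1 : derivable ((tau * hd w) *: psi) 0 v := derivableZ dpsi.
have d2 : derivable (fun z => tl w *m Fr (time z)) 0 v.
  by apply: smooth_derivable; apply: smooth_mulmx => //; exact: smooth_cst.
have -> : 'D_v ('D_w phi) 0 = (tau * hd w) *: ((tau * hd v) *: (derive1 (derive1 g) t1 + u0 *m derive1 (derive1 Fr) t1)
     + tl v *m derive1 Fr t1) + tl w *m ((tau * hd v) *: derive1 Fr t1).
  rewrite -(near_eq_derive _ E); apply: (etrans (deriveD d1 d2)).
  rewrite (deriveZ _ dpsi) (derive_mulmxl (tl w) v (smooth_diff sFt)).
  rewrite (derive_comp_rtime v sF') -/time time0.
  by rewrite /psi derive_ruled -/time time0 ?tl0 ?addr0.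
have nFP : \forall s \near t1, I s -> Fr s *m P s = Fr s.
  apply: filterS frame_leafproj => s H Is; have Fs := H Is.
  by rewrite -Fs -mulmxA (leafproj_P td Is).
have [FP _] := leaf_derive td It1 sF frame_leafproj.
have F0 : derive1 Fr t1 *m (1%:M - P t1) = 0 by rewrite mulmxBr mulmx1 FP subrr.
pose Y s := derive1 g s + u0 *m derive1 Fr s.
have suF : smooth_at (fun s => u0 *m derive1 Fr s) t1.
  by apply: smooth_mulmx => //; exact: smooth_cst.
have sY : smooth_at Y t1 by exact: smoothD.
have nY : \forall s \near t1, I s -> Y s *m P s = Y s.
  have nsF := smooth_near sF; have nfr := near_join frame_leafproj.
  apply: filterS2 nsF nfr => s sFs frs Is.
  have [FPs _] := leaf_derive td Is sFs frs.
  by rewrite /Y mulmxDl (td_vel td Is) -mulmxA FPs.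
have DY : derive1 Y t1 = derive1 (derive1 g) t1 + u0 *m derive1 (derive1 Fr) t1.
  have e1 : derivable (derive1 g) t1 1 := smooth_derivable sdg1.
  have e2 : derivable (fun s => u0 *m derive1 Fr s) t1 1 := smooth_derivable suF.
  rewrite derive1E; apply: (etrans (deriveD e1 e2)).
  by rewrite (derive_mulmxl u0 (1 : R) (smooth_diff sdF)) !derive1E.
have := nor_derive td It1 sY nY; rewrite DY => YE.
rewrite mulmxDl -!scalemxAl mulmxDl -!scalemxAl YE -scalemxAr -scalemxAl -!mulmxA F0 !mulmx0 scaler0 !addr0.
by rewrite scalerA mulrACA tt mul1r [hd w * _]mulrC.
Qed.

End Chart.
End TubeSubmanifold.

(** * The tube is a rank-one approximation *)

Section TubeRankOne.
Context {R : realType} {N m : nat}.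
Variables (I : set R) (g : R -> 'rV[R]_N) (P : R -> 'M[R]_N).
Hypothesis td : tube_data (m := m) I g P.
Variable Om : R -> set 'rV[R]_N.
Local Notation leaf := (leaf g P).

Hypothesis Om_open : forall t x, I t -> leaf t x -> Om t x ->
  exists2 d : R, 0 < d & forall s y, I s -> leaf s y ->
    `|s - t| < d -> `|y - x| < d -> Om s y.
Hypothesis Om_good : forall t x, I t -> leaf t x -> Om t x ->
  exists2 r, good I g P t r & `|x| < r.

Local Notation S := (tube I g P Om).

(** [P t] fixes the rows of the Jacobian, because [leaf_derive] makes [derive1 Fr t] tangent; by
    equality of dimensions the tangent space at [g t + x] is the one at [g t]. The second
    fundamental form is [hd v * hd w] times a nonzero vector, so its nullity is given by [hd v = 0]:
    this is the leaf. *)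
Lemma tube_point t x : I t -> leaf t x -> Om t x ->
  exists b (U : set 'rV[R]_m.+1) phi,
  [/\ param_at S (g t + x) b U phi 0, if b then ~ I° t else I° t,
      forall y, tangent m.+1 S (g t + x) y <-> y *m P t = y &
      forall y, nullity m.+1 S (g t + x) y <-> leaf t y].
Proof.
move=> It lx Ox; have T : tot I g P Om (t, x) by [].
have [Fr [sF rF nF]] := leaf_frame td It.
have [_ /(_ It) sp] := nbhs_singleton nF.
have [u0 xu] := (sp.2 x).1 lx.
have [tau [b [tt g1 g2 hb]]] : exists (tau : R) (b : bool), [/\ tau * tau = 1,
    forall s, I s -> b -> 0 <= tau * (s - t),
    \forall s \near t, (b -> 0 <= tau * (s - t)) -> I s &
    if b then ~ I° t else I° t].
  have [n|[nI [tau tauE [H1 H2]]]] := interval_germ (td_int td) (td_ne td) It.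
    exists 1, false; split=> //; first by rewrite mulr1.
    by apply: filterS n.
  exists tau, true; split=> //.
  - by case: tauE => ->; rewrite ?mulr1// mulrNN mulr1.
  - by move=> s Is _; exact: H1.
  - by apply: filterS H2 => s + H; apply; exact: H.
have [U Pa] := tube_param td Om_open Om_good T sF rF nF xu tt g1 g2.
set phi := ruled_chart _ _ _ _ _ in Pa.
have sphi := param_smooth Pa; have rJ := param_row_free Pa.
have DJ w : w *m jacobian phi 0 = (tau * hd w) *: (derive1 g t + u0 *m derive1 Fr t) + tl w *m Fr t.
  rewrite -deriveEjacobian; last exact: smooth_diff.
  exact: (chart_derive0 td T u0 tau sF).
have nfr := frame_leafproj nF.
have [FP _] := leaf_derive td It sF nfr.
have FrP : Fr t *m P t = Fr t.
  by rewrite -(nbhs_singleton nfr It) -mulmxA (leafproj_P td It).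
have [B rB PB] := td_basis td It.
have sB : spans B [set y | y *m P t = y].
  by split=> // y; rewrite /= PB; exact: projmx_id.
have sJ : spans (jacobian phi 0) [set y | exists w, y = w *m jacobian phi 0] by split.
have TE : [set y | exists w : 'rV_m.+1, y = w *m jacobian phi 0] = [set y | y *m P t = y].
  apply: (spans_eq sJ sB) => _ [w ->] /=.
  by rewrite DJ mulmxDl -scalemxAl mulmxDl (td_vel td It) -!mulmxA FP FrP.
have tanE y : tangent m.+1 S (g t + x) y <-> y *m P t = y.
  have -> : (y *m P t = y) = [set y | y *m P t = y] y by [].
  by rewrite -TE; exact: tangentE Pa y.
have norE : norproj phi 0 = 1%:M - P t.
  rewrite /norproj -(tproj_param Pa) (tprojE rB) -?PB// => y.
  by rewrite tanE PB; exact: projmx_id.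
have sffE v w : sff m.+1 S (g t + x) (v *m jacobian phi 0) (w *m jacobian phi 0)
    = (hd v * hd w) *: kappa g P t Fr u0.
  rewrite (sff_param Pa) norE; exact: (chart_derive2 td T u0 sF nF tt).
have k0 := kappa_neq0 td Om_good T sF nF xu.
exists b, U, phi; split=> // y; split.
  move=> [/(tangentE Pa)[w ->] H].
  have := H (mkz 1 0 *m jacobian phi 0); rewrite sffE hd_mkz mulr1.
  move=> /(_ _)/eqP; rewrite scaler_eq0 (negbTE k0) orbF => h0.
  rewrite DJ (eqP (h0 _)); last by apply/(tangentE Pa); eexists.
  by rewrite mulr0 scale0r add0r; apply/sp.2; eexists.
move=> /(sp.2 y)[u yu]; have yE : y = mkz 0 u *m jacobian phi 0.
  by rewrite DJ hd_mkz tl_mkz mulr0 scale0r add0r.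
split; first by apply/(tangentE Pa); exists (mkz 0 u).
by move=> _ /(tangentE Pa)[w ->]; rewrite yE sffE hd_mkz mul0r scale0r.
Qed.

Lemma tube_boundary t x : I t -> leaf t x -> Om t x ->
  boundary m.+1 S (g t + x) <-> ~ I° t.
Proof.
move=> It lx Ox; have [b [U [phi [Pa hb _ _]]]] := tube_point It lx Ox.
case: b Pa hb => Pa hb; split=> //.
- by move=> _; exists U, phi, 0; split=> // i _; rewrite mxE.
- by move=> bd; exfalso; apply: (boundary_param Pa) bd; near=> y.
Unshelve. all: by end_near. Qed.

Hypothesis Om0 : forall t, I t -> Om t 0.

Theorem tube_rank_one : rank_one m.+1 S.
Proof.
split.
- move=> p [t [x [It lx Ox ->]]].
  by have [b [U [phi [Pa _ _ _]]]] := tube_point It lx Ox; exists b, U, phi, 0.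
- move=> p [t [x [It lx Ox ->]]].
  have [b [U [phi [Pa _ _ nE]]]] := tube_point It lx Ox.
  have [F [rF FK]] := leaf_spans td It.
  by apply/has_dim_spans; exists F; split=> // y; rewrite nE; exact: FK.
- move=> p [U [phi [a [Pa bd]]]].
  have [t [x [It lx Ox pE]]] := param_mem Pa.
  have [b [U' [phi' [Pa' _ _ nE]]]] := tube_point It lx Ox.
  have [d d0 Hd] := Om_open It lx Ox.
  apply/near0P; exists d => // y; rewrite subr0 pE => yd /nE ly.
  have lxy := leafD lx ly.
  exists t, (x + y); split=> //; last by rewrite addrA.
  by apply: Hd => //; rewrite ?subrr ?normr0// addrAC subrr add0r.
Qed.

Theorem tube_approximation (M : set 'rV[R]_N) :
  (forall t, I t -> forall y, tangent m.+1 M (g t) y <-> y *m P t = y) ->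
  rank_one_approximation m.+1 M I g S.
Proof.
move=> MT; split; first exact: tube_rank_one.
have inS t : I t -> S (g t).
  by move=> It; exists t, 0; split=> //; [exact: leaf0|exact: Om0|rewrite addr0].
split.
- by have [] := tube_rank_one.
- by move=> _ [t It <-]; exact: inS.
- move=> t It; have [b [U [phi [_ _ tE _]]]] := tube_point It (leaf0 g P t) (Om0 It).
  rewrite addr0 in tE; apply/seteqP; split=> y.
    by move=> /tE /(MT t It).
  by move=> /(MT t It) /tE.
- by move=> t It; have := tube_boundary It (leaf0 g P t) (Om0 It); rewrite addr0.
- move=> oI; apply/seteqP; split=> // p bd.
  have [U [phi [a [Pa _]]]] := bd.
  have [t [x [It lx Ox pE]]] := param_mem Pa.
  have := (tube_boundary It lx Ox).1; rewrite -pE => /(_ bd); apply.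
  by move: oI It; rewrite openE; exact.
Qed.

End TubeRankOne.

(** * Existence of the approximation, and the fields [X_j] *)

Section Hypotheses.
Context {R : realType} {N m : nat}.
Variables (M : set 'rV[R]_N) (I : set R) (g : R -> 'rV[R]_N).
Hypothesis hM : submanifold m.+1 M.
Hypothesis hI : is_interval I.
Hypothesis hI0 : I° !=set0.
Hypothesis hgM : g @` I `<=` M.
Hypothesis hg : smooth_on I g.
Hypothesis hemb : embeds I g.
Hypothesis hasym : forall t, I t -> sff m.+1 M (g t) (derive1 g t) (derive1 g t) != 0.
Hypothesis hrank : forall t, I t ->
     has_dim (sff m.+1 M (g t) (derive1 g t) @` tangent m.+1 M (g t)) 1.

Let gM t : I t -> M (g t). Proof. by move=> It; apply: hgM; exists t. Qed.

Lemma exists_tube_data : exists2 P : R -> 'M[R]_N, tube_data (m := m) I g P &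
  forall t, I t -> P t = tproj (tangent m.+1 M (g t)).
Proof.
have [P sP PE] := tproj_smooth hM hI hI0 hg gM.
have vel t It := @curve_derive_tangent _ _ _ _ _ _ hM hI hI0 hg gM P PE t It.
have sffE t y It := @curve_sff _ _ _ _ _ _ hM hI hI0 hg gM P sP PE t y It.
exists P => //; split=> //.
- by move=> t It; exact: (curve_basis hM gM PE It).
- by move=> t It; have := hasym It; rewrite (sffE t _ It (vel t It)).
- move=> t y It yP.
  have [B _ BE] := (has_dimP _ _).1 (hrank It).
  have inT z : z *m P t = z -> exists k : R, z *m derive1 P t *m (1%:M - P t) = k *: row 0 B.
    move=> zP; have [v E] : exists v, z *m derive1 P t *m (1%:M - P t) = v *m B.
      apply/BE; exists z; last exact: sffE.
      exact/(curve_tangent hM gM PE z It).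
    exists (v 0 0); rewrite E [v]mx11_scalar mul_scalar_mx mxE eqxx mulr1n; congr (_ *: _).
    by apply/matrixP => i j; rewrite mxE ord1.
  have [k1 E1] := inT _ (vel t It); have [k2 E2] := inT _ yP.
  have k10 : k1 != 0.
    have := hasym It; rewrite (sffE t _ It (vel t It)) E1.
    by apply: contra => /eqP ->; rewrite scale0r.
  by exists (k2 / k1); rewrite E1 E2 scalerA divfK.
Qed.

Variable P : R -> 'M[R]_N.
Hypothesis td : tube_data (m := m) I g P.
Hypothesis PE : forall t, I t -> P t = tproj (tangent m.+1 M (g t)).

Lemma M_tangent t : I t -> forall y, tangent m.+1 M (g t) y <-> y *m P t = y.
Proof. by move=> It y; exact: (curve_tangent hM gM PE y It). Qed.

Lemma exists_rank_one_approximation : exists S, rank_one_approximation m.+1 M I g S.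
Proof.
(* Any good radius at a nearby parameter may be used, so no radius has to be chosen continuously in
   [t]. Halving it makes [good_shift] available at [t] itself. *)
pose Om (t : R) (x : 'rV[R]_N) := exists t0 r, [/\ I t0, good I g P t0 r, `|t - t0| < r / 2 & `|x| < r / 2] : Prop.
exists (tube I g P (fun t => [set x : 'rV[R]_N | Om t x])).
apply: (tube_approximation td) M_tangent.
- move=> t x It lx [t0 [r [It0 G tt0 xr]]].
  pose d := Num.min (r / 2 - `|t - t0|) (r / 2 - `|x|).
  exists d; first by rewrite lt_min !subr_gt0 tt0.
  move=> s y Is ly; rewrite !lt_min !ltrBrDl => /andP[st _] /andP[_ yx].
  exists t0, r; split=> //.
    by apply: le_lt_trans st; rewrite [leRHS]addrC ler_distD.
  by apply: le_lt_trans yx; have := ler_normD x (y - x); rewrite subrKC.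
- move=> t x It lx [t0 [r [It0 G tt0 xr]]].
  by exists (r / 2) => //; exact: good_shift G tt0.
- move=> t It; have [r G] := good_exists td It; have [r0 _ _] := G.
  by exists t, r; rewrite subrr !normr0 divr_gt0.
Qed.

(** The Weingarten equation: differentiating [nu P = 0] gives [nu' P = - nu P'], and the symmetry of
    [P], inherited by [P'], turns this into the transpose of [shape_mx]. *)
Lemma normal_derive (nu : R -> 'rV[R]_N) t : I t -> smooth_at nu t ->
  (forall s, I s -> nu s *m P s = 0) ->
  derive1 nu t *m P t = - (nu t *m (shape_mx P t)^T).
Proof.
move=> It snut nP0; have [B rB PB] := td_basis td It; have sP := tube_sP td It.
have nP : \forall s \near t, I s -> nu s *m P s = 0 by near=> s; exact: nP0.
have D : derive1 nu t *m P t = - (nu t *m derive1 P t).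
  apply/eqP; rewrite -addr_eq0 !derive1E; apply/eqP.
  have e := derive_mulmx (1:R) (smooth_diff snut) (smooth_diff sP).
  apply: (etrans (esym e)).
  have s0 : smooth_at (fun _ : R => 0 : 'rV[R]_N) t by exact: smooth_cst.
  have := derive_eq_dir (smooth_diff (smooth_mulmx snut sP)) (smooth_diff s0) It (tube_dir td It) nP.
  by rewrite derive_cst.
have DT : (derive1 P t)^T = derive1 P t.
  have nT : \forall s \near t, I s -> (P s)^T = P s.
    by near=> s => Is; have [B' _ ->] := td_basis td Is; exact: projmx_tr.
  rewrite derive1E -(derive_tr _ (smooth_diff sP)).
  exact: (derive_eq_dir (smooth_diff (smooth_tr sP)) (smooth_diff sP) It (tube_dir td It) nT).
have PT : (P t)^T = P t by rewrite PB projmx_tr.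
have E2 : (1%:M - P t)^T = 1%:M - P t by rewrite linearB /= trmx1 PT.
rewrite /shape_mx !trmx_mul DT PT E2 !mulmxA mulmxBr mulmx1 nP0// subr0.
by rewrite -mulNmx -D -mulmxA (tube_PP td It).
Unshelve. all: by end_near. Qed.

Section Ruled.
Hypothesis cI : compact I.
Variables (E : nat -> R -> 'rV[R]_N) (nu : R -> 'rV[R]_N).
Hypothesis hE : tangent_frame m.+1 M I g E.
Hypothesis hnu : admissible_normal m.+1 M I g nu.

Let Xmx t : 'M[R]_(m, N) := \matrix_(j < m) ruling E nu j.+1 t.

Lemma normal_P t : I t -> nu t *m P t = 0.
Proof.
move=> It; have [_ /(_ t It) nn _] := hnu.
have [B rB PB] := td_basis td It.
apply: dot_eq0; have <- : dot (nu t) (nu t *m P t) = 0.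
  by apply: nn; apply/(M_tangent It); rewrite -mulmxA (tube_PP td It).
by rewrite dotC !dot_mx trmx_mul PB projmx_tr -PB !mulmxA -(mulmxA (nu t) (P t)) (tube_PP td It).
Qed.

Lemma normal_dot t y : I t -> dot (y *m P t) (nu t) = 0.
Proof.
move=> It; have [B rB PB] := td_basis td It.
by rewrite dotC dot_mx trmx_mul PB projmx_tr -PB mulmxA (normal_P It) mul0mx mxE.
Qed.

(** The product with [nu] of the second fundamental form of the velocity with itself, which is also
    the coefficient of [E_{j+1}], up to sign, in [X_j]. *)
Let c t := dot (derive1 g t *m shape_mx P t) (nu t).

(** Only the normal part of the derivative of [E i] meets [nu]; by [nor_derive] it is the second
    fundamental form of the velocity and [E i], a multiple [beta] of that of the velocity with
    itself. *)
Lemma frame_at i t : (1 <= i <= m.+1)%N -> I t ->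
  [/\ smooth_at (E i) t, E i t *m P t = E i t &
   dot (derive1 (E i) t) (nu t) = beta (shape_mx P t) (derive1 g t) (E i t) * c t].
Proof.
move=> hi It; have [sE tE _ _] := hE.
have sEi : smooth_at (E i) t by have /smooth_onP := sE i hi; exact.
have EP s : I s -> E i s *m P s = E i s.
  by move=> Is; apply/(M_tangent Is); exact: tE.
split=> //; first exact: EP.
have nE : \forall s \near t, I s -> E i s *m P s = E i s by near=> s; exact: EP.
have := nor_derive td It sEi nE => D.
have [B rB PB] := td_basis td It.
rewrite (betaE rB PB (tube_PA td It) (tube_nu0 td It) (tube_rank1 td It)) in D.
have <- : dot (derive1 (E i) t *m (1%:M - P t)) (nu t) = dot (derive1 (E i) t) (nu t).
  by rewrite mulmxBr mulmx1 dotBl normal_dot// subr0.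
by rewrite D dotZl.
Unshelve. all: by end_near. Qed.

(** Let [y] be the tangential part of the derivative of [nu]. By [normal_derive], [dot y y = - dot
    (y *m shape_mx P t) (nu t) = - beta y * c t], and [y] is nonzero by admissibility. *)
Lemma ruling_c_neq0 t : I t -> c t != 0.
Proof.
move=> It; have [snu nn aa] := hnu.
have [B rB PB] := td_basis td It.
have snut : smooth_at nu t by have /smooth_onP := snu; exact.
have TE x : tangent m.+1 M (g t) x <-> exists v, x = v *m B.
  by rewrite (M_tangent It) PB; exact: projmx_id.
have := aa t It; rewrite (orthprojE _ rB TE) -PB; apply: contra => /eqP c0.

apply/eqP; apply: dot_eq0.
have E1 := normal_derive It snut normal_P.
set y := derive1 nu t *m P t in E1 *.
have -> : dot y y = - dot (y *m shape_mx P t) (nu t).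
  rewrite {1}E1 dotC !dot_mx raddfN /= mulmxN mxE trmx_mul trmxK mulmxA //.
by rewrite (betaE rB PB (tube_PA td It) (tube_nu0 td It) (tube_rank1 td It)) dotZl -/(c t) c0 mulr0 oppr0.
Qed.

(** Each field is [- c t] times the projection of a frame vector [E_{j+1}] onto the leaf along the
    velocity. Independence is read off by pairing with the frame vectors other than [E_1]. *)
Lemma ruling_spans t : I t -> spans (Xmx t) (leaf g P t).
Proof.
move=> It; have c0 := ruling_c_neq0 It.
have [B rB PB] := td_basis td It.
have h1 : (1 <= 1 <= m.+1)%N by [].
have hj (j : 'I_m) : (1 <= j.+2 <= m.+1)%N by rewrite /= ltnS ltn_ord.
have [_ _ oE gE] := hE.
have g1 := gE t It.
have [_ P1 D1] := frame_at h1 It.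
have b1 : beta (shape_mx P t) (derive1 g t) (E 1 t) = 1.
  by rewrite g1; exact: beta_v (tube_nu0 td It).
rewrite b1 mul1r in D1.
have XE (j : 'I_m) : ruling E nu j.+1 t =
    c t *: (beta (shape_mx P t) (derive1 g t) (E j.+2 t) *: derive1 g t - E j.+2 t).
  have [_ _ Dj] := frame_at (hj j) It.
  by rewrite /ruling Dj D1 g1 scalerBr scalerA [c t * _]mulrC.
have Xl v : leaf g P t (v *m Xmx t).
  rewrite mulmx_sum_row; apply: (big_ind (leaf g P t)).
  - exact: leaf0.
  - by move=> x y; exact: leafD.
  move=> j _; rewrite rowK XE /leaf /= -!scalemxAl; congr (_ *: (_ *: _)).
  apply/(leafP td It); have [_ Pj _] := frame_at (hj j) It; split.
    by rewrite mulmxBl -scalemxAl (td_vel td It) Pj.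
  rewrite mulmxBl -scalemxAl [E j.+2 t *m _](betaE rB PB (tube_PA td It) (tube_nu0 td It) (tube_rank1 td It)).
  by rewrite subrr.
have rX : row_free (Xmx t).
  apply: inj_row_free => v vX; apply/rowP => i; rewrite mxE.
  have := congr1 (fun z => dot z (E i.+2 t)) vX; rewrite /= dot0l dot_mx [v *m Xmx t]mulmx_sum_row mulmx_suml summxE.
  rewrite (bigD1 i)//= big1 ?addr0.
    rewrite rowK XE -dot_mx !dotZl dotBl dotZl -g1 !oE ?hj//.
    rewrite (_ : (1 == i.+2)%N = false)// eqxx mulr0 sub0r mulrN1 mulrN => /eqP.
    by rewrite oppr_eq0 mulf_eq0 (negbTE c0) orbF => /eqP.
  move=> j ji; rewrite rowK XE -dot_mx !dotZl dotBl dotZl -g1 !oE ?hj//.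
  rewrite (_ : (1 == i.+2)%N = false)// (_ : (j.+2 == i.+2)%N = false); last first.
    by rewrite !eqSS; apply/negbTE.
  by rewrite mulr0 subr0 !mulr0.
split=> // x; have [F sF] := leaf_spans td It.
have sX : spans (Xmx t) [set y | exists v : 'rV_m, y = v *m Xmx t] by split.
have <- : [set y | exists v : 'rV_m, y = v *m Xmx t] = leaf g P t.
  by apply: (spans_eq sX sF) => _ [v ->]; exact: Xl.
by [].
Qed.

Lemma smooth_Xmx t : I t -> smooth_at Xmx t.
Proof.
move=> It; apply/smooth_mxP => j k.
have hj : (1 <= j.+2 <= m.+1)%N by rewrite /= ltnS ltn_ord.
have h1 : (1 <= 1 <= m.+1)%N by [].
have [s1 _ _] := frame_at h1 It; have [sj _ _] := frame_at hj It.
have [/smooth_onP/(_ t It) snu _ _] := hnu.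
have sd (f : R -> 'rV[R]_N) : smooth_at f t -> smooth_at (derive1 f) t.
  move=> sf; have -> : derive1 f = 'D_1 f by apply/funext => s; rewrite derive1E.
  exact: smooth_derive.
have : smooth_at (fun s => ruling E nu j.+1 s 0 k) t.
  apply: smooth_coord; apply: smoothB; apply: smoothZ => //.
  - by apply: smooth_dot => //; exact: sd.
  - by apply: smooth_dot => //; exact: sd.
by apply: smooth_at_eq; near=> s; rewrite [RHS]mxE.
Unshelve. all: by end_near. Qed.

Lemma ruled_map_mx t (u : 'rV[R]_m) : ruled_map (m := m.+1) g E nu t u = g t + u *m Xmx t.
Proof.
rewrite /ruled_map mulmx_sum_row; congr (_ + _).
by apply: eq_bigr => j _; rewrite rowK.
Qed.

(** Compactness provides one radius [r] that is good for all [t], then one bound on the coordinates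
    that keeps all leaf vectors below [r]. As matrices carry the sup norm, the box of side [2 e] in
    the coordinates is a ball, and the ruled image is a tube. *)
Theorem ruled_image_approximation : \forall e \near (0 : R)^'+,
  rank_one_approximation m.+1 M I g (ruled_image m.+1 I g E nu e).
Proof.
have [r r0 G] := good_compact td cI.
have H : \forall e \near (0 : R)^'+,
    I `<=` (fun t => I t -> forall u : 'rV[R]_m, `|u| < e -> `|u *m Xmx t| < r).
  apply: ((compact_near_coveringP I).1 cI) => t It.
  have sX := smooth_Xmx It.
  have n := cont_dist (smooth_cont sX) ltr01.
  pose C := m%:R * (`|Xmx t| + 1) + 1.
  have C0 : 0 < C by rewrite ltr_wpDl// mulr_ge0// addr_ge0.
  have rC : 0 < r / C by rewrite divr_gt0.
  exists ([set t' | `|Xmx t - Xmx t'| < 1], [set e | 0 < e < r / C]) => /=.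
    split; first exact: n.
    by apply: filterS2 (nbhs_right_gt 0) (nbhs_right_lt rC) => s s0 sr; apply/andP.
  move=> [t' e] [/= tt' /andP[e0 er]] _ u ue.
  apply: le_lt_trans (mulmx_norm _ _) _; apply: (@le_lt_trans _ _ (C * `|u|)).
    rewrite mulrCA mulrC ler_wpM2r// /C.
    apply: (@le_trans _ _ (m%:R * (`|Xmx t| + 1))); last by rewrite lerDl.
    rewrite ler_wpM2l//; have := ler_normD (Xmx t) (Xmx t' - Xmx t).
    by rewrite subrKC => /le_trans; apply; rewrite lerD2l distrC ltW.
  by rewrite mulrC -ltr_pdivlMr// (lt_trans ue).
apply: filterS2 (nbhs_right_gt 0) H => e e0 He.
pose Om t : set 'rV[R]_N := [set x | `|x *m rightinv (Xmx t)| < e].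
have XR t : I t -> Xmx t *m rightinv (Xmx t) = 1%:M.
  by move=> It; apply: mul_rightinv; have [] := ruling_spans It.
have -> : ruled_image m.+1 I g E nu e = tube I g P Om.
  apply/seteqP; split=> p.
    move=> [t [u [It ue ->]]]; have [rX sX] := ruling_spans It.
    exists t, (u *m Xmx t); split=> //; last exact: ruled_map_mx.
      by apply/sX; eexists.
    rewrite /Om /= -mulmxA XR// mulmx1.
    have : `|u| < e.
      rewrite /Num.Def.normr/= mx_normrE; apply/bigmax_ltP; split=> //= -[i k] _ /=.
      by rewrite ord1 ltr_norml; exact: ue.
    by [].
  move=> [t [x [It lx Ox ->]]]; have [rX sX] := ruling_spans It.
  have [u xu] := (sX x).1 lx; exists t, u; rewrite ruled_map_mx xu; split=> // j.
  move: Ox; rewrite /Om /= xu -mulmxA XR// mulmx1 => ue.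
  by rewrite -ltr_norml; apply: le_lt_trans ue; exact: mx_entry_le.
apply: (tube_approximation td) M_tangent.
- move=> t x It lx Ox; have [rX _] := ruling_spans It.
  have sR := smooth_rightinv rX (smooth_Xmx It).
  pose e' := e - `|x *m rightinv (Xmx t)|.
  have e'0 : 0 < e' by rewrite subr_gt0.
  have e20 : 0 < e' / 2 by rewrite divr_gt0.
  pose A := N%:R * `|x| + 1.
  have A0 : 0 < A by rewrite ltr_wpDl// mulr_ge0.
  pose B := N%:R * (`|rightinv (Xmx t)| + 1) + 1.
  have B0 : 0 < B by rewrite ltr_wpDl// mulr_ge0// addr_ge0.
  have eA : 0 < e' / 2 / A by rewrite divr_gt0.
  have n1 := cont_dist (smooth_cont sR) eA.
  have n2 := cont_dist (smooth_cont sR) ltr01.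
  have [d1 d10 H1] := (near0P _ _).1 (filterI n1 n2).
  exists (Num.min d1 (e' / 2 / B)); first by rewrite lt_min d10 divr_gt0.
  move=> s y Is ly; rewrite !lt_min => /andP[st _] /andP[_ yx].
  have [p1 p2] := H1 s st.
  have b2 : `|(y - x) *m rightinv (Xmx s)| < e' / 2.
    apply: le_lt_trans (mulmx_norm _ _) _; apply: (@le_lt_trans _ _ (B * `|y - x|)).
      rewrite mulrCA mulrC ler_wpM2r// /B.
      apply: (@le_trans _ _ (N%:R * (`|rightinv (Xmx t)| + 1))); last by rewrite lerDl.
      rewrite ler_wpM2l//; have := ler_normD (rightinv (Xmx t)) (rightinv (Xmx s) - rightinv (Xmx t)).
      by rewrite subrKC => /le_trans; apply; rewrite lerD2l distrC ltW.
    by rewrite mulrC -ltr_pdivlMr.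
  have b3 : `|x *m (rightinv (Xmx s) - rightinv (Xmx t))| <= e' / 2.
    apply: le_trans (mulmx_norm _ _) _; rewrite distrC mulrA.
    apply: (@le_trans _ _ (A * (e' / 2 / A))); last by rewrite mulrCA divff ?mulr1// gt_eqF.
    by rewrite ler_pM ?mulr_ge0// ?lerDl// ltW.
  rewrite /Om /=.
  have -> : y *m rightinv (Xmx s) = (y - x) *m rightinv (Xmx s) +
      x *m (rightinv (Xmx s) - rightinv (Xmx t)) + x *m rightinv (Xmx t).
    by rewrite mulmxBr addrA subrK mulmxBl subrK.
  have := ler_normD ((y - x) *m rightinv (Xmx s) + x *m (rightinv (Xmx s) - rightinv (Xmx t))) (x *m rightinv (Xmx t)).
  have := ler_normD ((y - x) *m rightinv (Xmx s)) (x *m (rightinv (Xmx s) - rightinv (Xmx t))).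
  move: b2 b3; rewrite /e'.
  move: (`|_ + _ + _|) (`|(y - x) *m _|) (`|x *m (_ - _)|) (`|x *m _|) (`|_ + _|) => p q v w z.
  by move=> *; lra.
- move=> t x It lx Ox; have [rX sX] := ruling_spans It.
  exists r; first exact: G.
  have [u xu] := (sX x).1 lx; rewrite xu; apply: He => //.
  by move: Ox; rewrite /Om /= xu -mulmxA XR// mulmx1.
- by move=> t It; rewrite /Om /= mul0mx normr0.
Qed.

End Ruled.

End Hypotheses.

(** * Developability of rank-one submanifolds *)

Section NormalChart.
Context {R : realType} {N m : nat}.
Implicit Types (S : set 'rV[R]_N).

(* A chart of [S] around [p] which is inverse to a linear map [L], as in a graph. *)
Record graph_chart S (p : 'rV[R]_N) (L : 'M[R]_(N, m)) (Phi : 'rV[R]_m -> 'rV[R]_N)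
    (D : set 'rV[R]_m) : Prop := GraphChart {
  gc_smooth : smooth_at Phi (p *m L);
  gc_base : Phi (p *m L) = p;
  gc_linear : \forall y \near p *m L, Phi y *m L = y;
  gc_in : \forall q \near p, S q -> D (q *m L) /\ Phi (q *m L) = q;
  gc_out : \forall y \near p *m L, D y ->
    [/\ S (Phi y),
        forall x, tangent m S (Phi y) x <-> exists v, x = v *m jacobian Phi y,
        forall v, nullity m S (Phi y) (v *m jacobian Phi y) <-> forall w, 'D_v ('D_w Phi) y = 0 &
        forall v w, sff m S (Phi y) (v *m jacobian Phi y) (w *m jacobian Phi y) = 0 <->
          'D_v ('D_w Phi) y = 0] }.

Lemma jacobian_linear (L : 'M[R]_(N, m)) (Phi : 'rV[R]_m -> 'rV[R]_N) y : smooth_at Phi y ->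
  (\forall z \near y, Phi z *m L = z) -> jacobian Phi y *m L = 1%:M.
Proof.
move=> sP nL; apply/row_matrixP => i; rewrite !rowE mulmxA mulmx1.
rewrite -deriveEjacobian; last exact: smooth_diff.
rewrite -(derive_mulmxr L _ (smooth_diff sP)) (near_eq_derive _ nL).
exact: derive_id.
Qed.

(** Differentiate [Phi z *m L = z] twice. As [L] is injective on tangent vectors, a second
    derivative of [Phi] that is tangent must vanish; so in a graph chart the second fundamental form
    vanishes exactly when the second derivative does. *)
Lemma derive2_linear (L : 'M[R]_(N, m)) (Phi : 'rV[R]_m -> 'rV[R]_N) y v w : smooth_at Phi y ->
  (\forall z \near y, Phi z *m L = z) -> 'D_v ('D_w Phi) y *m L = 0.
Proof.
move=> sP nL; rewrite -(derive_mulmxr L _ (smooth_diff (smooth_derive w sP))).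
have E : \forall z \near y, 'D_w Phi z *m L = cst w z.
  apply: filterS2 (smooth_near sP) (near_join nL) => z sz nz.
  by rewrite -(derive_mulmxr L _ (smooth_diff sz)) (near_eq_derive _ nz) derive_id.
by rewrite (near_eq_derive _ E) derive_cst.
Qed.

Lemma exists_graph_chart S p b U phi a : param_at S p b U phi a ->
  forall L, jacobian phi a *m L = 1%:M -> exists psi : 'rV[R]_m -> 'rV[R]_m,
  [/\ smooth_at psi (p *m L), psi (p *m L) = a,
      \forall y \near p *m L, phi (psi y) *m L = y,
      \forall y \near p *m L, model b (psi y) -> param_at S (phi (psi y)) b U phi (psi y) &
      graph_chart S p L (fun y => phi (psi y)) (fun y => model b (psi y))].
Proof.
move=> Pa L JL; have [psi [spsi psia n1 n2]] := param_chart Pa JL.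
have sphi := param_smooth Pa.
have [[oU _ _ _ _] [Ua _] pa] := Pa.
have nU : \forall x \near a, U x by exact: open_nbhs_nbhs.
have nU' : \forall y \near p *m L, U (psi y).
  by apply: (smooth_cont_near spsi); rewrite psia.
have nP : \forall y \near p *m L, model b (psi y) -> param_at S (phi (psi y)) b U phi (psi y).
  by apply: filterS nU' => y Uy my; exact: (param_sub Pa).
have sPhi : smooth_at (fun y => phi (psi y)) (p *m L) by apply: smooth_comp => //; rewrite psia.
exists psi; split=> //; split=> //.
- by rewrite psia.
- by apply: filterS n2 => q H /H[[]].
have nphi : \forall y \near p *m L, smooth_at phi (psi y).
  by apply: (smooth_cont_near spsi); rewrite psia; exact: smooth_near.
have npsi := smooth_near spsi; have n1' := near_join n1.
near=> y => Dy.
have Py : param_at S (phi (psi y)) b U phi (psi y).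
  by move: Dy; exact: (near nP y).
have sy : smooth_at psi y by exact: (near npsi y).
have sphiy : smooth_at phi (psi y) by exact: (near nphi y).
have Ly : \forall z \near y, phi (psi z) *m L = z by exact: (near n1' y).
pose Phi z := phi (psi z).
have sP : smooth_at Phi y by exact: smooth_comp.
have JLy := jacobian_linear sP Ly.
have JE : jacobian Phi y = jacobian psi y *m jacobian phi (psi y).
  apply/row_matrixP => i; rewrite !rowE mulmxA.
  rewrite -deriveEjacobian; last exact: smooth_diff.
  have := derive_comp (delta_mx 0 i) (smooth_diff sy) (smooth_diff sphiy); rewrite /comp => ->.
  by rewrite !deriveEjacobian//; exact: smooth_diff.
have uJ : jacobian psi y \in unitmx.
  by rewrite JE -mulmxA in JLy; have [] := mulmx1_unit JLy.
have tE x : tangent m S (Phi y) x <-> exists v, x = v *m jacobian Phi y.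
  rewrite (tangentE Py) JE; split=> [[v ->]|[v ->]].
    by exists (v *m invmx (jacobian psi y)); rewrite mulmxA mulmxKV.
  by exists (v *m jacobian psi y); rewrite mulmxA.
have rJ := param_row_free Py.
have sffE v w : sff m S (Phi y) (v *m jacobian Phi y) (w *m jacobian Phi y) =
    'D_v ('D_w Phi) y *m norproj phi (psi y).
  have e u : 'D_u psi y = u *m jacobian psi y := deriveEjacobian _ (smooth_diff sy).
  have dphi : differentiable phi (psi y) := smooth_diff sphiy.
  have -> : 'D_v ('D_w Phi) y = 'D_('D_v psi y) ('D_('D_w psi y) phi) (psi y)
      + 'D_v ('D_w psi) y *m jacobian phi (psi y).
    apply: (etrans (derive2_comp v w sy sphiy)); congr (_ + _).
    exact: (deriveEjacobian _ dphi).
  have Z : 'D_v ('D_w psi) y *m jacobian phi (psi y) *m norproj phi (psi y) = 0.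
    by apply/(norproj_eq0 _ rJ); eexists.
  rewrite mulmxDl Z addr0 JE !mulmxA -(e v) -(e w).
  exact: (sff_param Py).
have nor0 v w : 'D_v ('D_w Phi) y *m norproj phi (psi y) = 0 -> 'D_v ('D_w Phi) y = 0.
  move/(norproj_eq0 _ rJ) => [u0 E].
  have {E} E : 'D_v ('D_w Phi) y = u0 *m invmx (jacobian psi y) *m jacobian Phi y.
    by rewrite E JE mulmxA mulmxKV.
  have := derive2_linear v w sP Ly; rewrite E -mulmxA JLy mulmx1 => ->.
  by rewrite mul0mx.
split=> //; first exact: param_mem Py.
  2: by move=> v w; split=> [|E]; [rewrite sffE; exact: nor0|rewrite sffE E mul0mx].
move=> v; split=> [[_ H] w|H].
  have tw : tangent m S (Phi y) (w *m jacobian Phi y).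
    exact: ((tE _).2 (ex_intro _ w erefl)).
  have s0 := H _ tw.
  have s1 := etrans (esym (sffE v w)) s0.
  exact: (nor0 v w s1).
split; first exact: ((tE _).2 (ex_intro _ v erefl)).
move=> z tz; have [w ->] := (tE z).1 tz.
have s0 := sffE v w; rewrite (H w) mul0mx in s0; exact: s0.
Unshelve. all: by end_near. Qed.

Lemma sff_sym S p b (U : set 'rV[R]_m) phi a x y : param_at S p b U phi a ->
  tangent m S p x -> tangent m S p y -> sff m S p x y = sff m S p y x.
Proof.
move=> Pa /(tangentE Pa)[v ->] /(tangentE Pa)[w ->].
by rewrite !(sff_param Pa) (schwarz_mx v w (param_smooth Pa)).
Qed.

End NormalChart.

(** * Constancy of the kernel of the second fundamental form along itself *)

Section Transport.
Context {R : realType} {N m : nat}.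
Variables (Phi : 'rV[R]_m -> 'rV[R]_N) (D : set 'rV[R]_m) (e : 'rV[R]_m) (i : 'I_N).

Definition comp_i y := Phi y 0 i.
Definition hess v w := 'D_v ('D_w comp_i).
Definition ell y v : R := hess v e y / hess e e y.

Lemma derive_eq_inward (f h : 'rV[R]_m -> R) x v : differentiable f x -> differentiable h x ->
  D x -> (\forall s \near (0 : R)^'+, D (x + s *: v)) ->
  (\forall y \near x, D y -> f y = h y) -> 'D_v f x = 'D_v h x.
Proof.
move=> df dh Dx dir E; have Ex := nbhs_singleton E Dx.
have : 'D_v (f - h) x = 0.
  apply: derive_eq0_side; first exact: differentiableB.
  apply: filterS2 dir (near_line v E) => s Ds Es.
  by rewrite !fctE Ex (Es Ds) !subrr.
by rewrite deriveB; [move/subr0_eq|exact: diff_derivable..].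
Qed.

Lemma smooth_comp_i y : smooth_at Phi y -> smooth_at comp_i y.
Proof. by move=> sP; exact: smooth_coord. Qed.

Lemma smooth_hess y v w : smooth_at Phi y -> smooth_at (hess v w) y.
Proof. by move=> /smooth_comp_i sF; apply: smooth_derive; exact: smooth_derive. Qed.

Lemma smooth_ell y v : smooth_at Phi y -> hess e e y != 0 -> smooth_at (fun z => ell z v) y.
Proof.
move=> sP h0; apply: smoothM; first exact: smooth_hess.
by apply: smoothV => //; exact: smooth_hess.
Qed.

Lemma hess_sym y v w : smooth_at Phi y -> hess v w y = hess w v y.
Proof. by move=> sP; apply: schwarz; exact: smooth_comp_i. Qed.

Lemma hess_i y v w : smooth_at Phi y -> hess v w y = ('D_v ('D_w Phi) y) 0 i.
Proof.
move=> sP; have E : \forall z \near y, 'D_w comp_i z = ('D_w Phi z) 0 i.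
  by apply: filterS (smooth_near sP) => z sz; exact: (esym (derive_entry w 0 i (smooth_diff sz))).
apply: (etrans (near_eq_derive v E)).
exact: (esym (derive_entry v 0 i (smooth_diff (smooth_derive w sP)))).
Qed.

Lemma hessDl y v v' w : smooth_at Phi y -> hess (v + v') w y = hess v w y + hess v' w y.
Proof.
move=> sP; apply: derive_dirD; apply: smooth_diff; apply: smooth_derive; exact: smooth_comp_i.
Qed.

Lemma hessZl y k v w : smooth_at Phi y -> hess (k *: v) w y = k * hess v w y.
Proof.
move=> sP; apply: derive_dirZ; apply: smooth_diff; apply: smooth_derive; exact: smooth_comp_i.
Qed.

Lemma ellD y v v' : smooth_at Phi y -> ell y (v + v') = ell y v + ell y v'.
Proof. by move=> sP; rewrite /ell hessDl// mulrDl. Qed.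

Lemma ellZ y k v : smooth_at Phi y -> ell y (k *: v) = k * ell y v.
Proof. by move=> sP; rewrite /ell hessZl// mulrA. Qed.

Lemma ellB y v v' : smooth_at Phi y -> ell y (v - v') = ell y v - ell y v'.
Proof. by move=> sP; rewrite ellD// -scaleN1r ellZ// mulN1r. Qed.

Lemma ell0 y : smooth_at Phi y -> ell y 0 = 0.
Proof. by move=> sP; rewrite -(scale0r e) ellZ// mul0r. Qed.

Lemma ell_e y : hess e e y != 0 -> ell y e = 1.
Proof. by move=> h0; rewrite /ell divff. Qed.

(** [ell] is built from the single component [i] of [Phi]; the condition says that vectors in its
    kernel are nevertheless killed by the second derivatives of all components. *)
Definition kernel_cond y := forall v, ell y v = 0 -> forall w, 'D_v ('D_w Phi) y = 0.

(** Apply the kernel condition to [u - ell y u *: e], on which [ell y] vanishes. *)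
Lemma hess_factor y u v : smooth_at Phi y -> hess e e y != 0 -> kernel_cond y ->
  hess u v y * hess e e y = hess u e y * hess v e y.
Proof.
move=> sP h0 K.
have lz : ell y (u - ell y u *: e) = 0 by rewrite ellB// ellZ// ell_e// mulr1 subrr.
have h1 : hess (u - ell y u *: e) v y = 0.
  by apply: (etrans (hess_i _ _ sP)); rewrite (K _ lz v) mxE.
have h2 : hess (u - ell y u *: e) v y = hess u v y - ell y u * hess e v y.
  by rewrite -scaleNr (hessDl _ _ _ sP) (hessZl _ _ _ sP) mulNr.
have h3 : hess u v y = ell y u * hess e v y := subr0_eq (etrans (esym h2) h1).
have h4 := hess_sym e v sP; rewrite /ell h4 in h3.
move: h3 h0; move: (hess u v y) (hess u e y) (hess v e y) (hess e e y) => p q r f -> f0.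
by rewrite mulrAC divfK.
Qed.

Lemma derive_hess_swap y u v w : smooth_at Phi y ->
  'D_u (hess v w) y = 'D_w (hess v u) y.
Proof.
move=> sP; have nP := smooth_near sP.
have sF := smooth_comp_i sP.
have E1 : \forall z \near y, hess v w z = hess w v z.
  by apply: filterS nP => z sz; exact: hess_sym.
have E2 : \forall z \near y, hess u v z = hess v u z.
  by apply: filterS nP => z sz; exact: hess_sym.
have e1 := near_eq_derive u E1; have e2 := near_eq_derive w E2.
have e3 := schwarz u w (smooth_derive v sF).
exact: (etrans e1 (etrans e3 e2)).
Qed.

(** The letters [p], [f], [q], [r] stand for [hess] at [u v], [e e], [u e], [v e], with primes for
    derivatives along [e], and [l] for [ell y v]. [X], [Y], [Z] are the derivatives of [f^-1], [q]
    and [f] along [v - l e], so that the conclusion is the vanishing derivative of [q / f], that is,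
    of [ell] at [u]. *)
Lemma transport_alg (p f q r p' f' q' r' X Y Z l : R) : f != 0 -> l = r / f ->
  p * f = q * r -> p * f' + f * p' = q * r' + r * q' ->
  X = - f ^- 2 * Z -> Y = p' - l * q' -> Z = r' - l * f' -> q * X + f^-1 * Y = 0.
Proof.
move=> f0 -> pf E -> -> ->.
have pE : p = q * r / f by rewrite -pf mulfK.
have p'E : p' = (q * r' + r * q' - p * f') / f by rewrite -E addrAC subrr add0r mulrC mulKf.
by rewrite p'E pE; field.
Qed.

(* The heart of the matter: differentiating [hess u v * f = hess u e * hess v e],
   where [f = hess e e], along [e] only and using the symmetry of third derivatives
   shows that [ell] is constant to first order along its own kernel. *)
Lemma ell_transport y u v : smooth_at Phi y -> hess e e y != 0 -> D y ->
  (\forall z \near y, D z -> kernel_cond z) ->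
  (\forall s \near (0 : R)^'+, D (y + s *: e)) ->
  'D_(v - ell y v *: e) (fun z => ell z u) y = 0.
Proof.
move=> sP h0 Dy nK dir.
have sh a b : smooth_at (hess a b) y by exact: smooth_hess.
have dh a b : derivable (hess a b) y e := smooth_derivable (sh a b).
have n0 : \forall z \near y, hess e e z != 0.
  exact: (smooth_cont_near (sh e e) (open_nbhs_nbhs (conj (@open_neq _ (0:R)) h0))).
have nP := smooth_near sP.
have E : \forall z \near y, D z -> (hess u v * hess e e) z = (hess u e * hess v e) z.
  near=> z => Dz; apply: hess_factor.
  - exact: (near nP z).
  - exact: (near n0 z).
  - by move: Dz; exact: (near nK z).
have DE : 'D_e (hess u v * hess e e) y = 'D_e (hess u e * hess v e) y.
  have m1 := differentiableM (smooth_diff (sh u v)) (smooth_diff (sh e e)).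
  have m2 := differentiableM (smooth_diff (sh u e)) (smooth_diff (sh v e)).
  exact: (derive_eq_inward m1 m2 Dy dir E).
have {}DE := etrans (esym (deriveM (dh u v) (dh e e))) (etrans DE (deriveM (dh u e) (dh v e))).
have F0 := hess_factor u v sP h0 (nbhs_singleton nK Dy).
set z := v - ell y v *: e.
have Dz (f : 'rV[R]_m -> R) : smooth_at f y -> 'D_z f y = 'D_v f y - ell y v * 'D_e f y.
  move=> sf; have df := smooth_diff sf.
  apply: (etrans (derive_dirB v (ell y v *: e) df)).
  exact: (congr1 (fun t => 'D_v f y - t) (derive_dirZ (ell y v) e df)).
have d1 : derivable (hess u e) y z := smooth_derivable (sh u e).
have d2 : derivable (hess e e) y z := smooth_derivable (sh e e).
have d3 : derivable (fun z => (hess e e z)^-1) y z by exact: derivableV.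
apply: (etrans (deriveM d1 d3)); have e1 := deriveV h0 d2.
have e2 := Dz _ (sh u e); have e4 := Dz _ (sh e e).
have e5 := derive_hess_swap v u e sP; have e6 := derive_hess_swap v e e sP.
have E3 : \forall z \near y, hess e v z = hess v e z.
  by apply: filterS nP => t st; exact: hess_sym.
have e3 := near_eq_derive e E3.
have eq1 := etrans e2 (congr1 (fun t => t - ell y v * 'D_e (hess u e) y) e5).
have eq2 := etrans e4 (congr1 (fun t => t - ell y v * 'D_e (hess e e) y) (etrans e6 e3)).
exact: (transport_alg h0 erefl F0 DE e1 eq1 eq2).
Unshelve. all: by end_near. Qed.

Definition good_point z := [/\ smooth_at Phi z, hess e e z != 0, kernel_cond z &
  forall u v, 'D_(v - ell z v *: e) (fun z => ell z u) z = 0].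

Lemma const_of_derive0 (l : R -> R) :
  (forall s : R, 0 <= s <= 1 -> is_derive s 1 l 0) -> forall s : R, 0 <= s <= 1 -> l s = l 0.
Proof.
move=> dl s s01; apply/eqP; rewrite -subr_eq0; apply/eqP.
apply: (@gronwall0 R (fun s => l s - l 0) (fun _ => 0) 0) => //; last by rewrite subrr.
- move=> t t01; have [d1 d2] := dl t t01; rewrite mul0r.
  have d3 : derivable (cst (l 0)) t (1 : R) by exact: derivable_cst.
  apply: DeriveDef; first exact: (derivableB d1 d3).
  by apply: (etrans (deriveB d1 d3)); rewrite d2 derive_cst subr0.
- by move=> t _; rewrite normr0.
Qed.

Lemma is_derive_line (f : 'rV[R]_m -> R) x v (s : R) : smooth_at f (x + s *: v) ->
  is_derive s 1 (fun h : R => f (x + h *: v)) ('D_v f (x + s *: v)).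
Proof. by move=> sf; apply: derive_line; exact: smooth_diff. Qed.

(** Along the segment put [lam u s = ell (x + s *: v) u]. The transport equation reads
    [lam u' = kap u * lam v]. For [u = v] it is a linear equation with initial value [0], so [lam v]
    vanishes by [gronwall0], and then every [lam u] is constant. As [v] stays in the kernel,
    ['D_v ('D_v Phi)] vanishes along the segment and [Phi] is affine there. *)
Lemma leaf_line x v : (forall s : R, 0 <= s <= 1 -> good_point (x + s *: v)) ->
  ell x v = 0 ->
  (forall u, ell (x + v) u = ell x u) /\ Phi (x + v) = Phi x + 'D_v Phi x.
Proof.
move=> G lv.
have i01 : 0 <= (1 : R) <= 1 by rewrite lexx ler01.
pose lam u (s : R) := ell (x + s *: v) u.
pose kap u (s : R) := 'D_e (fun z => ell z u) (x + s *: v).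
have sell u (s : R) : 0 <= s <= 1 -> smooth_at (fun z => ell z u) (x + s *: v).
  by move=> s01; have [sz hz _ _] := G s s01; exact: smooth_ell.
have dlam u (s : R) : 0 <= s <= 1 -> is_derive s 1 (lam u) (kap u s * lam v s).
  move=> s01; have [sz hz _ T] := G s s01.
  have := is_derive_line (sell u s s01).
  have -> : 'D_v (fun z => ell z u) (x + s *: v) = kap u s * lam v s; last by [].
  have d := smooth_diff (sell u s s01).
  have h1 := derive_dirB v (ell (x + s *: v) v *: e) d.
  have h2 := derive_dirZ (ell (x + s *: v) v) e d; rewrite h2 in h1.
  have h3 := subr0_eq (etrans (esym h1) (T u v)).
  by apply: (etrans h3); rewrite mulrC.
have [C HC] : exists C : R, forall s : R, 0 <= s <= 1 -> `|kap v s| <= C.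
  have ck : {within `[0, 1], continuous (fun s : R => `|kap v s|)}.
    apply: continuous_in_subspaceT => s; rewrite inE /= in_itv /= => s01.
    have sk : smooth_at (fun s => kap v s) s.
      have sl : smooth_at (fun h : R => x + h *: v) s.
        apply: smoothD; first exact: smooth_cst.
        by apply: smoothZ; [exact: smooth_id|exact: smooth_cst].
      exact: (smooth_comp_rV sl (smooth_derive e (sell v s s01))).
    exact: (cvg_norm (smooth_cont sk)).
  have [c _ Hc] := EVT_max ler01 ck.
  by exists (`|kap v c|) => s s01; apply: Hc; rewrite in_itv.
have lv0 s : 0 <= s <= 1 -> lam v s = 0.
  have l00 : lam v 0 = 0 by rewrite /lam scale0r addr0.
  exact: (gronwall0 (dlam v) HC l00).
have G0 : good_point x by have := G 0; rewrite scale0r addr0; apply; rewrite lexx ler01.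
split=> [u|].
  have := @const_of_derive0 (lam u) _ 1 i01; rewrite /lam scale1r scale0r addr0; apply.
  by move=> s s01; have := dlam u s s01; rewrite (lv0 s s01) mulr0.
apply/rowP => j.
pose F y := Phi y 0 j.
have sF (s : R) : 0 <= s <= 1 -> smooth_at F (x + s *: v).
  by move=> s01; have [sz _ _ _] := G s s01; exact: smooth_coord.
have dF0 s : 0 <= s <= 1 -> 'D_v ('D_v F) (x + s *: v) = 0.
  move=> s01; have [sz _ K _] := G s s01.
  have := K v (lv0 s s01) v; move/(congr1 (fun z : 'rV_N => z 0 j)); rewrite mxE => <-.
  have E : \forall z \near (x + s *: v), 'D_v F z = ('D_v Phi z) 0 j.
    by apply: filterS (smooth_near sz) => z sz'; exact: (esym (derive_entry v 0 j (smooth_diff sz'))).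
  rewrite (near_eq_derive _ E).
  exact: (esym (derive_entry v 0 j (smooth_diff (smooth_derive v sz)))).
have DF s : 0 <= s <= 1 -> 'D_v F (x + s *: v) = 'D_v F x.
  move=> s01; have := @const_of_derive0 (fun s => 'D_v F (x + s *: v)) _ s s01.
  rewrite scale0r addr0; apply=> t t01.
  have := is_derive_line (smooth_derive v (sF t t01)); by rewrite dF0.
have [s s01 E] := @MVT_line R _ F x v (fun s h => smooth_diff (sF s h)).
have s01' : 0 <= s <= 1 by move: s01 => /andP[/ltW -> /ltW ->].
rewrite mxE; apply/eqP; rewrite addrC -subr_eq; apply/eqP; rewrite -/(F _) -/(F x) E DF//.
by have [sx _ _ _] := G0; exact: (esym (derive_entry v 0 j (smooth_diff sx))).
Qed.

End Transport.

Section Developable.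
Context {R : realType} {N m : nat}.
Implicit Types (S : set 'rV[R]_N).

Lemma near_good_point (Phi : 'rV[R]_m.+1 -> 'rV[R]_N) (D : set 'rV[R]_m.+1) e i y0 :
  smooth_at Phi y0 -> hess Phi i e e y0 != 0 ->
  (\forall y \near y0, D y -> kernel_cond Phi e i y) ->
  (\forall y \near y0, D y -> \forall s \near (0 : R)^'+, D (y + s *: e)) ->
  \forall y \near y0, D y -> good_point Phi e i y.
Proof.
move=> sP h0 nK nI.
have n0 : \forall z \near y0, hess Phi i e e z != 0.
  exact: (smooth_cont_near (smooth_hess i e e sP) (open_nbhs_nbhs (conj (@open_neq _ (0:R)) h0))).
have nP := smooth_near sP; have nKj := near_join nK.
near=> y => Dy.
have sy : smooth_at Phi y by exact: (near nP y).
have hy : hess Phi i e e y != 0 by exact: (near n0 y).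
have Ky : \forall z \near y, D z -> kernel_cond Phi e i z by exact: (near nKj y).
have Iy : \forall s \near (0 : R)^'+, D (y + s *: e) by move: Dy; exact: (near nI y).
split=> //; first exact: (nbhs_singleton Ky).
by move=> u v; exact: (ell_transport u v sy hy Dy Ky Iy).
Unshelve. all: by end_near. Qed.

(** [ell y] is [1] on [e] and [0] on the nullity, which has dimension [m]; hence [e] and a basis of
    the nullity form a basis of the parameter space. The coefficient of a vector along [e] is its
    value under [ell y], so the kernel of [ell y] is the nullity. *)
Lemma chart_kernel_cond S p L Phi D e i : graph_chart (m := m.+1) S p L Phi D ->
  (forall q, S q -> has_dim (nullity m.+1 S q) m) ->
  \forall y \near p *m L, hess Phi i e e y != 0 -> D y -> kernel_cond Phi e i y.
Proof.
move=> gc hd; have nP := smooth_near (gc_smooth gc); have nL := near_join (gc_linear gc).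
have nO := gc_out gc.
near=> y => hy Dy.
have sy : smooth_at Phi y by exact: (near nP y).
have Ly : \forall z \near y, Phi z *m L = z by exact: (near nL y).
have [Sy tE nE _] : [/\ S (Phi y),
        forall x, tangent m.+1 S (Phi y) x <-> exists v, x = v *m jacobian Phi y,
        forall v, nullity m.+1 S (Phi y) (v *m jacobian Phi y) <-> forall w, 'D_v ('D_w Phi) y = 0 &
        forall v w, sff m.+1 S (Phi y) (v *m jacobian Phi y) (w *m jacobian Phi y) = 0 <->
          'D_v ('D_w Phi) y = 0].
  by move: Dy; exact: (near nO y).
have JL := jacobian_linear sy Ly.
have /has_dim_spans[B [rB BE]] := hd _ Sy.
have KB u : [/\ u *m B = (u *m B *m L) *m jacobian Phi y,
    forall w, 'D_(u *m B *m L) ('D_w Phi) y = 0 & ell Phi e i y (u *m B *m L) = 0].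
  have nB : nullity m.+1 S (Phi y) (u *m B) by apply/BE; eexists.
  have [v vE] := (tE _).1 nB.1.
  have vL : u *m B *m L = v by rewrite vE -mulmxA JL mulmx1.
  have Kv : forall w, 'D_v ('D_w Phi) y = 0 by apply/nE; rewrite -vE.
  rewrite vL; split=> //; rewrite /ell.
  have h1 := hess_i i v e sy; rewrite (Kv e) mxE in h1.
  by rewrite h1 mul0r.
pose C : 'M[R]_m.+1 := col_mx e (B *m L).
have rC : row_free C.
  apply: inj_row_free => w.
  have -> : w *m C = lsubmx (w : 'rV_(1 + m)) *m e + rsubmx (w : 'rV_(1 + m)) *m (B *m L).
    by rewrite /C -[X in X *m _](@hsubmxK R 1 1 m w) (@mul_row_col R 1 1 m m.+1).
  set w0 := lsubmx _; set u := rsubmx _; rewrite mulmxA => E.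
  have [uB Ku lu] := KB u.
  have w00 : w0 0 0 = 0.
    have E' : w0 0 0 *: e + u *m B *m L = 0 by rewrite -E -mul_scalar_mx -mx11_scalar.
    have := congr1 (fun v => ell Phi e i y v) E'.
    by rewrite (ellD _ _ _ _ sy) lu addr0 (ell0 _ _ sy) (ellZ _ _ _ _ sy) (ell_e hy) mulr1.
  have w0E : w0 = 0 by rewrite [w0]mx11_scalar w00 raddf0.
  have u0 : u = 0.
    apply: (row_free_inj rB); rewrite /= mul0mx uB.
    by move: E; rewrite w0E mul0mx add0r => ->; rewrite mul0mx.
  by rewrite -(@hsubmxK R 1 1 m w) -/w0 -/u w0E u0 (@row_mx0 R 1 1 m).
have uC : C \in unitmx by rewrite -row_free_unit.
move=> v lv w.
pose c : 'rV[R]_m.+1 := v *m invmx C.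
have vE : v = c *m C by rewrite mulmxKV.
have cE : c *m C = lsubmx (c : 'rV_(1 + m)) *m e + rsubmx (c : 'rV_(1 + m)) *m (B *m L).
  by rewrite /C -[X in X *m _](@hsubmxK R 1 1 m c) (@mul_row_col R 1 1 m m.+1).
rewrite cE mulmxA in vE; set c0 := lsubmx _ in vE; set u := rsubmx _ in vE.
have [uB Ku lu] := KB u.
have c00 : c0 0 0 = 0.
  have vE' : v = c0 0 0 *: e + u *m B *m L by rewrite -mul_scalar_mx -mx11_scalar.
  by move: lv; rewrite vE' (ellD _ _ _ _ sy) lu addr0 (ellZ _ _ _ _ sy) (ell_e hy) mulr1.
have c0E : c0 = 0 by rewrite [c0]mx11_scalar c00 raddf0.
by rewrite vE c0E mul0mx add0r; exact: Ku.
Unshelve. all: by end_near. Qed.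

Lemma ell_sum (Phi : 'rV[R]_m.+1 -> 'rV[R]_N) e i y v : smooth_at Phi y ->
  ell Phi e i y v = \sum_k v 0 k * ell Phi e i y (delta_mx 0 k).
Proof.
move=> sy; rewrite {1}(row_sum_delta v).
elim: (index_enum _) => [|j r IH]; first by rewrite !big_nil (ell0 _ _ sy).
by rewrite !big_cons (ellD _ _ _ _ sy) (ellZ _ _ _ _ sy) IH.
Qed.

Lemma ell_mx (Phi : 'rV[R]_m.+1 -> 'rV[R]_N) e i y : smooth_at Phi y ->
  exists Mx : 'M[R]_(m.+1, 1), forall v, ell Phi e i y v = (v *m Mx) 0 0.
Proof.
move=> sy; exists (\matrix_(k < m.+1, j < 1) ell Phi e i y (delta_mx 0 k)) => v.
by rewrite (ell_sum _ _ _ sy) mxE; apply: eq_bigr => j _; rewrite mxE.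
Qed.

End Developable.

Section Monotone.
Context {R : realType} {V : normedModType R}.

Lemma segment_affine (x v y0 : V) (s : R) :
  x + s *: v - y0 = (1 - s) *: (x - y0) + s *: (x + v - y0).
Proof. by rewrite (addrAC x v) (scalerDr s) addrA -scalerDl subrK scale1r addrAC. Qed.

Lemma segment_lt (x v y0 : V) (r s : R) : `|x - y0| < r -> `|x + v - y0| < r ->
  0 <= s <= 1 -> `|x + s *: v - y0| < r.
Proof.
move=> h0 h1 /andP[s0 s1].
rewrite segment_affine.
apply: le_lt_trans (ler_normD _ _) _; rewrite !normrZ (ger0_norm s0) ger0_norm ?subr_ge0//.
have [->|s_neq0] := eqVneq s 0; first by rewrite subr0 mul1r mul0r addr0.
have s_gt0 : 0 < s by rewrite lt_neqAle eq_sym s_neq0.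
have e1 : (1 - s) * `|x - y0| <= (1 - s) * r by rewrite ler_wpM2l ?subr_ge0// ltW.
have e2 : s * `|x + v - y0| < s * r by rewrite ltr_pM2l.
lra.
Qed.

Lemma local_monotone (f : V -> R) e y0 : smooth_at f y0 -> 0 < 'D_e f y0 ->
  exists2 r : R, 0 < r & forall y (s : R), `|y - y0| < r -> 0 < s -> `|y + s *: e - y0| < r ->
    f y < f (y + s *: e).
Proof.
move=> sf d0; have n1 := smooth_near sf.
have n2 : \forall y \near y0, 0 < 'D_e f y.
  exact: (smooth_cont_near (smooth_derive e sf) (near_gt d0)).
have [r r0 B] := (near0P y0 (fun y => smooth_at f y /\ 0 < 'D_e f y)).1 (filterI n1 n2).
exists r => // y s hy s0 hys.
have [t t01 E] : exists2 t : R, 0 < t < 1 & f (y + s *: e) - f y = 'D_(s *: e) f (y + t *: (s *: e)).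
  apply: MVT_line => t t01; have [sm _] := B _ (segment_lt hy hys t01); exact: smooth_diff.
have t01' : 0 <= t <= 1 by move: t01 => /andP[/ltW -> /ltW ->].
have [sm pos] := B _ (segment_lt hy hys t01').
have e1 := derive_dirZ s e (smooth_diff sm).
rewrite -subr_gt0; have -> := etrans E e1; exact: mulr_gt0.
Qed.

(** The intermediate value theorem in [s], with [y] as parameter: the signs at [eta] and [- eta]
    persist for [y] near [y0]. When [b] holds only [0 <= s] is allowed, and the assumed sign at
    [s = 0] replaces the one at [- eta]. *)
Lemma near_zero (b : bool) (F : R -> V -> R) (y0 : V) (r : R) : 0 < r ->
  (forall s : R, `|s| < r -> {for y0, continuous (F s)}) ->
  (\forall y \near y0, forall s : R, `|s| < r -> {for s, continuous (F ^~ y)}) ->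
  (forall s : R, 0 < s < r -> F (- s) y0 < 0 < F s y0) ->
  forall d : R, 0 < d -> \forall y \near y0, (b -> F 0 y <= 0) ->
    exists s : R, [/\ `|s| < d, b -> 0 <= s & F s y = 0].
Proof.
move=> r0 cy cs sg d d0.
pose eta := Num.min d r / 2.
have m0 : 0 < Num.min d r by rewrite lt_min d0 r0.
have e0 : 0 < eta by rewrite divr_gt0.
have em : eta < Num.min d r by rewrite /eta; lra.
have [ed er] : eta < d /\ eta < r by move: em; rewrite lt_min => /andP.
have /andP[neg pos] : F (- eta) y0 < 0 < F eta y0 by apply: sg; rewrite e0.
have c1 : {for y0, continuous (F eta)} by apply: cy; rewrite gtr0_norm.
have c2 : {for y0, continuous (F (- eta))} by apply: cy; rewrite normrN gtr0_norm.
have n1 : \forall y \near y0, 0 < F eta y := c1 _ (near_gt pos).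
have n2 : \forall y \near y0, F (- eta) y < 0 := c2 _ (near_lt neg).
apply: filterS3 n1 n2 cs => y h1 h2 hc F0.
pose lo := if b then 0 else - eta.
have [lo1 lo2 Flo] : [/\ - eta <= lo, lo <= eta & F lo y <= 0].
  by rewrite /lo; case: (b) F0 => F0; split; rewrite ?F0 ?(ltW h2)//; lra.
have [c] : exists2 c, c \in `[lo, eta]%R & F c y = 0.
  apply: (@IVT R (F ^~ y) lo eta 0 lo2).
    apply: continuous_in_subspaceT => s; rewrite inE /= in_itv /= => /andP[s1 s2].
    by apply: hc; rewrite ltr_norml; lra.
  by rewrite ge_min le_max (ltW h1) Flo orbT.
rewrite in_itv /= => /andP[c1' c2'] Fc; exists c; split=> //.
  by rewrite ltr_norml; lra.
by move=> bT; move: c1'; rewrite /lo bT.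
Qed.

End Monotone.

(** * Graph charts at an end point of the curve *)

Section BoundaryChart.
Context {R : realType} {N m : nat}.
Variables (S : set 'rV[R]_N) (p : 'rV[R]_N) (U : set 'rV[R]_m.+1)
  (phi : 'rV[R]_m.+1 -> 'rV[R]_N) (a : 'rV[R]_m.+1) (L : 'M[R]_(N, m.+1))
  (psi : 'rV[R]_m.+1 -> 'rV[R]_m.+1) (e : 'rV[R]_m.+1) (i : 'I_N).
Hypothesis rS : rank_one m.+1 S.
Hypothesis Pa : param_at S p true U phi a.
Hypothesis a_bd : half_space_bd a.
Let Phi y := phi (psi y).
Let D y := model true (psi y).
(** A defining function in graph coordinates: the domain [D] is [0 <= rho], and [rho] vanishes on
    the boundary. *)
Let rho y : R := psi y 0 ord0.
Hypothesis spsi : smooth_at psi (p *m L).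
Hypothesis psia : psi (p *m L) = a.
Hypothesis nP : \forall y \near p *m L, model true (psi y) ->
  param_at S (phi (psi y)) true U phi (psi y).
Hypothesis gc : graph_chart S p L (fun y => phi (psi y)) (fun y => model true (psi y)).
Hypothesis h0 : hess Phi i e e (p *m L) != 0.
Hypothesis rho_e0 : 0 <= 'D_e rho (p *m L).

Let DE y : D y <-> 0 <= rho y.
Proof.
split=> [h|h]; first exact: h.
by move=> j j0; have -> : j = ord0 by apply: val_inj.
Qed.

Let bdE y : rho y = 0 -> half_space_bd (psi y).
Proof. by move=> h j j0; have -> : j = ord0 by apply: val_inj. Qed.

Let srho : smooth_at rho (p *m L). Proof. exact: smooth_coord. Qed.
Let sPhi : smooth_at Phi (p *m L) := gc_smooth gc.

Let rho0 : rho (p *m L) = 0. Proof. by rewrite /rho psia a_bd. Qed.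

(** At boundary points [rank_one] requires the leaf to stay in [S] in all its directions. So [rho],
    which vanishes at [y], is nonnegative to first order along both [v] and [- v]. *)
Lemma boundary_kernel : \forall y \near p *m L, rho y = 0 ->
  forall v, (forall w, 'D_v ('D_w Phi) y = 0) -> 'D_v rho y = 0.
Proof.
have nS := smooth_near sPhi; have nR := smooth_near srho; have nL := near_join (gc_linear gc).
have nO := gc_out gc; have nI := near_join (gc_in gc); rewrite -(gc_base gc) in nI.
have {}nI := smooth_cont_near sPhi nI.
near=> y => ry v Kv.
have sy : smooth_at Phi y by exact: (near nS y).
have sr : smooth_at rho y by exact: (near nR y).
have Ly : \forall z \near y, Phi z *m L = z by exact: (near nL y).
have Dy : D y by apply/DE; rewrite ry.
have [Sy tE nE _] : [/\ S (Phi y),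
        forall x, tangent m.+1 S (Phi y) x <-> exists v, x = v *m jacobian Phi y,
        forall v, nullity m.+1 S (Phi y) (v *m jacobian Phi y) <-> forall w, 'D_v ('D_w Phi) y = 0 &
        forall v w, sff m.+1 S (Phi y) (v *m jacobian Phi y) (w *m jacobian Phi y) = 0 <->
          'D_v ('D_w Phi) y = 0].
  by move: Dy; exact: (near nO y).
have Py : param_at S (Phi y) true U phi (psi y) by move: Dy; exact: (near nP y).
have Iy : \forall q \near Phi y, S q -> D (q *m L) /\ Phi (q *m L) = q by exact: (near nI y).
have JL := jacobian_linear sy Ly.
have bS : boundary m.+1 S (Phi y).
  by exists U, phi, (psi y); split=> //; exact: bdE.
have [_ _ /(_ _ bS) leafS] := rS.
have pos u : (forall w, 'D_u ('D_w Phi) y = 0) -> 0 <= 'D_u rho y.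
  move=> Ku; apply: derive_ge0_side; first exact: smooth_diff.
  pose x := u *m jacobian Phi y.
  have l1 := near_line x leafS; have l2 := near_line x Iy.
  apply: filterS2 l1 l2 => s; rewrite add0r => H1 H2.
  have nul : nullity m.+1 S (Phi y) (s *: x).
    rewrite /x scalemxAl; apply/nE => w.
    by apply: (etrans (derive_dirZ s u (smooth_diff (smooth_derive w sy)))); rewrite Ku scaler0.
  have [Ds _] := H2 (H1 nul).
  have E : (Phi y + s *: x) *m L = y + s *: u.
    by rewrite mulmxDl (nbhs_singleton Ly) /x -scalemxAl -mulmxA JL mulmx1.
  by rewrite E in Ds; rewrite ry; exact: ((DE _).1 Ds).
apply/eqP; rewrite eq_le pos// andbT -oppr_ge0.
have <- : 'D_(- v) rho y = - 'D_v rho y := derive_dirN v (smooth_diff sr).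
apply: pos => w; apply: (etrans (derive_dirN v (smooth_diff (smooth_derive w sy)))).
by rewrite Kv oppr0.
Unshelve. all: by end_near. Qed.

Let rank_dim q : S q -> has_dim (nullity m.+1 S q) m.
Proof. by case: rS => _ h _; exact: h. Qed.

Let nhess : \forall y \near p *m L, hess Phi i e e y != 0.
Proof. exact: (smooth_cont_near (smooth_hess i e e sPhi) (open_nbhs_nbhs (conj (@open_neq _ (0:R)) h0))). Qed.

(** By [boundary_kernel] the differential of [rho] vanishes on the kernel of [ell], so it is a
    multiple of [ell]; the value at [e], where [ell] is [1], gives the factor. *)
Lemma boundary_derive : \forall y \near p *m L, rho y = 0 ->
  forall v, 'D_v rho y = ell Phi e i y v * 'D_e rho y.
Proof.
have nS := smooth_near sPhi; have nR := smooth_near srho.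
have nK := boundary_kernel; have nC := chart_kernel_cond e i gc rank_dim.
near=> y => ry v.
have sy : smooth_at Phi y by exact: (near nS y).
have sr : smooth_at rho y by exact: (near nR y).
have hy : hess Phi i e e y != 0 by exact: (near nhess y).
have Dy : D y by apply/DE; rewrite ry.
have Cy : kernel_cond Phi e i y by move: hy Dy; exact: (near nC y).
have Ky : forall v, (forall w, 'D_v ('D_w Phi) y = 0) -> 'D_v rho y = 0.
  by move: ry; exact: (near nK y).
have lz : ell Phi e i y (v - ell Phi e i y v *: e) = 0.
  by rewrite (ellB _ _ _ _ sy) (ellZ _ _ _ _ sy) (ell_e hy) mulr1 subrr.
have h1 := Ky _ (Cy _ lz).
have h2 := derive_dirB v (ell Phi e i y v *: e) (smooth_diff sr).
have h3 := derive_dirZ (ell Phi e i y v) e (smooth_diff sr); rewrite h3 in h2.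
exact: (subr0_eq (etrans (esym h2) h1)).
Unshelve. all: by end_near. Qed.

(** If it were zero, the differential of [rho] at the base point would vanish altogether by
    [boundary_derive]; but [rho] is a coordinate of the local diffeomorphism [psi]. *)
Lemma rho_e_gt0 : 0 < 'D_e rho (p *m L).
Proof.
rewrite lt_neqAle rho_e0 andbT eq_sym; apply/eqP => r0.
have JL := jacobian_linear sPhi (gc_linear gc).
have sphi : smooth_at phi (psi (p *m L)) by rewrite psia; exact: (param_smooth Pa).
have JE : jacobian Phi (p *m L) = jacobian psi (p *m L) *m jacobian phi (psi (p *m L)).
  apply: jacobian_eq => [|v]; first exact: smooth_diff.
  have e1 := derive_comp v (smooth_diff spsi) (smooth_diff sphi).
  apply: (etrans e1).
  by rewrite !deriveEjacobian ?mulmxA//; exact: smooth_diff.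
rewrite JE -mulmxA in JL; have {JL} := mulmx1C JL.
set K := jacobian phi _ *m L => KJ.
pose v := delta_mx 0 ord0 *m K : 'rV[R]_m.+1.
have e1 : 'D_v psi (p *m L) = delta_mx 0 ord0.
  by apply: (etrans (deriveEjacobian v (smooth_diff spsi))); rewrite /v -mulmxA KJ mulmx1.
have e2 : 'D_v rho (p *m L) = 1.
  apply: (etrans (esym (derive_entry v 0 ord0 (smooth_diff spsi)))).
  by rewrite e1 mxE !eqxx.
have := nbhs_singleton boundary_derive rho0 v; rewrite r0 mulr0 e2 => /eqP.
by rewrite oner_eq0.
Qed.

Lemma boundary_inward : \forall y \near p *m L, D y -> \forall s \near (0 : R)^'+, D (y + s *: e).
Proof.
have [r r_gt0 B] := local_monotone srho rho_e_gt0.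
have n1 : \forall y \near p *m L, `|y - p *m L| < r.
  by apply/(near0P _ (fun y => `|y - p *m L| < r)); exists r.
apply: filterS2 n1 (near_join n1) => y hy ny Dy.
near=> s; apply/DE; apply: ltW; apply: le_lt_trans ((DE _).1 Dy) _.
apply: B => //; near: s.
exact: (near_line e ny).
Unshelve. all: by end_near. Qed.

Lemma boundary_good_point : \forall y \near p *m L, D y -> good_point Phi e i y.
Proof.
apply: (near_good_point sPhi h0 _ boundary_inward).
by apply: filterS2 nhess (chart_kernel_cond e i gc rank_dim) => y hy; exact.
Qed.

Let f z := phi z *m L.

Lemma chart_roundtrip : \forall z \near a, half_space_bd z -> psi (f z) = z.
Proof.
have [[oU _ _ [h [hK _ _]] _] [Ua _] pa] := Pa.
have sphi := param_smooth Pa.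
have sf : smooth_at f a by apply: smooth_mulmx => //; exact: smooth_cst.
have fa : f a = p *m L by rewrite /f pa.
have nU : \forall x \near a, U x by exact: open_nbhs_nbhs.
have nUp : \forall y \near p *m L, U (psi y).
  by apply: (smooth_cont_near spsi); rewrite psia.
rewrite -fa in nUp; have nU' := smooth_cont_near sf nUp.
have nI : \forall q \near phi a, S q -> D (q *m L) /\ Phi (q *m L) = q.
  by rewrite pa; exact: (gc_in gc).
have {}nI := smooth_cont_near sphi nI.
near=> z => bz.
have Uz : U z by exact: (near nU z).
have mz : model true z by move=> j j0; rewrite (bz j j0).
have Sz : S (phi z) by exact: (param_mem (param_sub Pa (conj Uz mz))).
have [Df Pf] : D (f z) /\ Phi (f z) = phi z by move: Sz; exact: (near nI z).
have Upf : U (psi (f z)) by exact: (near nU' z).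
by rewrite -[RHS]hK// -Pf hK.
Unshelve. all: by end_near. Qed.

(* Along a segment of the boundary hyperplane of the parametrization, [ell] kills the
   velocity and is therefore constant. *)
Lemma boundary_hyperplane : \forall y \near p *m L, rho y = 0 -> ell Phi e i (p *m L) (y - p *m L) = 0.
Proof.
have sphi := param_smooth Pa; have [_ _ pa] := Pa.
have fa : f a = p *m L by rewrite /f pa.
have sf : smooth_at f a by apply: smooth_mulmx => //; exact: smooth_cst.
have nf (Q : 'rV[R]_m.+1 -> Prop) : (\forall y \near p *m L, Q y) -> \forall z \near a, Q (f z).
  by rewrite -fa; exact: (smooth_cont_near sf).
have ne : \forall y \near p *m L, 0 < 'D_e rho y.
  exact: (smooth_cont_near (smooth_derive e srho) (near_gt rho_e_gt0)).
have n0 := chart_roundtrip; have n1 := nf _ boundary_good_point; have n2 := nf _ boundary_derive.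
have n3 := nf _ ne; have n4 := smooth_near sf; have n5 := nf _ (smooth_near srho).
pose Q z := [/\ half_space_bd z -> psi (f z) = z, D (f z) -> good_point Phi e i (f z),
  rho (f z) = 0 -> forall v, 'D_v rho (f z) = ell Phi e i (f z) v * 'D_e rho (f z),
  0 < 'D_e rho (f z) & smooth_at f z /\ smooth_at rho (f z)].
have nQ : \forall z \near a, Q z.
  near=> z; split; [exact: (near n0 z)|exact: (near n1 z)|exact: (near n2 z)|exact: (near n3 z)|].
  by split; [exact: (near n4 z)|exact: (near n5 z)].
have [r r0 B] := (near0P a Q).1 nQ.
have nb : \forall y \near p *m L, `|psi y - a| < r.
  apply: (@smooth_cont_near _ _ _ psi _ (fun z => `|z - a| < r) spsi); rewrite psia.
  by apply/(near0P a (fun z => `|z - a| < r)); exists r.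
apply: filterS2 nb (gc_linear gc) => y hb fy ry.
set w := psi y - a in hb *.
have wz : w 0 ord0 = 0 by rewrite !mxE; move: ry; rewrite /rho => ->; rewrite a_bd// subrr.
have bdz (s : R) : half_space_bd (a + s *: w).
  move=> j j0; have -> : j = ord0 by apply: val_inj.
  by rewrite mxE a_bd// add0r mxE wz mulr0.
have ball (s : R) : 0 <= s <= 1 -> `|a + s *: w - a| < r.
  move=> s01; apply: segment_lt => //; first by rewrite subrr normr0.
  by rewrite addrAC subrr add0r.
have rz (s : R) : `|a + s *: w - a| < r -> rho (f (a + s *: w)) = 0.
  by move=> h; have [E _ _ _ _] := B _ h; rewrite /rho E//; exact: bdz.
have gp (s : R) : 0 <= s <= 1 -> good_point Phi e i (f (a + s *: w)).
  move=> s01; have [_ gp _ _ _] := B _ (ball s s01); apply: gp; apply/DE.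
  by rewrite rz// ball.
have vel (s : R) : 0 <= s <= 1 -> ell Phi e i (f (a + s *: w)) ('D_w f (a + s *: w)) = 0.
  move=> s01; have hb' := ball s s01; have [_ _ bd pos [sfz srz]] := B _ hb'.
  have e1 := derive_comp w (smooth_diff sfz) (smooth_diff srz).
  have e2 : 'D_w (rho \o f) (a + s *: w) = 0.
    have sc : smooth_at (rho \o f) (a + s *: w) := smooth_comp_rV sfz srz.
    have nb' : \forall z \near (a + s *: w), `|z - a| < r.
      apply/(near0P _ (fun z => `|z - a| < r)); exists (r - `|a + s *: w - a|); first by rewrite subr_gt0.
      move=> z hz; rewrite -(subrK (a + s *: w) z) -addrA.
      by apply: le_lt_trans (ler_normD _ _) _; rewrite -ltrBrDr.
    apply: (derive_eq0_side (smooth_diff sc)).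
    apply: filterS (near_line w nb') => h hh.
    rewrite /comp (rz s hb') -addrA -scalerDl; apply: rz.
    by rewrite scalerDl addrA.
  have e3 := bd (rz s hb') ('D_w f (a + s *: w)).
  have e4 : ell Phi e i (f (a + s *: w)) ('D_w f (a + s *: w)) * 'D_e rho (f (a + s *: w)) = 0.
    exact: (etrans (esym e3) (etrans (esym e1) e2)).
  by apply/eqP; move/eqP: e4; rewrite mulf_eq0 (gt_eqF pos) orbF.
have lam u (s : R) : 0 <= s <= 1 -> ell Phi e i (f (a + s *: w)) u = ell Phi e i (p *m L) u.
  move=> s01.
  have := @const_of_derive0 R (fun s => ell Phi e i (f (a + s *: w)) u) _ s s01.
  rewrite scale0r addr0 fa; apply=> t t01.
  have [sP hz _ T] := gp t t01; have [_ _ _ _ [sfz _]] := B _ (ball t t01).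
  have sl := smooth_ell u sP hz.
  have scl : smooth_at (fun z => ell Phi e i (f z) u) (a + t *: w) := smooth_comp_rV sfz sl.
  have := is_derive_line scl.
  have -> : 'D_w (fun z => ell Phi e i (f z) u) (a + t *: w) = 0; last by [].
  apply: (etrans (derive_comp w (smooth_diff sfz) (smooth_diff sl))).
  by have := T u ('D_w f (a + t *: w)); rewrite (vel t t01) scale0r subr0.
(* Along the image of the segment [ell] is the one at [p *m L]. This fixed linear form kills the
   velocity, hence also the difference of the end points. *)
have [Mx MxE] := ell_mx e i sPhi.
pose G z := ((f z - p *m L) *m Mx) 0 0.
have cG := @const_of_derive0 R (fun s => G (a + s *: w)) _ 1.
rewrite /G scale1r scale0r addr0 fa subrr mul0mx [RHS]mxE in cG.
rewrite MxE -[in LHS]fy -/(f _).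
have -> : psi y = a + w by rewrite /w addrCA subrr addr0.
apply: cG; last by rewrite lexx ler01.
move=> t t01; have [_ _ _ _ [sfz _]] := B _ (ball t t01).
have sd : smooth_at (fun z => f z - p *m L) (a + t *: w) by apply: smoothB => //; exact: smooth_cst.
have sM : smooth_at (fun z => (f z - p *m L) *m Mx) (a + t *: w).
  by apply: smooth_mulmx => //; exact: smooth_cst.
have sG : smooth_at G (a + t *: w) := smooth_coord 0 0 sM.
have := is_derive_line sG.
have -> : 'D_w G (a + t *: w) = 0; last by [].
apply: (etrans (esym (derive_entry w 0 0 (smooth_diff sM)))).
rewrite (derive_mulmxr Mx w (smooth_diff sd)).
have -> : 'D_w (fun z => f z - p *m L) (a + t *: w) = 'D_w f (a + t *: w).
  have d2 : derivable (cst (p *m L) : _ -> 'rV[R]_m.+1) (a + t *: w) w by exact: derivable_cst.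
  apply: (etrans (deriveB (smooth_derivable sfz) d2)).
  by rewrite derive_cst subr0.
by rewrite -MxE -(lam _ t t01) vel.
Unshelve. all: by end_near. Qed.

(** From [y] move along [e] to a zero [y + s *: e] of [rho]. There [boundary_hyperplane] applies,
    whence [ell (y - y0) = - s]. As [rho] increases along [e], both sides of the equivalence amount
    to [s <= 0]. *)
Lemma half_space_chart : \forall y \near p *m L, D y <-> 0 <= ell Phi e i (p *m L) (y - p *m L).
Proof.
set y0 := p *m L.
have [r1 r1_gt0 mono] := local_monotone srho rho_e_gt0.
have [r2 r2_gt0 hyp] := (near0P y0 (fun y => rho y = 0 -> ell Phi e i y0 (y - y0) = 0)).1
  boundary_hyperplane.
have [r3 r3_gt0 smo] := (near0P y0 (fun y => smooth_at rho y)).1 (smooth_near srho).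
have e_ge0 : 0 <= `|e| by [].
pose r := Num.min r1 (Num.min r2 r3).
have r_gt0 : 0 < r by rewrite !lt_min r1_gt0 r2_gt0 r3_gt0.
pose d := r / 2 / (1 + `|e|).
have d_gt0 : 0 < d by rewrite !divr_gt0// ltr_pwDl.
have dE : d * (1 + `|e|) = r / 2 by rewrite divfK// lt0r_neq0// ltr_pwDl.
have se (s : R) : `|s| < d -> `|s *: e| < r / 2.
  move=> sd; rewrite normrZ -dE; apply: le_lt_trans (_ : `|s| * (1 + `|e|) < _).
    by rewrite ler_wpM2l// lerDr.
  by rewrite ltr_pM2r// ltr_pwDl.
have near_ball y (s : R) : `|y - y0| < r / 2 -> `|s| < d -> `|y + s *: e - y0| < r.
  move=> hy /se hs; rewrite addrAC; apply: le_lt_trans (ler_normD _ _) _; lra.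
have in123 y : `|y - y0| < r -> [/\ `|y - y0| < r1, `|y - y0| < r2 & `|y - y0| < r3].
  by rewrite !lt_min => /andP[-> /andP[-> ->]].
have y00 : `|y0 - y0| < r / 2 by rewrite subrr normr0 divr_gt0.
have half y : `|y - y0| < r / 2 -> `|y - y0| < r by lra.
have mono' y (s : R) : `|y - y0| < r -> 0 < s -> `|y + s *: e - y0| < r -> rho y < rho (y + s *: e).
  by move=> /in123[h1 _ _] s0 /in123[h2 _ _]; exact: mono.
have n1 : \forall y \near y0, `|y - y0| < r / 2.
  by apply/(near0P _ (fun y => `|y - y0| < r / 2)); exists (r / 2) => //; rewrite divr_gt0.
have n2 : \forall y \near y0, (false -> rho (y + 0 *: e) <= 0) ->
    exists s : R, [/\ `|s| < d, false -> 0 <= s & rho (y + s *: e) = 0].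
  apply: (@near_zero _ _ false (fun s y => rho (y + s *: e)) y0 d d_gt0) => //.
  - move=> s sd; have [_ _ /smo sr] := in123 _ (near_ball _ _ y00 sd).
    apply: smooth_cont; apply: smooth_comp_rV => //.
    by apply: smoothD; [exact: smooth_id|exact: smooth_cst].
  - apply: filterS n1 => y hy s sd; have [_ _ /smo sr] := in123 _ (near_ball _ _ hy sd).
    apply: smooth_cont; apply: smooth_comp_rV => //.
    apply: smoothD; first exact: smooth_cst.
    by apply: smoothZ; [exact: smooth_id|exact: smooth_cst].
  - move=> s /andP[s0 sd]; have sd' : `|s| < d by rewrite gtr0_norm.
    have nsd : `|- s| < d by rewrite normrN.
    have b1 := near_ball _ _ y00 sd'; have b2 := near_ball _ _ y00 nsd.
    have m1 := mono' _ _ (half _ y00) s0 b1; rewrite rho0 in m1.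
    have E : y0 + - s *: e + s *: e = y0 by rewrite -addrA -scalerDl addNr scale0r addr0.
    have m2 := mono' _ _ b2 s0; rewrite E rho0 in m2.
    by rewrite m1 m2//; exact: half.
apply: filterS2 n1 n2 => y hy [//|s [sd _ rs]].
have hb := near_ball _ _ hy sd; have [_ h2 _] := in123 _ hb.
have := hyp _ h2 rs; rewrite addrAC (ellD _ _ _ _ sPhi) (ellZ _ _ _ _ sPhi) (ell_e h0) mulr1.
move=> /eqP; rewrite addr_eq0 => /eqP ->; rewrite oppr_ge0; split=> [/(DE _).1|] h.
  rewrite leNgt; apply/negP => s0.
  by have := mono' _ _ (half _ hy) s0 hb; rewrite rs ltNge h.
apply/DE; move: h; rewrite le_eqVlt => /orP[/eqP s0|s0].
  by move: rs; rewrite s0 scale0r addr0 => ->.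
have E : y + s *: e + - s *: e = y by rewrite -addrA -scalerDl subrr scale0r addr0.
have := mono' _ (- s) hb; rewrite E rs oppr_gt0 => m1.
by apply: ltW; apply: m1 => //; exact: half.
Qed.

End BoundaryChart.

Lemma affine_zero (R : realType) (x y : R) : 0 <= x -> y < 0 ->
  exists2 s : R, 0 <= s <= 1 & x + s * (y - x) = 0.
Proof.
move=> x0 y0; have d0 : 0 < x - y by lra.
exists (x / (x - y)); first by rewrite divr_ge0 ?(ltW d0)//= ler_pdivrMr// mul1r; lra.
by have := lt0r_neq0 d0 => dn; field.
Qed.

(** * The local ruling by straight leaves, and its intersection with the curve *)

Section LocalRuling.
Context {R : realType} {N m : nat}.
Variables (Phi : 'rV[R]_m.+1 -> 'rV[R]_N) (D : set 'rV[R]_m.+1) (e : 'rV[R]_m.+1) (i : 'I_N)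
  (y0 : 'rV[R]_m.+1) (b : bool) (c : R -> 'rV[R]_m.+1).
Hypothesis sPhi : smooth_at Phi y0.
Hypothesis h0 : hess Phi i e e y0 != 0.
Hypothesis nG : \forall y \near y0, D y -> good_point Phi e i y.
Hypothesis nD : \forall y \near y0, D y <-> (b -> 0 <= ell Phi e i y0 (y - y0)).
Hypothesis sc : smooth_at c 0.
Hypothesis c0 : c 0 = y0.
Hypothesis dc : 'D_1 c 0 = e.

Local Notation l := (ell Phi e i y0).

Let lB x y : l (x - y) = l x - l y := ellB e i x y sPhi.
Let lD x y : l (x + y) = l x + l y := ellD e i x y sPhi.
Let lZ k x : l (k *: x) = k * l x := ellZ e i k x sPhi.

(** If both ends lie in [D], so does the segment, [D] being near [y0] a half-space or everything;
    then [leaf_line] applies. If [y] were outside [D], the segment would cross the bounding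
    hyperplane at a point [z] of [D] on the leaf of [y0] as well as on that of [x]. Then [ell] at
    [x] and at [y0] coincide, [y - y0] and [x - y0] have the same value under it, and [y] would be
    in [D]. *)
Lemma leaf_closed : exists2 r : R, 0 < r & forall x y, `|x - y0| < r -> `|y - y0| < r ->
  D x -> ell Phi e i x (y - x) = 0 ->
  [/\ D y, forall u, ell Phi e i y u = ell Phi e i x u & Phi y = Phi x + 'D_(y - x) Phi x].
Proof.
have [r r0 B] := (near0P y0 (fun y => (D y -> good_point Phi e i y) /\
  (D y <-> (b -> 0 <= l (y - y0))))).1 (filterI nG nD).
have y0r : `|y0 - y0| < r by rewrite subrr normr0.
have D0 : D y0 by apply/(B _ y0r).2; rewrite subrr (ell0 _ _ sPhi).
have conv x y : `|x - y0| < r -> `|y - y0| < r -> D x -> D y ->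
    ell Phi e i x (y - x) = 0 ->
    (forall u, ell Phi e i y u = ell Phi e i x u) /\ Phi y = Phi x + 'D_(y - x) Phi x.
  move=> hx hy Dx Dy E.
  have yE : x + (y - x) = y by rewrite addrCA subrr addr0.
  have hy' : `|x + (y - x) - y0| < r by rewrite yE.
  have := @leaf_line R N m.+1 Phi e i x (y - x) _ E; rewrite yE; apply=> s s01.
  have hs := segment_lt hx hy' s01; apply: (B _ hs).1; apply/(B _ hs).2 => bT.
  have lx := (B _ hx).2.1 Dx bT; have ly := (B _ hy).2.1 Dy bT.
  rewrite segment_affine yE.
  rewrite lD !lZ; move: s01 => /andP[s0 s1]; have s1' : 0 <= 1 - s by rewrite subr_ge0.
  exact: (addr_ge0 (mulr_ge0 s1' lx) (mulr_ge0 s0 ly)).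
exists r; first exact: r0.
move=> x y hx hy Dx E.
suff Dy : D y by have [h1 h2] := conv _ _ hx hy Dx Dy E; split; [exact: Dy|exact: h1|exact: h2].
apply/(B _ hy).2 => bT; rewrite leNgt; apply/negP => ly.
have lx := (B _ hx).2.1 Dx bT.
have [th th01 thE] := affine_zero lx ly.
pose z := x + th *: (y - x).
have yE : x + (y - x) = y by rewrite addrCA subrr addr0.
have hy' : `|x + (y - x) - y0| < r by rewrite yE.
have hz : `|z - y0| < r := segment_lt hx hy' th01.
have lz : l (z - y0) = 0.
  have -> : z - y0 = (x - y0) + th *: ((y - y0) - (x - y0)).
    by rewrite /z addrAC; congr (_ + _ *: _); rewrite opprB addrA subrK.
  by rewrite lD lZ (lB (y - y0) (x - y0)); exact: thE.
have Dz : D z by apply/(B _ hz).2 => _; rewrite lz lexx.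
have ez : ell Phi e i x (z - x) = 0.
  rewrite /z addrAC subrr add0r.
  have [sx _ _ _] := (B _ hx).1 Dx.
  by have := ellZ e i th (y - x) sx; rewrite E mulr0.
have E1 := (conv _ _ y0r hz D0 Dz lz).1.
have E2 := (conv _ _ hx hz Dx Dz ez).1.
have E3 : l (y - x) = 0 := etrans (esym (E1 _)) (etrans (E2 _) E).
have E4 : l (y - y0) = l (x - y0).
  have -> : y - y0 = (y - x) + (x - y0) by rewrite addrA subrK.
  by rewrite lD E3 add0r.
by move: ly; rewrite E4 ltNge lx.
Qed.

(** This is [ell y (c s - y)] by [ell_sum], expanded in coordinates so that its regularity in [y]
    and in [s] is apparent. *)
Let G (s : R) y := \sum_k (c s - y) 0 k * ell Phi e i y (delta_mx 0 k).

Let smooth_G (s : R) : smooth_at (G s) y0.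
Proof.
apply: smooth_sum => k _; apply: smoothM; last exact: smooth_ell.
by apply: smooth_coord; apply: smoothB; [exact: smooth_cst|exact: smooth_id].
Qed.

Let curve_transversal : exists2 r : R, 0 < r &
  (forall s, `|s| < r -> smooth_at c s) /\
  forall s, 0 < s < r -> l (c (- s) - y0) < 0 < l (c s - y0).
Proof.
have [Mx MxE] := ell_mx e i sPhi.
pose h (s : R) : R := ((c s - y0) *m Mx) 0 0.
have sd : smooth_at (fun s => c s - y0) 0 by apply: smoothB => //; exact: smooth_cst.
have sM : smooth_at (fun s => (c s - y0) *m Mx) 0.
  by apply: smooth_mulmx => //; exact: smooth_cst.
have sh : smooth_at h 0 := smooth_coord 0 0 sM.
have h1 : 'D_1 h 0 = 1.
  have e1 := derive_entry (1 : R) 0 0 (smooth_diff sM).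
  apply: (etrans (esym e1)).
  rewrite (derive_mulmxr Mx (1 : R) (smooth_diff sd)).
  have -> : 'D_1 (fun s => c s - y0) 0 = e.
    have d2 : derivable (cst y0 : R -> 'rV[R]_m.+1) 0 1 by exact: derivable_cst.
    apply: (etrans (deriveB (smooth_derivable sc) d2)).
    by rewrite derive_cst subr0.
  by rewrite -MxE (ell_e h0).
have h1' : 0 < 'D_1 h 0 by rewrite h1.
have h00 : h 0 = 0 by rewrite /h c0 subrr mul0mx mxE.
have [r1 r1_gt0 mono] := local_monotone sh h1'.
have [r2 r2_gt0 smo] := (near0P (0 : R) (fun s => smooth_at c s)).1 (smooth_near sc).
exists (Num.min r1 r2); first by rewrite lt_min r1_gt0.
split=> [s|s]; first by rewrite lt_min => /andP[_ hs]; apply: smo; rewrite subr0.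
rewrite lt_min => /andP[s0 /andP[sr _]].
rewrite !MxE -!/(h _).
have m1 := mono 0 s; have m2 := mono (- s) s.
rewrite subrr normr0 add0r subr0 /GRing.scale /= mulr1 gtr0_norm// h00 in m1.
rewrite subr0 normrN /GRing.scale /= mulr1 addNr subrr normr0 gtr0_norm// h00 in m2.
by rewrite m1// m2.
Qed.

(** The leaf of [y] meets the curve at [c s] when [ell y (c s - y) = 0]. At [y = y0] this function
    of [s] changes sign at [0], since the velocity [e] is transversal to the leaf, and [near_zero]
    applies. *)
Lemma meets_curve (d : R) : 0 < d -> \forall y \near y0, D y ->
  exists s : R, [/\ `|s| < d, b -> 0 <= s & ell Phi e i y (c s - y) = 0].
Proof.
move=> d0; have [r r0 [scr sgr]] := curve_transversal.
have [r1 r1_gt0 cl] := leaf_closed.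
have [r2 r2_gt0 nD2] := (near0P y0 (fun y => D y <-> (b -> 0 <= l (y - y0)))).1 nD.
have nS := smooth_near sPhi.
have GE s y : smooth_at Phi y -> G s y = ell Phi e i y (c s - y).
  by move=> sy; rewrite (ell_sum _ _ _ sy).
have n1 : \forall y \near y0, (b -> G 0 y <= 0) -> exists s : R, [/\ `|s| < d, b -> 0 <= s & G s y = 0].
  apply: (@near_zero R _ b G y0 r r0 _ _ _ d d0).
  - by move=> s sr; apply: smooth_cont; exact: smooth_G.
  - near=> y => s sr; apply: smooth_cont; apply: smooth_sum => k _.
    apply: smoothM; last exact: smooth_cst.
    by apply: smooth_coord; apply: smoothB; [exact: scr|exact: smooth_cst].
  - by move=> s sr; rewrite !GE//; exact: sgr.
have G00 : G 0 y0 = 0 by rewrite GE// c0 subrr (ell0 _ _ sPhi).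
pose r3 := Num.min r1 r2; have r3_gt0 : 0 < r3 by rewrite lt_min r1_gt0.
pose k0 := r3 / (1 + `|e|).
have e1 : 0 < 1 + `|e| by rewrite ltr_pwDl.
have k0_gt0 : 0 < k0 by rewrite divr_gt0.
have n2 : \forall y \near y0, `|G 0 y0 - G 0 y| < k0 := cont_dist (smooth_cont (smooth_G 0)) k0_gt0.
have n3 : \forall y \near y0, `|y - y0| < r1.
  by apply/(near0P y0 (fun y => `|y - y0| < r1)); exists r1.
near=> y => Dy.
have sy : smooth_at Phi y by exact: (near nS y).
have hy : `|y - y0| < r1 by exact: (near n3 y).
have gy : D y -> good_point Phi e i y by exact: (near nG y).
have [_ hhy _ _] := gy Dy.
have Gk : `|G 0 y0 - G 0 y| < k0 by exact: (near n2 y).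
have ex : (b -> G 0 y <= 0) -> exists s : R, [/\ `|s| < d, b -> 0 <= s & G s y = 0].
  exact: (near n1 y).
have [|s [s1 s2 s3]] := ex; last by exists s; split=> //; rewrite -GE.
move=> bT; rewrite leNgt; apply/negP => kpos; set k := G 0 y in kpos Gk.
(* For an end point, suppose the required sign at [s = 0] fails. Then [z] satisfies
   [ell y (z - y) = 0], so [leaf_closed] puts it in [D], although its value under [ell] at [y0],
   relative to [y0], is [- k < 0]. *)
pose z := y0 - k *: e.
have zn : `|z - y0| < r3.
  rewrite /z addrAC subrr add0r normrN normrZ gtr0_norm//.
  move: Gk; rewrite G00 sub0r normrN gtr0_norm// => Gk.
  apply: le_lt_trans (_ : k * (1 + `|e|) < _); first by rewrite ler_wpM2l ?lerDr// ltW.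
  by rewrite -ltr_pdivlMr.
have [zr1 zr2] : `|z - y0| < r1 /\ `|z - y0| < r2 by move: zn; rewrite lt_min => /andP.
have ez : ell Phi e i y (z - y) = 0.
  have -> : z - y = (c 0 - y) - k *: e by rewrite /z c0 addrAC.
  by rewrite (ellB _ _ _ _ sy) (ellZ _ _ _ _ sy) (ell_e hhy) mulr1 -GE// subrr.
have [Dz _ _] := cl _ _ hy zr1 Dy ez.
have := (nD2 _ zr2).1 Dz bT.
rewrite /z addrAC subrr add0r -scaleNr lZ (ell_e h0) mulr1 oppr_ge0.
by rewrite leNgt kpos.
Unshelve. all: by end_near. Qed.

End LocalRuling.

Lemma normD_half (R : realType) (V : normedModType R) (a b : V) (r : R) :
  `|a| < r / 2 -> `|b| < r / 2 -> `|a + b| < r.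
Proof. by move=> h1 h2; apply: le_lt_trans (ler_normD _ _) _; lra. Qed.

Lemma ball_near (R : realType) (V : normedModType R) (x : V) (r : R) : 0 < r ->
  \forall y \near x, `|y - x| < r.
Proof. by move=> r0; apply/(near0P x (fun y => `|y - x| < r)); exists r. Qed.

(** * Local uniqueness *)

Section Uniqueness.
Context {R : realType} {N m : nat}.
Variables (I : set R) (g : R -> 'rV[R]_N) (P : R -> 'M[R]_N) (S : set 'rV[R]_N).
Hypothesis td : tube_data (m := m) I g P.
Hypothesis rS : rank_one m.+1 S.
Hypothesis gS : forall t, I t -> S (g t).
Hypothesis PE : forall t, I t -> P t = tproj (tangent m.+1 S (g t)).
Hypothesis bdS : forall t, I t -> boundary m.+1 S (g t) <-> ~ I° t.

Let sS : submanifold m.+1 S. Proof. by case: rS. Qed.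
Let dimS q : S q -> has_dim (nullity m.+1 S q) m. Proof. by case: rS => _ h _; exact: h. Qed.

Let sffE t y (It : I t) :=
  @curve_sff _ _ _ _ _ _ sS (td_int td) (td_ne td) (td_sg td) gS P (td_sP td) PE t y It.

(** A nullity vector of [S] is in particular paired to zero with the velocity, by symmetry in either
    order, and so belongs to the leaf; the dimensions agree. *)
Lemma nullity_leaf t : I t -> nullity m.+1 S (g t) = leaf g P t.
Proof.
move=> It; have [B sB] := (has_dim_spans _ _).1 (dimS (gS It)); have [F sF] := leaf_spans td It.
apply: (spans_eq sB sF) => x [tx nx].
have xP := (curve_tangent sS gS PE x It).1 tx.
have vP := td_vel td It; have tv := (curve_tangent sS gS PE _ It).2 vP.
have [b [U [phi [a Pa]]]] := sS (gS It).
have E := nx _ tv; rewrite (sff_sym Pa tx tv) (sffE It xP) in E.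
by apply/(leafP td It); split=> //; rewrite (tube_shape xP).
Qed.

Lemma derive_curve_chart t0 (tau : R) d (L : 'M[R]_(N, d)) : I t0 ->
  'D_1 (fun s : R => g (t0 + s *: tau) *m L) 0 = tau *: (derive1 g t0 *m L).
Proof.
move=> It; have sg := tube_sg td It.
have sgL : smooth_at (fun t => g t *m L) t0 by apply: smooth_mulmx => //; exact: smooth_cst.
have dgL : differentiable (fun t => g t *m L) (t0 + (0 : R) *: tau).
  by rewrite scale0r addr0; exact: smooth_diff.
have [_ E] := derive_line dgL; apply: (etrans E); rewrite scale0r addr0.
rewrite -[X in 'D_X _ _]mulr1.
apply: (etrans (derive_dirZ tau (1 : R) (smooth_diff sgL))).
by rewrite (derive_mulmxr L (1 : R) (smooth_diff sg)) derive1E.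
Qed.

Lemma smooth_curve_chart t0 (tau : R) d (L : 'M[R]_(N, d)) : I t0 ->
  smooth_at (fun s : R => g (t0 + s *: tau) *m L) 0.
Proof.
move=> It; have sg := tube_sg td It.
apply: smooth_mulmx; last exact: smooth_cst.
apply: smooth_comp_R; last by rewrite scale0r addr0.
apply: smoothD; first exact: smooth_cst.
by apply: smoothM; [exact: smooth_id|exact: smooth_cst].
Qed.

Section AtPoint.
Variable t0 : R.
Hypothesis It0 : I t0.
Let p := g t0.

(** The second fundamental form of [S] on the velocity is the one computed from [P], hence nonzero;
    so some component of the second derivative of [Phi] along the curve is nonzero. *)
Lemma curve_hess L (Phi : 'rV[R]_m.+1 -> 'rV[R]_N) D (tau : R) : tau * tau = 1 ->
  graph_chart S p L Phi D ->
  exists i, hess Phi i (tau *: (derive1 g t0 *m L)) (tau *: (derive1 g t0 *m L)) (p *m L) != 0.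
Proof.
move=> tt gc; set e := derive1 g t0 *m L; have sP := gc_smooth gc.
apply/not_existsP => H.
have D0 : D (p *m L) by have [] := nbhs_singleton (gc_in gc) (gS It0).
have [_ tE _ sE] := nbhs_singleton (gc_out gc) D0.
rewrite (gc_base gc) in tE sE.
have [v vE] := (tE _).1 ((curve_tangent sS gS PE _ It0).2 (td_vel td It0)).
have JL := jacobian_linear sP (gc_linear gc).
have eE : v = e by rewrite /e vE -mulmxA JL mulmx1.
have H' i : hess Phi i e e (p *m L) = 0.
  have h1 := hessZl i tau e (tau *: e) sP.
  have h2 := hess_sym i e (tau *: e) sP.
  have h3 := hessZl i tau e e sP.
  have /negP/negPn/eqP h4 := H i.
  by rewrite -[LHS]mul1r -tt -mulrA -h3 -h2 -h1.
have z : 'D_e ('D_e Phi) (p *m L) = 0.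
  by apply/rowP => i; rewrite mxE; exact: (etrans (esym (hess_i i e e sP)) (H' i)).
have := td_nu td It0; rewrite -(sffE It0 (td_vel td It0)) vE eE.
by rewrite ((sE e e).2 z) eqxx.
Qed.

(** Common description of both cases: [b] is false at interior parameters, where [D] is a full
    neighbourhood, and true at end points, where [D] is a half-space. The vector [e] is the velocity
    of the curve in the chart, pointing inward at an end point. *)
Lemma local_chart : exists (L : 'M[R]_(N, m.+1)) (Phi : 'rV[R]_m.+1 -> 'rV[R]_N) (D : set 'rV[R]_m.+1) (i : 'I_N) (b : bool) (tau : R),
  let e := tau *: (derive1 g t0 *m L) in
  [/\ graph_chart S p L Phi D, hess Phi i e e (p *m L) != 0,
      \forall y \near p *m L, D y -> good_point Phi e i y,
      \forall y \near p *m L, D y <-> (b -> 0 <= ell Phi e i (p *m L) (y - p *m L)) &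
      [/\ tau * tau = 1, forall s, I s -> b -> 0 <= tau * (s - t0) &
          \forall t \near t0, (b -> 0 <= tau * (t - t0)) -> I t]].
Proof.
have [It0i|[nI [tau tau1 [g1 g2]]]] := interval_germ (td_int td) (td_ne td) It0.
- have [b' [U [phi [a Pa]]]] := sS (gS It0).
  have nb : ~ boundary m.+1 S p by move/(bdS It0).
  have nm := nonboundary_param Pa nb.
  have [psi [spsi psia nl nP gc]] := exists_graph_chart Pa (mul_rightinv (param_row_free Pa)).
  set L := rightinv _ in spsi psia nl nP gc.
  have nD : \forall y \near p *m L, model b' (psi y).
    have nm' : \forall x \near psi (p *m L), model b' x by rewrite psia.
    exact: (smooth_cont_near spsi nm').
  have [i hi] := curve_hess (mulr1 1) gc.
  set e := 1 *: _ in hi.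
  exists L, (fun y => phi (psi y)), (fun y => model b' (psi y)), i, false, 1; split=> //.
  + apply: (near_good_point (gc_smooth gc) hi).
      have nh : \forall y \near p *m L, hess (fun y => phi (psi y)) i e e y != 0.
        exact: (smooth_cont_near (smooth_hess i e e (gc_smooth gc)) (open_nbhs_nbhs (conj (@open_neq _ (0:R)) hi))).
      by apply: filterS2 nh (chart_kernel_cond e i gc dimS) => y hy; exact.
    by apply: filterS (near_join nD) => y ny _; exact: (near_line e ny).
  + by apply: filterS nD => y my; split.
  + split=> //; first by rewrite mulr1.
    by apply: filterS It0i => t It _.
have [U [phi [a [Pa bd]]]] := (bdS It0).2 nI.
have [psi [spsi psia nl nP gc]] := exists_graph_chart Pa (mul_rightinv (param_row_free Pa)).
set L := rightinv _ in spsi psia nl nP gc.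
have tt : tau * tau = 1 by case: tau1 => ->; rewrite ?mulr1// mulrNN mulr1.
have [i hi] := curve_hess tt gc.
set e := tau *: _ in hi.
(* The curve stays in [S], that is, in the region where this coordinate is nonnegative, when it
   leaves its end point in the direction [tau]. *)
have rho0 : 0 <= 'D_e (fun y => psi y 0 ord0) (p *m L).
  pose c (s : R) := g (t0 + s *: tau) *m L.
  have c0 : c 0 = p *m L by rewrite /c scale0r addr0.
  have sg := tube_sg td It0.
  have sc : smooth_at c 0 := smooth_curve_chart tau L It0.
  have srho : smooth_at (fun y => psi y 0 ord0) (c 0) by rewrite c0; exact: smooth_coord.
  have E := derive_comp (1 : R) (smooth_diff sc) (smooth_diff srho).
  rewrite (derive_curve_chart _ _ It0) c0 in E; rewrite -/e in E; rewrite -E.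
  have scr : smooth_at ((fun y => psi y 0 ord0) \o c) 0 := smooth_comp_rV sc srho.
  apply: derive_ge0_side; first exact: smooth_diff.
  have nS : \forall t \near t0, S (g t) -> model true (psi (g t *m L)).
    by apply: filterS (smooth_cont_near sg (gc_in gc)) => t H /H[].
  have l1 := near_line tau nS; have l2 := near_line tau g2.
  near=> s.
  have s0 : 0 < s by [].
  have H1 : S (g (t0 + s *: tau)) -> model true (psi (g (t0 + s *: tau) *m L)) by exact: (near l1 s).
  have H2 : 0 <= tau * (t0 + s *: tau - t0) -> I (t0 + s *: tau) by exact: (near l2 s).
  have Is : I (t0 + s *: tau).
    apply: H2; rewrite addrAC subrr add0r /GRing.scale /= mulrCA tt mulr1; exact: ltW.
  have := H1 (gS Is) ord0 erefl.
  by rewrite /comp add0r /GRing.scale /= mulr1 c0 psia bd.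
exists L, (fun y => phi (psi y)), (fun y => model true (psi y)), i, true, tau; split=> //.
- exact: (boundary_good_point rS Pa bd spsi psia nP gc hi rho0).
- apply: filterS (half_space_chart rS Pa bd spsi psia nP gc hi rho0) => y [h1 h2].
  by split=> [/h1|h]; [|apply: h2; exact: h].
- split; [exact: tt|by move=> s Is _; exact: g1|].
  by apply: filterS g2 => t H h; exact: (H (h isT)).
Unshelve. all: by end_near. Qed.

(** In the chart, [x] corresponds to a vector [v] in the kernel of [ell] at the parameter [u] of
    [g t]. By [leaf_closed], [u + v] lies in the domain and [Phi (u + v) = g t + x]. *)
Lemma contains_tube : exists2 d : R, 0 < d & forall t x, I t -> `|t - t0| < d ->
  leaf g P t x -> `|x| < d -> S (g t + x).
Proof.
have [L [Phi [D [i [b [tau [gc h0 nG nD [tt g1 g2]]]]]]]] := local_chart.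
set e := tau *: _ in h0 nG nD; set y0 := p *m L in h0 nG nD.
have sc := smooth_curve_chart tau L It0.
have c0 : g (t0 + (0 : R) *: tau) *m L = y0 by rewrite scale0r addr0.
have [r r0 cl] := leaf_closed (gc_smooth gc) nG nD.
have nS := smooth_near (gc_smooth gc); have nL := near_join (gc_linear gc).
have nO := gc_out gc; have sg := tube_sg td It0.
have r2 : 0 < r / 2 by rewrite divr_gt0.
pose Q y := [/\ `|y - y0| < r / 2, D y -> good_point Phi e i y,
  \forall z \near y, Phi z *m L = z & D y -> [/\ S (Phi y),
        forall x, tangent m.+1 S (Phi y) x <-> exists v, x = v *m jacobian Phi y,
        forall v, nullity m.+1 S (Phi y) (v *m jacobian Phi y) <-> forall w, 'D_v ('D_w Phi) y = 0 &
        forall v w, sff m.+1 S (Phi y) (v *m jacobian Phi y) (w *m jacobian Phi y) = 0 <->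
          'D_v ('D_w Phi) y = 0]].
have nQ : \forall y \near y0, Q y.
  have nb := ball_near y0 r2.
  near=> y; split; [exact: (near nb y)|exact: (near nG y)|exact: (near nL y)|exact: (near nO y)].
have sgL : smooth_at (fun t => g t *m L) t0 by apply: smooth_mulmx => //; exact: smooth_cst.
have n1 : \forall t \near t0, Q (g t *m L) := smooth_cont_near sgL nQ.
have n2 : \forall t \near t0, S (g t) -> D (g t *m L) /\ Phi (g t *m L) = g t.
  exact: (smooth_cont_near sg (gc_in gc)).
have n3 : \forall x \near (0 : 'rV[R]_N), `|x *m L| < r / 2.
  have sL : smooth_at (fun x : 'rV[R]_N => x *m L) 0.
    by apply: smooth_mulmx; [exact: smooth_id|exact: smooth_cst].
  have nb : \forall z \near (0 : 'rV[R]_N) *m L, `|z - 0 *m L| < r / 2 by exact: ball_near.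
  by apply: filterS (smooth_cont_near sL nb) => x; rewrite mul0mx subr0.
have n4 : \forall y \near y0, D y -> S (Phi y) by apply: filterS nO => y H /H[].
have [r4 r4_gt0 B4] := (near0P y0 (fun y => D y -> S (Phi y))).1 n4.
have n5 : \forall t \near t0, `|g t *m L - y0| < r4 / 2.
  by apply: (smooth_cont_near sgL (ball_near y0 _)); rewrite divr_gt0.
have n6 : \forall x \near (0 : 'rV[R]_N), `|x *m L| < r4 / 2.
  have sL : smooth_at (fun x : 'rV[R]_N => x *m L) 0.
    by apply: smooth_mulmx; [exact: smooth_id|exact: smooth_cst].
  have r42 : 0 < r4 / 2 by rewrite divr_gt0.
  have nb : \forall z \near (0 : 'rV[R]_N) *m L, `|z - 0 *m L| < r4 / 2 by exact: ball_near.
  by apply: filterS (smooth_cont_near sL nb) => x; rewrite mul0mx subr0.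
have [d1 d1_gt0 B1] := (near0P t0 _).1 (filterI n1 (filterI n2 n5)).
have [d2 d2_gt0 B2] := (near0P (0 : 'rV[R]_N) _).1 (filterI n3 n6).
exists (Num.min d1 d2); first by rewrite lt_min d1_gt0.
move=> t x It; rewrite lt_min => /andP[ht _] lx; rewrite lt_min => /andP[_ hx].
have [[hb gp nl out] [inn hb4]] := B1 t ht.
have [hx2 hx4] : `|x *m L| < r / 2 /\ `|x *m L| < r4 / 2 by apply: B2; rewrite subr0.
set u := g t *m L in hb gp nl out inn hb4.
have [Du Phiu] := inn (gS It).
have [_ tE nE _] := out Du; have [sP hu _ _] := gp Du.
rewrite Phiu in tE nE.
rewrite -(nullity_leaf It) in lx.
have [v xE] := (tE _).1 lx.1.
have JL := jacobian_linear sP nl.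
have vE : x *m L = v by rewrite xE -mulmxA JL mulmx1.
have Kv : forall w, 'D_v ('D_w Phi) u = 0 by apply/nE; rewrite -xE.
have lv : ell Phi e i u v = 0.
  have h1 := hess_i i v e sP; rewrite (Kv e) mxE in h1.
  by rewrite /ell h1 mul0r.
pose y := u + v.
have yu : y - u = v by rewrite /y addrAC subrr add0r.
have hy (r' : R) : `|u - y0| < r' / 2 -> `|x *m L| < r' / 2 -> `|y - y0| < r'.
  by rewrite vE /y addrAC; exact: normD_half.
have r20 : `|0 : 'rV[R]_m.+1| < r / 2 by rewrite normr0.
have ur : `|u - y0| < r by rewrite -[u - y0]addr0; exact: (normD_half hb r20).
have ey : ell Phi e i u (y - u) = 0 by rewrite yu.
have [Dy _ PhiE] := cl u y ur (hy r hb hx2) Du ey.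
have := B4 y (hy r4 hb4 hx4) Dy.
by rewrite PhiE yu (deriveEjacobian v (smooth_diff sP)) -xE Phiu.
Unshelve. all: by end_near. Qed.

(** [meets_curve] gives a parameter [t] for which the leaf of [q] passes through [g t].
    [leaf_closed] is then used twice: from [q] to [g t], to see that [ell] is the same at both, and
    back from [g t] to [q], to write [q] as [g t] plus a vector of its leaf. *)
Lemma contained_in_tube (d : R) : 0 < d -> \forall q \near p, S q ->
  exists t x, [/\ I t, `|t - t0| < d, leaf g P t x, `|x| < d & q = g t + x].
Proof.
move=> d0; have [L [Phi [D [i [b [tau [gc h0 nG nD [tt g1 g2]]]]]]]] := local_chart.
set e := tau *: _ in h0 nG nD; set y0 := p *m L in h0 nG nD.
have sc := smooth_curve_chart tau L It0.
have c0 : g (t0 + (0 : R) *: tau) *m L = y0 by rewrite scale0r addr0.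
have dc := derive_curve_chart tau L It0.
have [r r0 cl] := leaf_closed (gc_smooth gc) nG nD.
have nO := gc_out gc; have sg := tube_sg td It0.
have d2 : 0 < d / 2 by rewrite divr_gt0.
have sgL : smooth_at (fun t => g t *m L) t0 by apply: smooth_mulmx => //; exact: smooth_cst.
have n1 : \forall t \near t0, S (g t) -> D (g t *m L) /\ Phi (g t *m L) = g t.
  exact: (smooth_cont_near sg (gc_in gc)).
have n2 : \forall t \near t0, `|g t - p| < d / 2 := smooth_cont_near sg (ball_near p d2).
have n3 : \forall t \near t0, `|g t *m L - y0| < r := smooth_cont_near sgL (ball_near y0 r0).
have n4 : \forall t \near t0, D (g t *m L) -> good_point Phi e i (g t *m L).
  exact: (smooth_cont_near sgL nG).
have n5 : \forall t \near t0, D (g t *m L) -> [/\ S (Phi (g t *m L)),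
        forall x, tangent m.+1 S (Phi (g t *m L)) x <-> exists v, x = v *m jacobian Phi (g t *m L),
        forall v, nullity m.+1 S (Phi (g t *m L)) (v *m jacobian Phi (g t *m L)) <->
          forall w, 'D_v ('D_w Phi) (g t *m L) = 0 &
        forall v w, sff m.+1 S (Phi (g t *m L)) (v *m jacobian Phi (g t *m L))
          (w *m jacobian Phi (g t *m L)) = 0 <-> 'D_v ('D_w Phi) (g t *m L) = 0].
  exact: (smooth_cont_near sgL nO).
have [k k0 B] := (near0P t0 _).1 (filterI n1 (filterI n2 (filterI n3 (filterI n4 (filterI n5 g2))))).
have d'0 : 0 < Num.min k d by rewrite lt_min k0.
have nM := meets_curve (gc_smooth gc) h0 nG nD sc c0 dc d'0.
have sL : smooth_at (fun q : 'rV[R]_N => q *m L) p.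
  by apply: smooth_mulmx; [exact: smooth_id|exact: smooth_cst].
have m1 := smooth_cont_near sL nM.
have m2 : \forall q \near p, `|q *m L - y0| < r := smooth_cont_near sL (ball_near y0 r0).
have m3 := ball_near p d2; have m4 := gc_in gc.
have m5 : \forall q \near p, smooth_at Phi (q *m L) := smooth_cont_near sL (smooth_near (gc_smooth gc)).
near=> q => Sq.
have [Dq Phiq] : D (q *m L) /\ Phi (q *m L) = q by move: Sq; exact: (near m4 q).
have hq : `|q *m L - y0| < r by exact: (near m2 q).
have hqp : `|q - p| < d / 2 by exact: (near m3 q).
have sq : smooth_at Phi (q *m L) by exact: (near m5 q).
have [s [sk bs es]] : exists s : R, [/\ `|s| < Num.min k d, b -> 0 <= s &
    ell Phi e i (q *m L) (g (t0 + s *: tau) *m L - q *m L) = 0].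
  by move: Dq; exact: (near m1 q).
pose t := t0 + s *: tau; rewrite -/t in es.
have tau1 : `|tau| = 1.
  have : `|tau| * `|tau| = 1 by rewrite -normrM tt normr1.
  by move: (normr_ge0 tau); move: `|tau| => z z0 zz; nra.
have tt0 : t - t0 = s * tau by rewrite /t addrAC subrr add0r.
have ht : `|t - t0| < Num.min k d by rewrite tt0 normrM tau1 mulr1.
move: (ht); rewrite lt_min => /andP[htk htd].
have [inn [gtp [ur [gp [out It']]]]] := B t htk.
have It : I t by apply: It' => /bs s0; rewrite tt0 mulrCA tt mulr1.
have [Du Phiu] := inn (gS It).
have [_ tE nE _] := out Du; have [sP hu Ku _] := gp Du.
set u := g t *m L in es gtp ur Du Phiu tE nE sP hu Ku.
have [_ ellE _] := cl _ u hq ur Dq es.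
have es' : ell Phi e i u (q *m L - u) = 0.
  have h := ellZ e i (-1) (u - q *m L) sq.
  by rewrite ellE -opprB -scaleN1r h es mulr0.
have [_ _ PhiE] := cl u _ ur hq Du es'.
rewrite Phiq Phiu (deriveEjacobian (q *m L - u) (smooth_diff sP)) in PhiE.
exists t, (q - g t); split; [exact: It|exact: htd| | |].
- have E : q - g t = (q *m L - u) *m jacobian Phi u by rewrite {1}PhiE addrAC subrr add0r.
  by rewrite -(nullity_leaf It) E -Phiu; exact: ((nE _).2 (Ku _ es')).
- have -> : q - g t = (q - p) + (p - g t) by rewrite addrA subrK.
  by apply: (normD_half hqp); rewrite distrC.
- by rewrite addrCA subrr addr0.
Unshelve. all: by end_near. Qed.

End AtPoint.

End Uniqueness.

Section Unique.
Context {R : realType} {N m : nat}.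
Variables (M : set 'rV[R]_N) (I : set R) (g : R -> 'rV[R]_N) (P : R -> 'M[R]_N).
Hypothesis td : tube_data (m := m) I g P.
Hypothesis PE : forall t, I t -> P t = tproj (tangent m.+1 M (g t)).

(** Both approximations have the tangent spaces of [M] along the curve, hence the same [P] and the
    same leaves; near [g t] the first consists of points of the tube, and the second contains
    them. *)
Lemma approximation_sub S1 S2 t : rank_one_approximation m.+1 M I g S1 ->
  rank_one_approximation m.+1 M I g S2 -> I t -> \forall q \near g t, S1 q -> S2 q.
Proof.
move=> [r1 [_ g1 T1 b1 _]] [r2 [_ g2 T2 b2 _]] It.
have PE1 s : I s -> P s = tproj (tangent m.+1 S1 (g s)) by move=> Is; rewrite (T1 s Is); exact: PE.
have PE2 s : I s -> P s = tproj (tangent m.+1 S2 (g s)) by move=> Is; rewrite (T2 s Is); exact: PE.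
have gS1 s : I s -> S1 (g s) by move=> Is; apply: g1; exists s.
have gS2 s : I s -> S2 (g s) by move=> Is; apply: g2; exists s.
have [d d0 sub] := contains_tube td r2 gS2 PE2 b2 It.
apply: filterS (contained_in_tube td r1 gS1 PE1 b1 It d0) => q H /H[s [x [Is hs lx hx ->]]].
exact: (sub s x Is hs lx hx).
Qed.

Lemma approximation_unique S1 S2 : rank_one_approximation m.+1 M I g S1 ->
  rank_one_approximation m.+1 M I g S2 ->
  exists O : set 'rV[R]_N, [/\ open O, g @` I `<=` O & S1 `&` O = S2 `&` O].
Proof.
move=> a1 a2; exists ([set q | S1 q <-> S2 q]°)%classic; split.
- exact: open_interior.
- move=> _ [t It <-]; apply: filterS2 (approximation_sub a1 a2 It) (approximation_sub a2 a1 It).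
  by move=> q; split.
- by apply/seteqP; split=> q [Sq /[dup] Oq /interior_subset h]; split=> //; exact/h.
Qed.

End Unique.

(** * Orthonormal frames along a compact curve *)

Section Frames.
Context {R : realType} {N : nat}.

Lemma class_C_sqrt k : class_C k [set x : R | 0 < x] (Num.sqrt : R -> R).
Proof.
elim: k => [|k IH] /=; first by move=> x _; exact: sqrt_continuous.
split=> [x x0|v]; first by apply/derivable1_diffP; have [] := is_derive1_sqrt x0.
have oU : open [set x : R | 0 < x] by exact: open_gt.
apply: (@class_C_eq _ _ _ _ _ (fun x => v * (2 * Num.sqrt x)^-1)) => //.
  move=> x /= x0; have [dx ex] := is_derive1_sqrt x0.
  have df : differentiable (Num.sqrt : R -> R) x by apply/derivable1_diffP.
  have := derive_dirZ v (1 : R) df.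
  rewrite [v *: 1]mulr1 => h; apply: (etrans _ (esym h)).
  by rewrite ex.
apply: class_CM => //; first exact: class_C_cst.
apply: class_CV => //; first by move=> x /= x0; rewrite mulf_neq0// gt_eqF// sqrtr_gt0.
by apply: class_CM => //; exact: class_C_cst.
Qed.

Lemma smooth_sqrt (V : normedModType R) (f : V -> R) x : 0 < f x -> smooth_at f x ->
  smooth_at (fun y => Num.sqrt (f y)) x.
Proof.
move=> f0 sf; apply: smooth_comp_scal => //; apply/smooth_atE.
exists [set x : R | 0 < x]; split; [exact: open_gt|exact: f0|exact: class_C_sqrt].
Qed.

Lemma uniform_projections (I : set R) (Q : R -> 'M[R]_N) (eps : R) : compact I -> smooth_on I Q ->
  0 < eps -> exists2 d : R, 0 < d & forall s t, I s -> I t -> `|s - t| < d -> `|Q s - Q t| < eps.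
Proof.
move=> cI /smooth_onP sQ e0; have nc := (compact_near_coveringP I).1 cI.
have e2 : 0 < eps / 2 by rewrite divr_gt0.
pose good (d t : R) := forall s, I s -> `|s - t| < d -> `|Q s - Q t| < eps.
have H : \forall d \near (0 : R)^'+, I `<=` (fun t => I t -> good d t).
  apply: nc => t It.
  have [r r0 B] := (near0P t (fun s => `|Q t - Q s| < eps / 2)).1 (cont_dist (smooth_cont (sQ t It)) e2).
  have r20 : 0 < r / 2 by rewrite divr_gt0.
  exists ([set t' | `|t' - t| < r / 2], [set s | 0 < s < r / 2]) => /=.
    have n : \forall t' \near t, `|t' - t| < r / 2 by exact: ball_near.
    split; first exact: n.
    by apply: filterS2 (nbhs_right_gt 0) (nbhs_right_lt r20) => s s0 sr; apply/andP.
  move=> [t' d] [/= tt' /andP[d0 dr]] It' s Is st'.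
  have h1 : `|Q t - Q t'| < eps / 2 by apply: B; lra.
  have h2 : `|Q t - Q s| < eps / 2.
    apply: B; rewrite -(subrK t' s) -addrA; apply: normD_half => //; exact: lt_trans dr.
  rewrite -(subrK (Q t) (Q s)) -addrA; apply: normD_half => //.
  by rewrite distrC.
have [d [d0 Hd]] : exists d : R, 0 < d /\ I `<=` (fun t => I t -> good d t).
  by apply: (@filter_ex _ ((0:R)^'+)); apply: filterI H; exact: nbhs_right_gt.
by exists d => // s t Is It; apply: (Hd t It It).
Qed.

(* Transporting a vector from [a] to [t] by projecting it successively on the subspaces at
   [a + (t - a) j / K], for [j = 1, ..., K]: smooth in [t], as all steps depend affinely
   on [t], and nonzero, as the steps are short. *)
Lemma unit_section (I : set R) (Q : R -> 'M[R]_N) : is_interval I -> compact I -> I !=set0 ->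
  smooth_on I Q -> (forall t, I t -> Q t *m Q t = Q t) -> (forall t, I t -> Q t != 0) ->
  exists2 e : R -> 'rV[R]_N, smooth_on I e &
    forall t, I t -> e t *m Q t = e t /\ dot (e t) (e t) = 1.
Proof.
move=> hI cI [a Ia] sQ QQ Q0.
(* With consecutive projections closer than [1 / N.+1] and the factor [N] of [mulmx_norm], a
   projection step moves a nonzero vector by less than its norm, and so cannot annihilate it. *)
have eps0 : 0 < (N.+1%:R : R)^-1 by rewrite invr_gt0.
have [d d0 U] := uniform_projections cI sQ eps0.
have [C HC] : exists C : R, forall t, I t -> `|t - a| <= C.
  have [C [_ HC]] := compact_bounded cI.
  exists (C + 1 + `|a|) => t It; apply: le_trans (ler_normB _ _) _; rewrite lerD2r.
  by apply: (HC (C + 1)); rewrite ?ltrDl.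
(* The number of steps is the same for all [t], and each step has length at most [C / K < d]. *)
pose K := (Num.truncn (C / d)).+1.
have KC : C / d < K%:R by rewrite /K; exact: truncnS_gt.
have K0 : 0 < (K%:R : R) by [].
pose tau (j : nat) (t : R) := a + (t - a) * (j%:R / K%:R).
have Itau j t : (j <= K)%N -> I t -> I (tau j t).
  move=> jK It; have c0 : 0 <= (j%:R / K%:R : R) by rewrite divr_ge0.
  have c1 : (j%:R / K%:R : R) <= 1 by rewrite ler_pdivrMr// mul1r ler_nat.
  have [ta|ta] := lerP a t; first by apply: (hI a t) => //; apply/andP; split; rewrite /tau; nra.
  by apply: (hI t a) => //; apply/andP; split; rewrite /tau; nra.
have tauS j t : I t -> `|tau j.+1 t - tau j t| < d.
  move=> It; have -> : tau j.+1 t - tau j t = (t - a) / K%:R.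
    by rewrite /tau -natr1; field; rewrite gt_eqF.
  rewrite normrM (gtr0_norm (_ : 0 < K%:R^-1)) ?invr_gt0// ltr_pdivrMr//.
  apply: le_lt_trans (HC t It) _; rewrite mulrC; move: KC; by rewrite ltr_pdivrMr.
have [v v0] : exists v : 'rV[R]_N, v *m Q a != 0.
  apply/not_existsP => H; move: (Q0 a Ia); apply/negP/negPn/eqP.
  by apply/row_matrixP => i; rewrite row0 rowE; apply/eqP/negPn/negP; exact: H.
pose fix w (j : nat) (t : R) {struct j} : 'rV[R]_N := if j is j'.+1 then w j' t *m Q (tau j t) else v *m Q a.
have w_ok j t : (j <= K)%N -> I t -> [/\ smooth_at (w j) t, w j t != 0 & w j t *m Q (tau j t) = w j t].
  move=> + It; elim: j => [_|j IH jK].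
    split=> //=; first exact: smooth_cst.
    by rewrite /tau mul0r mulr0 addr0 -mulmxA QQ.
  have [sw wn wQ] := IH (ltnW jK); have Ij := Itau _ _ jK It.
  have /smooth_onP sQ' := sQ.
  split=> /=; last by rewrite -mulmxA QQ.
    apply: smooth_mulmx => //; apply: smooth_comp_R; last exact: sQ'.
    apply: smoothD; first exact: smooth_cst.
    apply: smoothM; last exact: smooth_cst.
    by apply: smoothD; [exact: smooth_id|exact: smooth_cst].
  apply: contra_neq wn => w0.
  have E : w j t = w j t *m (Q (tau j t) - Q (tau j.+1 t)) by rewrite mulmxBr wQ w0 subr0.
  have h1 := U _ _ (Itau _ _ (ltnW jK) It) Ij; rewrite distrC in h1; have {}h1 := h1 (tauS j t It).
  have h2 := mulmx_norm (w j t) (Q (tau j t) - Q (tau j.+1 t)); rewrite -E in h2.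
  apply/eqP; rewrite -normr_eq0; apply/eqP/le_anti; rewrite normr_ge0 andbT leNgt; apply/negP => wpos.
  have h3 : N%:R * (`|w j t| * `|Q (tau j t) - Q (tau j.+1 t)|) <= N%:R * (`|w j t| * N.+1%:R^-1).
    by rewrite ler_wpM2l// ler_wpM2l// ltW.
  have := le_trans h2 h3; rewrite leNgt => /negP; apply.
  rewrite mulrCA -[ltRHS]mulr1 ltr_pM2l// ltr_pdivrMr// mul1r ltr_nat//.
have tauK t : tau K t = t by rewrite /tau divff ?mulr1 ?gt_eqF// addrC subrK.
have wK t : I t -> [/\ smooth_at (w K) t, 0 < dot (w K t) (w K t) & w K t *m Q t = w K t].
  move=> It; have [sw wn wQ] := w_ok K t (leqnn _) It; rewrite tauK in wQ; split=> //.
  by rewrite lt_neqAle dot_ge0 andbT eq_sym; apply: contra wn => /eqP/dot_eq0/eqP.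
exists (fun t => (Num.sqrt (dot (w K t) (w K t)))^-1 *: w K t).
  apply/smooth_onP => t It; have [sw wp _] := wK t It.
  apply: smoothZ => //; apply: smoothV; first by rewrite gt_eqF// sqrtr_gt0.
  by apply: smooth_sqrt => //; exact: smooth_dot.
move=> t It; have [_ wp wQ] := wK t It; split; first by rewrite -scalemxAl wQ.
rewrite dotZl dotC dotZl; set q := dot _ _ in wp *.
by rewrite mulrA -invfM -expr2 sqr_sqrtr ?ltW// mulVf// gt_eqF.
Qed.

End Frames.

Section FrameExistence.
Context {R : realType} {N m : nat}.
Variables (M : set 'rV[R]_N) (I : set R) (g : R -> 'rV[R]_N) (P : R -> 'M[R]_N).
Hypothesis td : tube_data (m := m) I g P.
Hypothesis PE : forall t, I t -> P t = tproj (tangent m.+1 M (g t)).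
Hypothesis MT : forall t, I t -> forall y, tangent m.+1 M (g t) y <-> y *m P t = y.

(** The normal acceleration [nu] is a choice: if the tangential part of its derivative were zero,
    [normal_derive] would give [nu *m (shape_mx P t)^T = 0], and pairing with the velocity
    [dot nu nu = 0]. *)
Lemma exists_admissible_normal : exists nu, admissible_normal m.+1 M I g nu.
Proof.
pose nu t := derive1 (derive1 g) t *m (1%:M - P t).
have nuE t : I t -> nu t = derive1 g t *m shape_mx P t.
  move=> It; apply: (nor_derive td It (tube_sdg td It)).
  by near=> s => Is; exact: (td_vel td Is).
have snu t : I t -> smooth_at nu t.
  move=> It; apply: smooth_mulmx.
    have -> : derive1 (derive1 g) = 'D_1 (derive1 g) by apply/funext => s; rewrite derive1E.
    exact: (smooth_derive _ (tube_sdg td It)).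
  by apply: smoothB; [exact: smooth_cst|exact: (tube_sP td It)].
have nuP t : I t -> nu t *m P t = 0.
  by move=> It; rewrite /nu -mulmxA mulmxBl mul1mx (tube_PP td It) subrr mulmx0.
exists nu; split; first by apply/smooth_onP.
  move=> t It x /(MT It) xP; have [B rB PB] := td_basis td It.
  have PT : (P t)^T = P t by rewrite PB projmx_tr.
  have Pnu : P t *m (nu t)^T = 0 by rewrite -{1}PT -trmx_mul nuP// trmx0.
  by rewrite dotC dot_mx -xP -mulmxA Pnu mulmx0 mxE.
move=> t It; have [B rB PB] := td_basis td It.
have TE x : tangent m.+1 M (g t) x <-> exists v, x = v *m B.
  by rewrite (MT It) PB; exact: projmx_id.
rewrite (orthprojE _ rB TE) -PB (normal_derive td It (snu t It) nuP) oppr_eq0.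
apply: contra (tube_nu0 td It) => /eqP E; apply/eqP/dot_eq0.
rewrite -nuE// {2}nuE// dot_mx trmx_mul mulmxA E.
by rewrite mul0mx mxE.
Unshelve. all: by end_near. Qed.

Definition orthonormal_sections k (F : nat -> R -> 'rV[R]_N) :=
  forall i t, (i < k)%N -> I t -> [/\ smooth_at (F i) t, F i t *m P t = F i t &
    forall j, (j < k)%N -> dot (F i t) (F j t) = (i == j)%:R].

(** [Q] projects onto the part of the tangent space orthogonal to the given sections. It is nonzero,
    as [k <= m] sections cannot span dimension [m.+1], so [unit_section] supplies the next
    vector. *)
Lemma extend_sections k F : compact I -> (k <= m)%N -> orthonormal_sections k F ->
  exists F', orthonormal_sections k.+1 F' /\ forall i, (i < k)%N -> F' i = F i.
Proof.
move=> cI km oF.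
pose A t : 'M[R]_(k, N) := \matrix_(i < k) F i t.
pose Q t := P t - (A t)^T *m A t.
have AP t : I t -> A t *m P t = A t.
  move=> It; apply/row_matrixP => i; rewrite row_mul !rowK.
  by have [] := oF i t (ltn_ord i) It.
have AA t : I t -> A t *m (A t)^T = 1%:M.
  move=> It; apply/matrixP => i j; have [_ _ o] := oF i t (ltn_ord i) It.
  rewrite !mxE -val_eqE -(o j (ltn_ord j)) /dot.
  by apply: eq_bigr => l _; rewrite !mxE.
have PT t : I t -> (P t)^T = P t.
  by move=> It; have [B _ ->] := td_basis td It; exact: projmx_tr.
have PAT t : I t -> P t *m (A t)^T = (A t)^T.
  by move=> It; rewrite -{1}(PT t It) -trmx_mul AP.
have sA t : I t -> smooth_at A t.
  move=> It; apply/smooth_mxP => i j; have [sF _ _] := oF i t (ltn_ord i) It.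
  apply: (@smooth_at_eq _ _ _ (fun t => F i t 0 j)); last exact: smooth_coord.
  by near=> s; rewrite mxE.
have sQ : smooth_on I Q.
  apply/smooth_onP => t It; apply: smoothB; first exact: (tube_sP td It).
  by apply: smooth_mulmx; [apply: smooth_tr|]; exact: sA.
have QP t : I t -> Q t *m P t = Q t.
  by move=> It; rewrite /Q mulmxBl (tube_PP td It) -mulmxA AP.
have QA t : I t -> Q t *m (A t)^T = 0.
  by move=> It; rewrite /Q mulmxBl PAT// -mulmxA AA// mulmx1 subrr.
have QQ t : I t -> Q t *m Q t = Q t.
  by move=> It; rewrite {2}/Q mulmxBr QP// mulmxA QA// mul0mx subr0.
have Q0 t : I t -> Q t != 0.
  move=> It; apply/eqP => /subr0_eq E; have [B rB PB] := td_basis td It.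
  have BP : B *m P t = B by rewrite PB mul_projmx.
  have h1 : (\rank (B *m P t) <= \rank (A t))%N.
    by rewrite E mulmxA; exact: mxrankM_maxr.
  have h2 := rank_leq_row (A t).
  move: rB; rewrite /row_free -{1}BP => /eqP h3.
  by move: (leq_trans h1 h2); rewrite h3 ltnNge km.
have [t0 It0] := td_ne td; have It0' := interior_subset It0.
have [e se eE] := unit_section (td_int td) cI (ex_intro _ t0 It0') sQ QQ Q0.
have eP t : I t -> e t *m P t = e t.
  by move=> It; have [eQ _] := eE t It; rewrite -eQ -mulmxA QP.
have eF i t : (i < k)%N -> I t -> dot (e t) (F i t) = 0.
  move=> ik It; have [eQ _] := eE t It.
  have : e t *m (A t)^T = 0 by rewrite -eQ -mulmxA QA// mulmx0.
  move=> /(congr1 (fun z : 'rV[R]_k => z 0 (Ordinal ik))); rewrite !mxE => <-.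
  by apply: eq_bigr => l _; rewrite !mxE.
exists (fun i => if (i < k)%N then F i else e); split; last by move=> i ->.
move=> i t; rewrite ltnS leq_eqVlt => /orP[/eqP ->|ik] It.
  rewrite ltnn; have [_ ee] := eE t It; split; [by move/smooth_onP: se; exact|exact: eP|].
  move=> j; rewrite ltnS leq_eqVlt => /orP[/eqP ->|jk]; first by rewrite ltnn ee eqxx.
  by rewrite jk eF// gtn_eqF.
rewrite ik; have [sF FP o] := oF i t ik It; split=> // j.
rewrite ltnS leq_eqVlt => /orP[/eqP ->|jk]; last by rewrite jk o.
by rewrite ltnn dotC eF// ltn_eqF.
Unshelve. all: by end_near. Qed.

Lemma exists_tangent_frame : compact I -> (forall t, I t -> dot (derive1 g t) (derive1 g t) = 1) ->
  exists E, tangent_frame m.+1 M I g E.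
Proof.
move=> cI unit.
have H k : (k <= m)%N -> exists F, orthonormal_sections k.+1 F /\ F 0%N = derive1 g.
  elim: k => [_|k IH km].
    exists (fun _ => derive1 g); split=> // i t; rewrite ltnS leqn0 => /eqP -> It.
    split; [exact: (tube_sdg td It)|exact: (td_vel td It)|].
    by move=> j; rewrite ltnS leqn0 => /eqP ->; rewrite unit// eqxx.
  have [F [oF F0]] := IH (ltnW km); have [F' [oF' E]] := extend_sections cI km oF.
  by exists F'; split=> //; rewrite E.
(* The sections are numbered from [0] and the frame from [1], whence the shift of index. *)
have [F [oF F0]] := H m (leqnn m); exists (fun i => F i.-1); split.
- case=> [//|i] /= im; apply/smooth_onP => t It.
  by have [] := oF i t im It.
- case=> [//|i] t /= im It; apply/(MT It).
  by have [] := oF i t im It.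
- case=> [//|i] [//|j] t /= im jm It.
  by have [_ _ o] := oF i t im It; rewrite o.
- by move=> t It /=; rewrite F0.
Qed.

End FrameExistence.

Theorem theorem6p1 (R : realType) (m n : nat) (hm : (2 <= m)%N) (hn : (1 <= n)%N)
  (M : set 'rV[R]_(m + n))
  (hM : submanifold m M) (hM0 : boundary m M = set0)
  (I : set R) (hI : is_interval I) (hI0 : I° !=set0)
  (g : R -> 'rV[R]_(m + n))
  (hgM : g @` I `<=` M)
  (hg : smooth_on I g)
  (hreg : forall t, I t -> derive1 g t != 0)
  (hemb : embeds I g)
  (hasym : forall t, I t -> sff m M (g t) (derive1 g t) (derive1 g t) != 0)
  (hrank : forall t, I t ->
     has_dim (sff m M (g t) (derive1 g t) @` tangent m M (g t)) 1) :
  [/\ exists S, rank_one_approximation m M I g S,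
      forall S1 S2, rank_one_approximation m M I g S1 ->
        rank_one_approximation m M I g S2 ->
        exists O : set 'rV[R]_(m + n),
          [/\ open O, g @` I `<=` O & S1 `&` O = S2 `&` O] &
      compact I -> (forall t, I t -> dot (derive1 g t) (derive1 g t) = 1) ->
        [/\ exists E, tangent_frame m M I g E,
            exists nu, admissible_normal m M I g nu &
            forall E nu, tangent_frame m M I g E ->
              admissible_normal m M I g nu ->
              \forall e \near 0^'+,
                rank_one_approximation m M I g (ruled_image m I g E nu e)]].
Proof.
(* The dimension is written [m.+1]: one time coordinate and [m] coordinates along the leaves. *)
case: m hm M hM hM0 g hgM hg hreg hemb hasym hrank => [//|m] _ M hM _ g hgM hg _ hemb hasym hrank.
have [P td PE] := exists_tube_data hM hI hI0 hgM hg hemb hasym hrank.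
have MT t (It : I t) := M_tangent hM hgM PE It.
split; first exact: (exists_rank_one_approximation hM hgM td PE).
  by move=> S1 S2; exact: (approximation_unique td PE).
move=> cI unit; split.
- exact: (exists_tangent_frame td MT cI unit).
- exact: (exists_admissible_normal td MT).
- by move=> E nu hE hnu; exact: (ruled_image_approximation hM hgM td PE cI hE hnu).
Qed.
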